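(* For all $g\ge0$, $k,l\ge1$ and every $W\in\overline{\mathcal{W}_{k,l}}$ there exists a polynomial $P^g_W$ in the variables $L=(L_1,\dots,L_k)$, $L'=(L'_1,\dots,L'_l)$, homogeneous of degree $2g$ (or identically zero), such that for all $(L,L')\in\mathbb{Z}^k\times\mathbb{Z}^l$ belonging to $H^+_{k,l}\cap W^\circ$ we have $$\mathcal{P}^g_{k,l}(L,L')=P^g_W(L,L')+\text{terms of degree at most }2g-1,$$ where the ''terms of degree at most $2g-1$'' are given by a polynomial in $L,L'$ of degree at most $2g-1$ on (the integer points of) each connected component of $H^+_{k,l}\cap W^\circ$ (this polynomial may depend on the component).
   Context: A ribbon graph is a connected graph (loops and multiple edges allowed) with a circular ordering of the adjacent edges (half-edges) at each vertex; isomorphisms are graph isomorphisms respecting the circular orderings. Thickening it gives an oriented surface with boundary, so a ribbon graph has a genus $g$ and boundary components, with $V-E+F=2-2g$ ($F$ = number of boundary components). An integral metric is an assignment of a positive integer length to every edge; the perimeter of a boundary component is the sum of lengths of the edges along it. For $g\ge0$, $k,l\ge1$, $\mathcal{E}_{g,k,l}$ is the set of isomorphism classes of genus $g$ ribbon graphs with one vertex, $k$ black boundary components labeled $1,\dots,k$ and $l$ white boundary components labeled $1,\dots,l$, such that the two boundary components on the two sides of any edge have opposite colors (isomorphisms preserve colors and labels). For $G\in\mathcal{E}_{g,k,l}$, $L\in\mathbb{Z}^k$, $L'\in\mathbb{Z}^l$, $\mathcal{P}_G(L,L')$ is the number of integral metrics on $G$ giving the black boundary components perimeters $L_1,\dots,L_k$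 and the white ones perimeters $L'_1,\dots,L'_l$. Define $$\mathcal{P}^g_{k,l}(L,L')=\sum_{G\in\mathcal{E}_{g,k,l}}\frac{1}{|\operatorname{Aut}(G)|}\,\mathcal{P}_G(L,L').$$ $H_{k,l}\subset\mathbb{R}^k\times\mathbb{R}^l$ is the hyperplane $L_1+\dots+L_k=L'_1+\dots+L'_l$, and $H^+_{k,l}=H_{k,l}\cap(\mathbb{R}_{>0}^k\times\mathbb{R}_{>0}^l)$. $\mathcal{W}_{k,l}$ is the set of hyperplanes of $H_{k,l}$ of the form $\sum_{i\in I}L_i=\sum_{j\in J}L'_j$ with $I\subset\{1,\dots,k\}$, $J\subset\{1,\dots,l\}$, $(I,J)\ne(\varnothing,\varnothing)$, $(I^c,J^c)\ne(\varnothing,\varnothing)$. $\overline{\mathcal{W}_{k,l}}$ is the set of linear subspaces of $H_{k,l}$ that are intersections of several hyperplanes from $\mathcal{W}_{k,l}$ (the empty intersection being $H_{k,l}$). For $W\in\overline{\mathcal{W}_{k,l}}$, $W^\circ=W\setminus\bigcup_{V\in\overline{\mathcal{W}_{k,l}},\,V\subsetneq W}V$. A polynomial of degree at most $-1$ is the zero polynomial. *)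

(* Defs.v *)
From HB Require Import structures.
From mathcomp Require Import all_boot all_order all_algebra all_fingroup finmap zify.
From mathcomp Require Import all_classical all_reals topology normedtype.
(* Some notations of mpoly have levels that clash with those of
   MathComp-Analysis. *)
From mathcomp Require Import -(notations) mpoly.

Set Implicit Arguments.
Unset Strict Implicit.
Unset Printing Implicit Defensive.
Import Order.TTheory GRing.Theory Num.Theory numFieldNormedType.Exports.
Local Open Scope ring_scope.

(* A ribbon graph is given by its half-edges D, the permutation [rot] sending a
   half-edge to the next one in the circular ordering at its vertex, and the
   involution [opp] exchanging the two halves of each edge.  Vertices are the
   orbits of [rot], edges those of [opp].  Boundary components are the orbits
   of [face]: the half-edge h, directed away from its vertex, stands for the
   left-hand side of its edge, and [opp h] for the other side.  [side h] is the
   label of the boundary component along that side, [inl i] being the black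
   label i and [inr j] the white label j. *)
Record labeled_map (D : finType) (k l : nat) := LabeledMap {
  rot : {perm D};
  opp : {perm D};
  side : {ffun D -> 'I_k + 'I_l}
}.

Section LabeledMapFinite.
Variables (D : finType) (k l : nat).

Definition labeled_map_code (G : labeled_map D k l) :=
  (rot G, opp G, side G).
Definition labeled_map_decode c : labeled_map D k l :=
  LabeledMap c.1.1 c.1.2 c.2.

Lemma labeled_map_codeK : cancel labeled_map_code labeled_map_decode.
Proof. by case. Qed.

HB.instance Definition _ :=
  Finite.copy (labeled_map D k l) (can_type labeled_map_codeK).

End LabeledMapFinite.

Section RibbonGraphs.
Variables (D : finType) (k l : nat).
Implicit Types (G : labeled_map D k l) (f : {perm D}) (h : D).

Definition is_ribbon_graph G : bool :=
  [&& [forall h, opp G (opp G h) == h],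
      [forall h, opp G h != h] &
      [forall h, forall h',
        connect [rel x y | (y == rot G x) || (y == opp G x)] h h']].

(* [opp G * (rot G)^-1] applies [opp G] first. *)
Definition face G : {perm D} := (opp G * (rot G)^-1)%g.

Definition nb_vertices G : nat := #|porbits (rot G)|.
Definition nb_edges G : nat := #|porbits (opp G)|.
Definition nb_faces G : nat := #|porbits (face G)|.

Definition has_genus (g : nat) G : bool :=
  (nb_vertices G)%:Z - (nb_edges G)%:Z + (nb_faces G)%:Z == 2 - (2 * g)%N%:Z.

(* [side] induces a bijection from boundary components to labels. *)
Definition well_labeled G : bool :=
  [forall h, forall h',
    (side G h == side G h') == (porbit (face G) h == porbit (face G) h')] &&
  [forall c, exists h, side G h == c].

Definition is_black (c : 'I_k + 'I_l) : bool := if c is inl _ then true else false.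

Definition bicolored G : bool :=
  [forall h, is_black (side G h) != is_black (side G (opp G h))].

Definition one_vertex_bicolored (g : nat) : {set labeled_map D k l} :=
  [set G | [&& is_ribbon_graph G, nb_vertices G == 1%N, has_genus g G,
               well_labeled G & bicolored G]]%SET.

Definition is_iso f G G' : bool :=
  [forall h, [&& rot G' (f h) == f (rot G h),
                 opp G' (f h) == f (opp G h) &
                 side G' (f h) == side G h]].

Definition isomorphic G G' : bool := [exists f, is_iso f G G'].

Definition Aut_map G : {set {perm D}} := [set f | is_iso f G G]%SET.

(* A metric is a function on half-edges giving both halves of an edge the
   length of that edge. *)
Definition integral_metric G (m : {ffun D -> nat}) : Prop :=
  forall h, (0 < m h)%N /\ m (opp G h) = m h.

Definition perimeter G (m : {ffun D -> nat}) (c : 'I_k + 'I_l) : int :=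
  (\sum_(h | side G h == c) m h)%N%:Z.

Definition metrics G (L : 'rV[int]_k) (L' : 'rV[int]_l) : set {ffun D -> nat} :=
  [set m | [/\ integral_metric G m,
               forall i, perimeter G m (inl i) = L 0 i &
               forall j, perimeter G m (inr j) = L' 0 j]]%classic.

Definition nb_metrics G L L' : nat := #|` fset_set (metrics G L L')|%fset.

(* [fset_set] of an infinite set is empty; this never happens here. *)
Lemma finite_metrics G L L' : finite_set (metrics G L L').
Proof.
pose B := (\sum_i `|L ord0 i| + \sum_j `|L' ord0 j|)%N.
pose F (u : {ffun D -> 'I_B.+1}) : {ffun D -> nat} := [ffun h => u h : nat].
apply: (@sub_finite_set _ _ (F @` setT)%classic); last first.
  exact/finite_image/finite_finset.
move=> m [_ mL mL'].
have le_sum h : (m h <= \sum_(h' | side G h' == side G h) m h')%N.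
  by rewrite (bigD1 h) //= leq_addr.
have mB h : (m h < B.+1)%N.
  rewrite ltnS (leq_trans (le_sum h)) // /B.
  case: (side G h) => [i|j].
  - have /(congr1 absz) /= -> := mL i.
    by rewrite (bigD1 i) //= -addnA leq_addr.
  - have /(congr1 absz) /= -> := mL' j.
    by rewrite addnC (bigD1 j) //= -addnA leq_addr.
exists [ffun h => Ordinal (mB h)] => //.
by apply/ffunP => h; rewrite !ffunE.
Qed.

End RibbonGraphs.

(* Twice the E given by V - E + F = 2 - 2g with V = 1 and F = k + l. *)
Definition nb_half_edges (g k l : nat) : nat := (2 * (2 * g + k + l).-1)%N.

Lemma card_half_edges (D : finType) (g k l : nat) (G : labeled_map D k l) :
  G \in one_vertex_bicolored D k l g -> #|D| = nb_half_edges g k l.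
Proof.
rewrite inE => /and5P[/and3P[/forallP oppK /forallP opp_neq _] /eqP V1 genusG].
move=> /andP[/forallP sideE /forallP sideT] _.
have DE : (#|D| = 2 * nb_edges G)%N.
  rewrite -cardsT mulnC.
  have part : finset.partition (porbits (opp G)) [set: D]%SET.
    have -> : porbits (opp G) = (orbit 'P <[opp G]> @: [set: D])%g%SET.
      by apply/setP => A; apply/imsetP/imsetP => -[h _ ->];
         exists h; rewrite ?porbitE ?inE.
    by apply: orbit_partition; apply/actsP => a _ h; rewrite !inE.
  apply: card_uniform_partition part => _ /imsetP[h _ ->].
  have -> : porbit (opp G) h = [set h; opp G h]%SET.
    apply/setP => x; rewrite !inE.
    apply/porbitP/orP => [[i ->]|[/eqP->|/eqP->]]; last 2 first.
    - by exists 0%N; rewrite expg0 perm1.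
    - by exists 1%N; rewrite expg1.
    elim: i => [|i]; first by left; rewrite expg0 perm1.
    rewrite expgSr permM => -[]/eqP->; first by right.
    by left; rewrite (eqP (oppK h)).
  by rewrite cards2 eq_sym opp_neq.
have FE : nb_faces G = (k + l)%N.
  have -> : (k + l = #|{: 'I_k + 'I_l}|)%N by rewrite card_sum !card_ord.
  rewrite -cardsT.
  pose s c := xchoose (existsP (sideT c)).
  have sK c : side G (s c) = c by apply/eqP/(xchooseP (existsP (sideT c))).
  have E h h' : (side G h == side G h') = (porbit (face G) h == porbit (face G) h').
    exact: eqP (forallP (sideE h) h').
  have -> : nb_faces G = #|[set porbit (face G) (s c) | c in [set: 'I_k + 'I_l]]%SET|.
    apply: eq_card => A; apply/imsetP/imsetP => -[h _ ->]; last by exists (s h).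
    by exists (side G h) => //; apply/eqP; rewrite -E sK.
  by rewrite card_imset // => c c' /eqP; rewrite -E !sK => /eqP.
move: genusG; rewrite /has_genus V1 FE DE /nb_half_edges => /eqP H.
by congr (2 * _)%N; lia.
Qed.

(* One representative of each isomorphism class; by [card_half_edges] every
   graph considered is isomorphic to one whose half-edges are
   ['I_(nb_half_edges g k l)]. *)
Definition iso_classes (g k l : nat) :
    {set labeled_map 'I_(nb_half_edges g k l) k l} :=
  let E := one_vertex_bicolored 'I_(nb_half_edges g k l) k l g in
  transversal (equivalence_partition (@isomorphic _ k l) E) E.

Definition weighted_count (g k l : nat) (L : 'rV[int]_k) (L' : 'rV[int]_l) : rat :=
  \sum_(G in iso_classes g k l) (#|Aut_map G|%:R)^-1 * (nb_metrics G L L')%:R.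

Section Strata.
Variables (R : realType) (k l : nat).
Local Open Scope classical_set_scope.
Local Notation space := ('rV[R]_k * 'rV[R]_l)%type.

Definition balanced : set space :=
  [set x : space | \sum_i x.1 0 i = \sum_j x.2 0 j].

Definition balanced_pos : set space :=
  [set x : space | [/\ balanced x, forall i, 0 < x.1 0 i & forall j, 0 < x.2 0 j]].

Definition wall (I : {set 'I_k}) (J : {set 'I_l}) : set space :=
  [set x : space | balanced x /\ \sum_(i in I) x.1 0 i = \sum_(j in J) x.2 0 j].

Definition walls : set (set space) :=
  [set V | exists (I : {set 'I_k}) (J : {set 'I_l}),
    [/\ (I, J) <> (finset.set0, finset.set0),
        (~: I, ~: J)%SET <> (finset.set0, finset.set0) & V = wall I J]].

(* [walls] is finite, so arbitrary subfamilies are finite. *)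
Definition flats : set (set space) :=
  [set W | exists2 S : set (set space), S `<=` walls &
           W = balanced `&` \bigcap_(V in S) V].

Definition flat_core (W : set space) : set space :=
  W `\` \bigcup_(V in [set V | flats V /\ V `<` W]) V.

Definition stratum (W : set space) : set space := balanced_pos `&` flat_core W.

Definition int_point (L : 'rV[int]_k) (L' : 'rV[int]_l) : space :=
  (map_mx intr L, map_mx intr L').

(* The first k variables of a polynomial are L, the last l are L'. *)
Definition peval (P : mpoly (k + l) R) (x : space) : R :=
  meval (fun i => row_mx x.1 x.2 0 i) P.

End Strata.

(* Main.v *)
(* Cutting the unique vertex at its corners turns a labelled ribbon graph with
   n = 2g + k + l - 1 edges into a cyclic permutation rho of the 2n arcs of a
   bipartite graph s on the k black and l white labels, and a metric into a
   positive weight on the edges of s with vertex sums (L, L').  If one drops the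
   condition that distinct faces have distinct labels, the permutations rho are
   the Eulerian tours of s, counted by the BEST theorem: spanning trees times
   the product of the factorials (deg v - 1)!.  Inclusion-exclusion on the labels
   recovers the count of ribbon graphs, and Euler's relation for the number of
   spanning trees lets one split vertices until s becomes a tree.  So the count
   is a combination of push-forwards, along merging of labels, of the weights
   [s is a tree] * prod_v (deg v - 1)!.

   On trees the weights are the sums of b = (L, - L') over the fundamental cuts,
   and the total weight T(b) of the trees with all cut sums positive depends only
   on the set of subsets S with b(S) = 0: when b crosses a wall, the edges crossing
   it are reversed, and the products of rising factorials that count them are
   symmetric since each block has as many black as white corners.  Hence
   the count at (L, L') is the sum of T over the lifts of (L, L'), all but
   O(N^(2g-1)) of which have the zero pattern inherited from (L, L'): this gives
   the leading form on each W.

   On a cell where all b(S) have fixed signs the count is polynomial of degree at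
   most 2g: partial fractions reduce the number of positive flows on a connected
   graph to products over the edges of spanning trees.  Comparing both statements
   along rays shows that the difference has degree less than 2g. *)
Require Import Defs.
From HB Require Import structures.
From mathcomp Require Import all_boot all_order all_algebra all_fingroup finmap zify ring lra.
From mathcomp Require Import all_classical all_reals topology normedtype.
From mathcomp Require Import -(notations) mpoly.
Set Implicit Arguments.
Unset Strict Implicit.
Unset Printing Implicit Defensive.
Import Order.TTheory GRing.Theory Num.Theory numFieldNormedType.Exports.
Local Open Scope ring_scope.

(** * Determinants indexed by a finite type *)

(** Neither description of the count suffices alone. The tree formula is uniform over all points
    with a given zero pattern, hence across the components of a stratum, but it leaves an error that
    is only bounded. The cell description is an exact polynomial, but its leading form could a
    priori change from cell to cell.

    The degree [2g] is [n + 1 - (k + l)]: the number of labels lost when the [n + 1] vertices of a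
    tree with [n] edges are merged into [k + l] labels. It is also the dimension of the cycle space
    of a connected graph with [n] edges and [k + l] vertices.

    Spanning trees enter through the determinant [tau] of the reduced Laplacian, by five properties:
    independence of the root, Euler's relation, a formula for splitting a vertex, the value 0 on
    disconnected graphs and the value 1 on trees. The factorials fit the splitting because a vertex
    of degree [d] has [(d - 1)!] cyclic orders, and summing [(m - 1)! (d - m - 1)!] over the parts
    separating two given edges gives [(d - 1)!] back.

    A bound [N] on the perimeters accompanies all counts; it makes the sets of weights finite and
    measures the error terms. *)

Section FinDet.
Variable V : finType.
Implicit Types (M : V -> V -> rat) (u v : V) (x y : V -> rat).

Definition fdet M : rat :=
  \det (\matrix_(a < #|V|, b < #|V|) M (enum_val a) (enum_val b)).

Definition setrow M u x := fun v w => if v == u then x w else M v w.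

Lemma eq_fdet M M' : M =2 M' -> fdet M = fdet M'.
Proof. by move=> E; congr (\det _); apply/matrixP => a b; rewrite !mxE E. Qed.

Lemma fdet_tr M : fdet (fun u v => M v u) = fdet M.
Proof.
by rewrite /fdet -det_tr; congr (\det _); apply/matrixP => a b; rewrite !mxE.
Qed.

Lemma fdet1 : fdet (fun u v => (u == v)%:R) = 1.
Proof.
rewrite -[RHS](@det1 _ #|V|); congr (\det _).
by apply/matrixP => a b; rewrite !mxE (inj_eq enum_val_inj).
Qed.

Lemma fdet_lin M u x y c d :
  fdet (setrow M u (fun w => c * x w + d * y w)) =
  c * fdet (setrow M u x) + d * fdet (setrow M u y).
Proof.
apply: (@determinant_multilinear _ _ _ _ _ (enum_rank u)).
- by apply/rowP => b; rewrite !mxE /setrow enum_rankK eqxx.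
- apply/matrixP => a b; rewrite !mxE /setrow.
  by rewrite -(inj_eq enum_rank_inj) enum_valK eq_sym (negPf (neq_lift _ _)).
- apply/matrixP => a b; rewrite !mxE /setrow.
  by rewrite -(inj_eq enum_rank_inj) enum_valK eq_sym (negPf (neq_lift _ _)).
Qed.

Lemma fdet_alt M u u' : u != u' -> M u =1 M u' -> fdet M = 0.
Proof.
move=> uu' E; apply: (@determinant_alternate _ _ _ (enum_rank u) (enum_rank u')).
  by rewrite (inj_eq enum_rank_inj).
by move=> b; rewrite !mxE !enum_rankK E.
Qed.

Lemma fdet_ker M y v : y v != 0 -> (forall u, \sum_w M u w * y w = 0) -> fdet M = 0.
Proof.
move=> yv E; rewrite -fdet_tr; apply/eqP/det0P.
exists (\row_b y (enum_val b)).
  by apply: contraNneq yv => /rowP/(_ (enum_rank v)); rewrite !mxE enum_rankK => ->.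
apply/rowP => a; rewrite !mxE -[RHS](E (enum_val a)).
rewrite (reindex_onto (@enum_rank V) enum_val) /=; last by move=> b _; rewrite enum_valK.
apply: eq_big => [w|w _]; first by rewrite enum_rankK eqxx.
by rewrite !mxE enum_rankK mulrC.
Qed.

Lemma fdetD M u x y :
  fdet (setrow M u (fun w => x w + y w)) = fdet (setrow M u x) + fdet (setrow M u y).
Proof.
rewrite -[X in X + _]mul1r -[X in _ + X]mul1r -fdet_lin; apply: eq_fdet => v w.
by rewrite /setrow !mul1r.
Qed.

Lemma fdetB M u x y :
  fdet (setrow M u (fun w => x w - y w)) = fdet (setrow M u x) - fdet (setrow M u y).
Proof.
rewrite -[X in X - _]mul1r -[X in _ - X]mul1r -mulNr -fdet_lin; apply: eq_fdet => v w.
by rewrite /setrow !mul1r mulN1r.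
Qed.

Lemma fdetZ M u x c :
  fdet (setrow M u (fun w => c * x w)) = c * fdet (setrow M u x).
Proof.
rewrite -[RHS]addr0 -[X in _ + X](mul0r (fdet (setrow M u x))) -fdet_lin.
by apply: eq_fdet => v w; rewrite /setrow mul0r addr0.
Qed.

Lemma fdet_row0 M u : (forall w, M u w = 0) -> fdet M = 0.
Proof.
move=> E; rewrite -(@mul0r _ (fdet (setrow M u (fun=> 0)))) -fdetZ.
by apply: eq_fdet => v w; rewrite /setrow mul0r; case: eqP => // ->.
Qed.

Lemma fdet_sum (I : Type) (r : seq I) (P : pred I) M u (F : I -> V -> rat) :
  fdet (setrow M u (fun w => \sum_(i <- r | P i) F i w)) =
  \sum_(i <- r | P i) fdet (setrow M u (F i)).
Proof.
elim: r => [|i r IH].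
  rewrite big_nil; apply: (@fdet_row0 _ u) => w.
  by rewrite /setrow eqxx big_nil.
rewrite big_cons; case: ifP => Pi; last first.
  by rewrite -IH; apply: eq_fdet => v w; rewrite /setrow big_cons Pi.
rewrite -IH -fdetD; apply: eq_fdet => v w; rewrite /setrow big_cons Pi.
by [].
Qed.

Lemma setrow_id M u x : (forall w, x w = M u w) -> fdet (setrow M u x) = fdet M.
Proof. by move=> E; apply: eq_fdet => v w; rewrite /setrow; case: eqP => // ->. Qed.

Lemma setrowC M u v x y : u != v ->
  fdet (setrow (setrow M u x) v y) = fdet (setrow (setrow M v y) u x).
Proof.
move=> uv; apply: eq_fdet => a w; rewrite /setrow.
by case: (a =P v) => // ->; rewrite eq_sym (negPf uv).
Qed.

Lemma fdet_alt2 M u v x : u != v -> fdet (setrow (setrow M u x) v x) = 0.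
Proof.
move=> uv; apply: (@fdet_alt _ u v) => // w.
by rewrite /setrow eqxx (negPf uv) eqxx.
Qed.

Lemma fdet_swap M u v x y : u != v ->
  fdet (setrow (setrow M u x) v y) = - fdet (setrow (setrow M u y) v x).
Proof.
move=> uv; apply/eqP; rewrite -addr_eq0; apply/eqP.
have := fdet_alt2 M (fun w => x w + y w) uv.
rewrite fdetD (setrowC _ _ _ uv) fdetD (setrowC _ _ _ uv) fdetD.
rewrite -!(setrowC _ _ _ uv) !(fdet_alt2 _ _ uv) add0r addr0.
by move=> H; rewrite -[RHS]H; ring.
Qed.

Lemma fdet_addrow M u v c : u != v ->
  fdet (setrow M u (fun w => M u w + c * M v w)) = fdet M.
Proof.
move=> uv; rewrite fdetD setrow_id // fdetZ.
have -> : fdet (setrow M u (M v)) = 0.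
  apply: (@fdet_alt _ u v) => // w.
  by rewrite /setrow eqxx eq_sym (negPf uv).
by rewrite mulr0 addr0.
Qed.

(** Adding multiples of the unit row [r] to the other rows changes column [r] at will; the rows are
    treated one at a time. *)
Lemma fdet_unitcol M M' r :
  (forall w, M r w = (r == w)%:R) -> (forall w, M' r w = (r == w)%:R) ->
  (forall u w, w != r -> M u w = M' u w) -> fdet M = fdet M'.
Proof.
move=> Mr M'r E.
pose S := [set u | u != r]%SET.
suff H (s : seq V) : uniq s -> r \notin s ->
    fdet (fun u w => if u \in s then M' u w else M u w) = fdet M.
  rewrite -(H (enum S)) ?enum_uniq //; last by rewrite mem_enum inE eqxx.
  apply: eq_fdet => u w; rewrite mem_enum inE; case: (eqVneq u r) => //= ->.
  by rewrite Mr M'r.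
elim: s => [|u s IH] //= /andP[us /IH{}IH]; rewrite inE negb_or => /andP[ur /IH <-].
set N := (X in _ = fdet X).
rewrite -[RHS](@fdet_addrow _ u r (M' u r - M u r)); last by rewrite eq_sym.
apply: eq_fdet => v w; rewrite /setrow inE; case: (eqVneq v u) => //= ->.
rewrite /N (negPf us); case: ifP => _; case: (eqVneq w r) => [->|wr].
- by rewrite M'r eqxx mulr1 addrC subrK.
- by rewrite M'r eq_sym (negPf wr) mulr0 addr0 E.
- by rewrite Mr eqxx mulr1 addrC subrK.
- by rewrite Mr eq_sym (negPf wr) mulr0 addr0 E.
Qed.

End FinDet.


(** The two enumerations differ by a permutation applied to rows and columns alike, so its sign
    occurs twice. *)
Lemma det_two_enum (V : finType) (n : nat) (f g : 'I_n -> V) (M : V -> V -> rat) :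
  injective f -> injective g -> n = #|V| ->
  \det (\matrix_(a < n, b < n) M (f a) (f b)) = \det (\matrix_(a < n, b < n) M (g a) (g b)).
Proof.
move=> fI gI e.
have [h hK Kh] : bijective g by apply: inj_card_bij; rewrite ?card_ord ?e.
have pI : injective (h \o f) by apply: inj_comp fI; exact: can_inj Kh.
set B := (X in _ = \det X).
have -> : \matrix_(a < n, b < n) M (f a) (f b) = row_perm (perm pI) (col_perm (perm pI) B).
  by apply/matrixP => a b; rewrite !mxE !permE /= !Kh.
rewrite row_permE col_permE !det_mulmx !det_perm odd_permV mulrCA.
by rewrite -signr_addb addbb mulr1.
Qed.

Lemma fdetE (V : finType) (n : nat) (f : 'I_n -> V) (M : V -> V -> rat) :
  injective f -> n = #|V| -> \det (\matrix_(a < n, b < n) M (f a) (f b)) = fdet M.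
Proof.
move=> fI e; have H m (em : m = n) (g : 'I_m -> V) : injective g ->
    \det (\matrix_(a < n, b < n) M (f a) (f b)) =
    \det (\matrix_(a < m, b < m) M (g a) (g b)).
  by subst m => gI; apply: det_two_enum.
by apply: H => //; exact: enum_val_inj.
Qed.

Lemma fdet_reindex (V W : finType) (f : V -> W) (M : W -> W -> rat) :
  bijective f -> fdet (fun u v => M (f u) (f v)) = fdet M.
Proof.
move=> bf; rewrite -(@fdetE W #|V| (f \o enum_val)) //; last exact: bij_eq_card bf.
by apply: inj_comp; [exact: bij_inj | exact: enum_val_inj].
Qed.

Lemma fdet_option (V : finType) (M : option V -> option V -> rat) :
  (forall w, M None w = (None == w)%:R) ->
  fdet M = fdet (fun u v => M (Some u) (Some v)).
Proof.
move=> MN.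
pose f (a : 'I_#|V|.+1) : option V := omap enum_val (unlift ord0 a).
have fI : injective f.
  move=> a b; rewrite /f; case: unliftP => [a'|] ->; case: unliftP => [b'|] -> //=.
  by case=> /enum_val_inj ->.
rewrite -(fdetE M fI) ?card_option // (expand_det_row _ ord0) (bigD1 ord0) //=.
rewrite big1 ?addr0 => [|j jn0]; last first.
  rewrite !mxE /f unlift_none MN; case: unliftP => [j'|] ej; first by rewrite mul0r.
  by rewrite ej eqxx in jn0.
rewrite !mxE /f unlift_none MN eqxx mul1r /cofactor addn0 expr0 mul1r.
congr (\det _); apply/matrixP => a b; rewrite !mxE.
by rewrite !liftK.
Qed.

(** * Counting Eulerian trails *)

Section EulerianTrails.
Variables (V Arc : finType) (src tgt : Arc -> V) (r : V).
Implicit Types (A : {set Arc}) (u v w : V) (a : Arc).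

Definition outdeg A v : nat := #|[set a in A | src a == v]%SET|.
Definition indeg A v : nat := #|[set a in A | tgt a == v]%SET|.

(* Vertices without outgoing arcs get a unit row, so that they do not count as
   vertices of the graph. *)
Definition lap A u w : rat :=
  if (u == r) || (outdeg A u == 0)%N then (u == w)%:R
  else \sum_(a in A | src a == u) ((u == w)%:R - (tgt a == w)%:R).

Fixpoint trails n u A : nat :=
  if n is n'.+1 then (\sum_(a in A | src a == u) trails n' (tgt a) (A :\ a)%SET)%N
  else (u == r).

(** The degree condition satisfied by the arcs of a trail from [u] to [r] that uses all of [A]. *)
Definition balanced_arcs A u :=
  forall v, (outdeg A v + (v == r) = indeg A v + (v == u))%N.

Lemma outdegD1 A a v : a \in A ->
  outdeg A v = ((src a == v) + outdeg (A :\ a)%SET v)%N.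
Proof.
move=> aA; rewrite /outdeg (cardsD1 a) !inE aA /=; congr (_ + _)%N.
by apply: eq_card => b; rewrite !inE andbA.
Qed.

Lemma indegD1 A a v : a \in A ->
  indeg A v = ((tgt a == v) + indeg (A :\ a)%SET v)%N.
Proof.
move=> aA; rewrite /indeg (cardsD1 a) !inE aA /=; congr (_ + _)%N.
by apply: eq_card => b; rewrite !inE andbA.
Qed.

Lemma balancedD1 A u a : a \in A -> src a = u ->
  balanced_arcs A u -> balanced_arcs (A :\ a)%SET (tgt a).
Proof.
move=> aA su bA v; have := bA v.
rewrite (outdegD1 _ aA) (indegD1 _ aA) su [u == v]eq_sym [tgt a == v]eq_sym.
lia.
Qed.

(** In the BEST argument the last exits from the vertices other than [r] form a tree directed to
    [r], and the remaining exits are ordered freely: all but one at such a vertex, all of them at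
    [r]. Truncated subtraction gives a vertex without outgoing arcs the factor [0! = 1]. *)
Definition degfact A := (\prod_v (outdeg A v - (v != r))`!)%N.

Lemma degfactE A u :
  degfact A = ((outdeg A u - (u != r))`! * \prod_(v | v != u) (outdeg A v - (v != r))`!)%N.
Proof. by rewrite /degfact (bigD1 u). Qed.

Lemma degfactD1 A a : a \in A ->
  degfact (A :\ a)%SET =
  ((outdeg A (src a) - 1 - (src a != r))`! *
   \prod_(v | v != src a) (outdeg A v - (v != r))`!)%N.
Proof.
move=> aA; rewrite (degfactE _ (src a)); congr (_ * _)%N.
  by rewrite (outdegD1 (src a) aA) eqxx add1n subn1.
by apply: eq_bigr => v va; rewrite (outdegD1 v aA) [src a == v]eq_sym (negPf va).
Qed.

Lemma lapD1 A a v w : a \in A -> v != src a -> lap (A :\ a)%SET v w = lap A v w.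
Proof.
move=> aA va; rewrite /lap (outdegD1 v aA) [src a == v]eq_sym (negPf va) add0n.
case: ifP => // _; apply: eq_bigl => b; rewrite !inE.
by case: eqP => //= ->; rewrite [src a == v]eq_sym (negPf va) andbF.
Qed.

Lemma sum_arcs_card A u (c : rat) :
  \sum_(a in A | src a == u) c = c *+ outdeg A u.
Proof. by rewrite sumr_const; congr (_ *+ _); apply: eq_card => a; rewrite !inE. Qed.

(** By balance [u] has no incoming arc, so column [u] vanishes outside row [u]. Only the diagonal
    entry of row [u] then matters, and the row may be replaced by the unit row, which is what it
    becomes once [u] has lost its only outgoing arc. *)
Lemma fdet_lapD1 A u a : a \in A -> src a = u -> balanced_arcs A u ->
  u != r -> outdeg A u = 1%N -> fdet (lap (A :\ a)%SET) = fdet (lap A).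
Proof.
move=> aA su bA ur o1.
have in0 : indeg A u = 0%N by have := bA u; rewrite o1 eqxx (negPf ur); lia.
have tu : tgt a != u.
  apply/eqP => ta; move: in0; rewrite (indegD1 _ aA) ta eqxx; lia.
have -> : fdet (lap A) =
    fdet (setrow (lap A) u (fun w => (u == w)%:R - (tgt a == w)%:R)).
  rewrite setrow_id // => w; rewrite /lap (negPf ur) o1 /=.
  rewrite (bigD1 a) ?aA ?su ?eqxx //= big1 ?addr0 // => b /andP[/andP[bA' bu] ba].
  suff : (1 < outdeg A u)%N by rewrite o1.
  rewrite (outdegD1 _ aA) su eqxx (@outdegD1 _ b) ?bu; last by rewrite !inE ba.
  by [].
rewrite fdetB [X in _ - X](@fdet_ker _ _ (fun w => (w == u)%:R) u) ?eqxx ?oner_eq0 //.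
  rewrite subr0; apply: eq_fdet => v w; rewrite /setrow.
  case: (eqVneq v u) => [->|vu]; last by rewrite lapD1 // su.
  rewrite /lap; suff -> : outdeg (A :\ a)%SET u = 0%N by rewrite orbT.
  by move: o1; rewrite (outdegD1 _ aA) su eqxx; lia.
move=> v; rewrite (bigD1 u) //= eqxx mulr1 big1 ?addr0 => [|w /negPf->]; last by rewrite mulr0.
rewrite /setrow; case: (eqVneq v u) => [_|vu]; first by rewrite (negPf tu).
rewrite /lap (negPf vu); case: ifP => // _; rewrite big1 // => b /andP[bA' _].
suff /negPf-> : tgt b != u by rewrite subrr.
by apply/eqP => tb; move: in0; rewrite (indegD1 _ bA') tb eqxx; lia.
Qed.

(** Induction over the first arc of the trail. Removing an arc that leaves the root keeps the
    matrix; at any other vertex it deletes one term of row [u], and multilinearity adds up the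
    resulting determinants. *)
Theorem best_trails n A u : #|A| = n -> balanced_arcs A u ->
  (trails n u A)%:R = fdet (lap A) * (degfact A)%:R.
Proof.
elim: n A u => [|n IH] A u.
  move=> /eqP; rewrite cards_eq0 => /eqP-> bA /=.
  have o0 v : outdeg finset.set0 v = 0%N.
    by apply/eqP; rewrite cards_eq0; apply/eqP/setP => b; rewrite !inE.
  have i0 v : indeg finset.set0 v = 0%N.
    by apply/eqP; rewrite cards_eq0; apply/eqP/setP => b; rewrite !inE.
  have := bA u; rewrite o0 i0 eqxx; case: eqP => // _ _.
  rewrite /degfact big1 => [|v _]; last by rewrite o0 sub0n.
  rewrite mulr1 -[LHS](fdet1 V); apply: eq_fdet => v w.
  by rewrite /lap o0 orbT.
move=> cA bA /=; rewrite natr_sum.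
have step a : a \in A -> src a == u ->
    (trails n (tgt a) (A :\ a)%SET)%:R =
    fdet (lap (A :\ a)%SET) * (degfact (A :\ a)%SET)%:R.
  move=> aA /eqP su; apply: IH; last exact: balancedD1 bA.
  by move: cA; rewrite (cardsD1 a) aA; lia.
under eq_bigr => a /andP[aA su] do rewrite step // degfactD1 // (eqP su).
have [o0|o0] := posnP (outdeg A u).
  have ur : u = r.
    by have := bA u; rewrite o0 eqxx; case: (u =P r) => //; lia.
  rewrite big1 => [|a /andP[aA su]]; last first.
    by move: o0; rewrite (outdegD1 u aA) su.
  have [a aA] : exists a, a \in A by apply/set0Pn; rewrite -cards_eq0 cA.
  have oi v : outdeg A v = indeg A v by have := bA v; rewrite ur; lia.
  (* No trail can start, although arcs remain. The matrix is singular: every target has an outgoing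
     arc by balance and the root has none, so the indicator of the vertices with outgoing arcs lies
     in the kernel. *)
  rewrite (@fdet_ker _ _ (fun v => (outdeg A v != 0)%:R) (src a)) ?mul0r //.
    by rewrite (outdegD1 _ aA) eqxx oner_eq0.
  move=> v; rewrite /lap; case vr: ((v == r) || _).
    rewrite big1 // => w _; case: eqP => [<-|_]; last by rewrite mul0r.
    case/orP: vr => [/eqP->|/eqP->]; last by rewrite mulr0.
    by rewrite -ur o0 mulr0.
  rewrite -[LHS]/(\sum_w _ * _); under eq_bigr => w _ do rewrite big_distrl /=.
  rewrite exchange_big big1 // => b /andP[bA' sb].
  under eq_bigr => w _ do rewrite mulrBl.
  rewrite sumrB (bigD1 v) //= eqxx mul1r big1 ?addr0; last first.
    by move=> w; rewrite eq_sym => /negPf->; rewrite mul0r.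
  rewrite (bigD1 (tgt b)) //= eqxx mul1r big1 ?addr0; last first.
    by move=> w; rewrite eq_sym => /negPf->; rewrite mul0r.
  rewrite (outdegD1 v bA') sb oi (indegD1 _ bA') eqxx /=.
  by rewrite subrr.
rewrite (degfactE _ u).
set R := (\prod_(v | v != u) _)%N.
have [ur|ur] := eqVneq u r.
  transitivity (\sum_(a in A | src a == u) (fdet (lap A) * R%:R * ((outdeg A u).-1)`!%:R)).
    apply: eq_bigr => a /andP[aA /eqP su].
    rewrite subn0 subn1 natrM [X in _ * X]mulrC mulrA; congr (_ * _ * _).
    apply: eq_fdet => v w; have [vu|vu] := eqVneq v u.
      by rewrite /lap vu ur eqxx.
    by rewrite lapD1 // su.
  rewrite sum_arcs_card -mulr_natr subn0.
  by case: (outdeg A u) o0 => // q _; rewrite factS !natrM; ring.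
have [o1|o2] := leqP (outdeg A u) 1.
  have {o0}o1 : outdeg A u = 1%N by lia.
  have [a /[!inE] /andP[aA su]] : exists a, a \in [set a in A | src a == u]%SET.
    by apply/set0Pn; rewrite -cards_eq0 -/(outdeg A u) o1.
  rewrite (bigD1 a) ?aA ?su //= big1 ?addr0 => [|b /andP[/andP[bA' bu] ba]]; last first.
    suff : (1 < outdeg A u)%N by rewrite o1.
    rewrite (outdegD1 _ aA) su (@outdegD1 _ b) ?bu; last by rewrite !inE ba.
    by [].
  by rewrite (fdet_lapD1 aA (eqP su) bA ur o1) o1 natrM.
(* Row [u] is the sum of one term per outgoing arc, and each summand here lacks one of these terms;
   together they make [outdeg A u - 1] copies of the row. *)
have H : \sum_(a in A | src a == u) fdet (lap (A :\ a)%SET) =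
    (outdeg A u).-1%:R * fdet (lap A).
  transitivity (\sum_(a in A | src a == u) (fdet (lap A) -
      fdet (setrow (lap A) u (fun w => (u == w)%:R - (tgt a == w)%:R)))).
    apply: eq_bigr => a /andP[aA /eqP su].
    rewrite -[fdet (lap A)](@setrow_id _ _ u (lap A u)) // -fdetB.
    apply: eq_fdet => v w; rewrite /setrow; have [->|vu] := eqVneq v u; last by rewrite lapD1 // su.
    rewrite /lap (negPf ur) /=.
    have := outdegD1 u aA; rewrite su eqxx => oD.
    have -> : (outdeg A u == 0)%N = false by apply/eqP; lia.
    have -> : (outdeg (A :\ a)%SET u == 0)%N = false by apply/eqP; lia.
    rewrite [in RHS](bigD1 a) ?aA ?su ?eqxx //= addrC addrK.
    apply: eq_bigl => b; rewrite !inE.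
    by case: (b == a); rewrite ?andbF ?andbT.
  rewrite sumrB sum_arcs_card -fdet_sum setrow_id; last first.
    move=> w; rewrite /lap (negPf ur).
    by have -> : (outdeg A u == 0)%N = false by apply/eqP; lia.
  rewrite -[fdet _ *+ _]mulr_natl -[X in _ - X]mul1r -[LHS]mulrBl; congr (_ * _).
  by case: (outdeg A u) o0 => // q _; rewrite -natr1 addrK.
rewrite -mulr_suml H natrM /=.
have -> : (outdeg A u - 1 - 1)%N = (outdeg A u).-2 by lia.
have -> : (outdeg A u - 1)%N = (outdeg A u).-2.+1 by lia.
have -> : (outdeg A u).-1 = (outdeg A u).-2.+1 by lia.
by rewrite factS natrM -/R; ring.
Qed.

End EulerianTrails.

Section CyclicTrails.
Variables (V Arc : finType) (src tgt : Arc -> V).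
Implicit Types (A : {set Arc}) (u v : V) (a : Arc) (rho : {perm Arc}).

Fixpoint is_trail r u (s : seq Arc) : bool :=
  if s is a :: s' then (src a == u) && is_trail r (tgt a) s' else u == r.

Lemma trails_tuples r n u A :
  trails src tgt r n u A =
  #|[set t : n.-tuple Arc | [&& is_trail r u t, uniq t & all [in A] t]]%SET|.
Proof.
elim: n u A => [|n IH] u A /=.
  rewrite -sum1dep_card; have [->|ur] := eqVneq u r.
    by rewrite (big_pred1 [tuple]) // => t; rewrite [t]tuple0 /= !eqxx.
  by rewrite big_pred0 // => t; rewrite [t]tuple0 /= (negPf ur).
rewrite -sum1dep_card.
rewrite (reindex (fun p : Arc * n.-tuple Arc => cons_tuple p.1 p.2)) /=; last first.
  exists (fun t => (thead t, behead_tuple t)) => [[a t]|t] _; first by congr pair; apply: val_inj.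
  by rewrite [RHS]tuple_eta; apply: val_inj.
pose P (a : Arc) (t : n.-tuple Arc) := [&& (src a == u) && is_trail r (tgt a) t,
   (a \notin tval t) && uniq t, a \in A & all [in A] t].
transitivity (\sum_a \sum_(t : n.-tuple Arc) (if P a t then 1 else 0))%N; last first.
  by rewrite pair_bigA [RHS]big_mkcond.
rewrite big_mkcond; apply: eq_bigr => a _.
rewrite -big_mkcond; case: ifP => [/andP[aA su]|H].
  rewrite IH -sum1dep_card; apply: eq_bigl => t.
  rewrite /P su aA /= -andbA; congr (_ && _).
  have -> : all [in (A :\ a)%SET] t = (a \notin tval t) && all [in A] t.
    elim: (tval t) => //= b s ->; rewrite !inE negb_or [b == a]eq_sym.
    by case: (a == b) => //=; case: (b \in A); rewrite ?andbF.
  by case: (a \notin _); rewrite ?andbF.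
rewrite big_pred0 // => t; rewrite /P.
by case: (a \in A) H => /= H; rewrite ?andbF //; rewrite H.
Qed.

Definition transitive_perm (rho : {perm Arc}) : bool := #|porbits rho| == 1%N.

Lemma transitive_permP rho a : transitive_perm rho -> porbit rho a = [set: Arc]%SET.
Proof.
move=> /cards1P[C EC]; have E b : porbit rho b = C.
  by apply/set1P; rewrite -EC; apply: imset_f.
by apply/setP => b; rewrite inE E -(E b) porbit_id.
Qed.

Lemma is_trail_cycle a s :
  is_trail (src a) (tgt a) s = path.cycle (fun x y => src y == tgt x) (a :: s).
Proof.
suff H c : is_trail (src a) (tgt c) s = path (fun x y => src y == tgt x) c (rcons s a).
  exact: H.
by elim: s c => [|b s IH] c /=; [rewrite andbT eq_sym | rewrite IH].
Qed.

(** Reading the single cycle of [rho] from the arc [a] on gives a closed trail through all arcs,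
    whose part after [a] runs from [tgt a] to [src a]. Conversely such a trail defines [rho] by
    [next]. *)
Theorem card_transitive_perm a :
  #|[set rho : {perm Arc} | transitive_perm rho & [forall x, src (rho x) == tgt x]]%SET| =
  trails src tgt (src a) #|Arc|.-1 (tgt a) ([set: Arc] :\ a)%SET.
Proof.
have N0 : (0 < #|Arc|)%N by apply/card_gt0P; exists a.
rewrite trails_tuples; set S := [set rho | _ & _]%SET; set T := [set t | _]%SET.
pose F rho : #|Arc|.-1.-tuple Arc := 
  Tuple (introT eqP (size_traject rho (rho a) #|Arc|.-1)).
have FE rho : a :: F rho = traject rho a #|Arc| by rewrite -{2}(prednK N0).
have orb rho : rho \in S -> #|porbit rho a| = #|Arc|.
  by rewrite inE => /andP[/transitive_permP-> _]; rewrite cardsT.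
have Funiq rho : rho \in S -> uniq (a :: F rho).
  by move=> rS; rewrite FE -(orb _ rS) uniq_traject_porbit.
have Fcyc rho : rho \in S -> fcycle rho (a :: F rho).
  move=> rS; rewrite /= ; have : fpath rho a (F rho) by apply: fpath_traject.
  rewrite rcons_path => -> /=; apply/eqP.
  have -> : last a (F rho) = iter #|Arc|.-1 rho a by rewrite /= last_traject.
  by rewrite -iterS (prednK N0) -(orb _ rS) iter_porbit.
have FI : {in S &, injective F}.
  move=> r1 r2 r1S r2S E; apply/permP => x.
  have xin : x \in a :: F r1.
    by rewrite FE -(orb _ r1S) -porbit_traject (transitive_permP a) ?inE //; move: r1S; rewrite inE => /andP[].
  have := Fcyc _ r1S => /(next_cycle)/(_ xin) /eqP ->.
  by have := Fcyc _ r2S; rewrite -E => /(next_cycle)/(_ xin) /eqP ->.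
rewrite -(card_in_imset FI); apply: eq_card => t; apply/imsetP/idP.
  case=> rho rS ->; rewrite inE is_trail_cycle.
  have /= /andP[aF ->] := Funiq _ rS.
  apply/and3P; split=> //.
    apply: sub_cycle (Fcyc _ rS) => x y /= /eqP <-.
    by move: rS; rewrite inE => /andP[_ /forallP].
  apply/allP => b bF; rewrite !inE andbT; apply: contraNneq aF => ba.
  by rewrite /= -{1}ba.
rewrite inE is_trail_cycle => /and3P[cyc ut /allP tA].
have us : uniq (a :: t).
  by rewrite /= ut andbT; apply/negP => /tA; rewrite !inE eqxx.
have nI : injective (next (a :: t)) by apply: can_inj (prev_next us).
have all_in x : x \in a :: t.
  have := uniq_leq_size us (fun y _ => mem_enum Arc y).
  have [] := uniq_min_size us (fun y _ => (mem_enum Arc y)).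
    by rewrite -cardE /= size_tuple (prednK N0).
  by move=> _ /(_ x); rewrite mem_enum.
have [rho rhoE] : exists rho : {perm Arc}, forall x, rho x = next (a :: t) x.
  by exists (perm nI) => x; rewrite permE.
have fc : fcycle (rho) (a :: t).
  have := cycle_next us; apply: sub_cycle => x y /= /eqP <-.
  by rewrite rhoE.
have tE : tval t = traject (rho) (rho a) #|Arc|.-1.
  move: fc => /=; rewrite rcons_path => /andP[/fpathP[m Em] _].
  by have := congr1 size Em; rewrite size_tuple size_traject => Em'; rewrite [LHS]Em -Em'.
exists rho; last by apply: val_inj.
rewrite inE; apply/andP; split.
  apply/cards1P; exists [set: Arc]%SET; apply/setP => C; rewrite inE.
  have full x : porbit (rho) x = [set: Arc]%SET.
    apply/setP => y; rewrite inE.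
    have H z : z \in porbit (rho) a.
      have := all_in z; rewrite tE -[_ :: _]/(traject _ _ #|Arc|.-1.+1).
      by move=> /trajectP[i _ ->]; apply/porbitP; exists i; rewrite permX.
    have := H x; rewrite porbit_sym => Hx.
    by move: (H y); rewrite -eq_porbit_mem in Hx; rewrite (eqP Hx).
  apply/imsetP/eqP => [[x _ ->]|->]; first exact: full.
  by exists a => //; rewrite full.
apply/forallP => x; rewrite rhoE.
by have := next_cycle cyc (all_in x).
Qed.

End CyclicTrails.

(** * Spanning trees and splittings of a vertex *)

Section Laplacian.
Variables (E V : finType) (p q : E -> V).
Implicit Types (u v w r i j a b : V) (e : E) (S : {set E}).

Definition edelta e u : rat := (p e == u)%:R - (q e == u)%:R.

Definition qlap u w : rat := \sum_e edelta e u * edelta e w.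

Definition unitrow u w : rat := (u == w)%:R.

(* By the matrix-tree theorem, the number of spanning trees. *)
Definition tau r : rat := fdet (setrow qlap r (unitrow r)).

(** For distinct [i] and [j], the determinant of the Laplacian without the rows and columns of both.
    It counts the spanning forests with two trees that separate [i] from [j], that is, the spanning
    trees through one additional edge joining them. *)
Definition minor2 i j : rat :=
  fdet (setrow (setrow qlap i (unitrow i)) j (unitrow j)).

Lemma sum_unitrow u : \sum_w unitrow u w = 1.
Proof.
rewrite (bigD1 u) //= /unitrow eqxx big1 ?addr0 // => w.
by rewrite eq_sym => /negPf->.
Qed.

Lemma sum_edelta e : \sum_w edelta e w = 0.
Proof. by rewrite sumrB !sum_unitrow subrr. Qed.

Lemma qlapC u w : qlap u w = qlap w u.
Proof. by apply: eq_bigr => e _; rewrite mulrC. Qed.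

Lemma sum_qlap u : \sum_w qlap u w = 0.
Proof.
rewrite exchange_big big1 // => e _.
by rewrite -mulr_sumr sum_edelta mulr0.
Qed.

Lemma fdet_zerosum (M : V -> V -> rat) v : (forall u, \sum_w M u w = 0) -> fdet M = 0.
Proof.
move=> M0; apply: (@fdet_ker _ M (fun=> 1) v); first exact: oner_neq0.
by move=> u; under eq_bigr do rewrite mulr1.
Qed.

(** The rows of the Laplacian add up to 0, so the new row is minus the sum of the remaining
    Laplacian rows, and these all occur in [N]. *)
Lemma qlap_row_opp (N : V -> V -> rat) v (P : pred V) :
  ~~ P v -> (forall u w, u != v -> ~~ P u -> N u w = qlap u w) ->
  fdet (setrow N v (fun w => qlap v w + \sum_(u | P u) qlap u w)) = 0.
Proof.
move=> Pv NE.
have E0 w : qlap v w + \sum_(u | P u) qlap u w =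
    \sum_(u | (u != v) && ~~ P u) (- qlap u w).
  apply/eqP; rewrite -subr_eq0 -sumrN; apply/eqP.
  under [X in _ + X]eq_bigr do rewrite opprK.
  rewrite -[RHS](sum_qlap w); under [RHS]eq_bigr do rewrite qlapC.
  rewrite [RHS](bigD1 v) //= -addrA; congr (_ + _).
  rewrite [RHS](bigID P) /=; congr (_ + _); apply: eq_bigl => u.
  by case: eqP => //= ->; rewrite (negPf Pv).
transitivity (fdet (setrow N v (fun w => \sum_(u | (u != v) && ~~ P u) (- qlap u w)))).
  by apply: eq_fdet => u w; rewrite /setrow E0.
rewrite fdet_sum big1 // => u /andP[uv Pu].
transitivity (fdet (setrow N v (fun w => -1 * qlap u w))).
  by apply: eq_fdet => a w; rewrite /setrow mulN1r.
rewrite fdetZ (@fdet_alt _ _ u v) ?mulr0 // => w.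
by rewrite /setrow eqxx (negPf uv) NE.
Qed.

(** Vanishing row sums allow the unit row of [r] to be replaced by that of [r']; vanishing column
    sums then allow row [r'] to be traded for minus row [r], and a swap of the two rows restores the
    sign. *)
Lemma tau_root r r' : tau r = tau r'.
Proof.
have [->//|rr'] := eqVneq r r'.
pose F x y := fdet (setrow (setrow qlap r x) r' y).
have tr : tau r = F (unitrow r) (qlap r').
  rewrite /F setrow_id // => w; rewrite /setrow eq_sym (negPf rr') //.
have tr' : tau r' = F (qlap r) (unitrow r').
  rewrite /F (setrowC _ _ _ rr') setrow_id // => w.
  by rewrite /setrow (negPf rr').
have H1 : F (unitrow r) (qlap r') = F (unitrow r') (qlap r').
  apply/eqP; rewrite -subr_eq0 /F !(setrowC _ _ _ rr') -fdetB; apply/eqP.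
  apply: (@fdet_zerosum _ r) => u; rewrite /setrow.
  case: (u == r); first by rewrite sumrB !sum_unitrow subrr.
  by case: (u == r'); rewrite sum_qlap.
have H2 : F (unitrow r') (qlap r') + F (unitrow r') (qlap r) = 0.
  rewrite /F -fdetD.
  rewrite -[RHS](@qlap_row_opp (setrow qlap r (unitrow r')) r' (pred1 r)) /=.
  - by apply: eq_fdet => u w; rewrite /setrow big_pred1_eq.
  - by rewrite eq_sym.
  - by move=> u w ur' ur; rewrite /setrow (negPf ur).
rewrite tr tr' H1 [RHS]fdet_swap //.
by apply/eqP; rewrite -addr_eq0; apply/eqP.
Qed.

Lemma minor2C i j : i != j -> minor2 i j = minor2 j i.
Proof. by move=> ij; rewrite /minor2 setrowC. Qed.

(* Euler's relation for [tau], which is homogeneous of degree [#|V| - 1] in the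
   multiplicities of the edges. *)
Lemma sum_minor2 r : (forall e, p e != q e) ->
  \sum_e minor2 (p e) (q e) = #|V|.-1%:R * tau r.
Proof.
move=> pq; pose G u x := fdet (setrow (setrow qlap r (unitrow r)) u x).
have GZ u c x : G u (fun w => c * x w) = c * G u x by rewrite /G fdetZ.
(* Row [u] of the Laplacian is a sum over the edges. Summing this expansion over all [u != r]
   produces the factor [#|V| - 1]. *)
have tG u : u != r -> tau r = \sum_e edelta e u * G u (edelta e).
  move=> ur; rewrite /tau -(@setrow_id _ _ u (qlap u)); last first.
    by move=> w; rewrite /setrow (negPf ur).
  rewrite /qlap fdet_sum; apply: eq_bigr => e _.
  by rewrite fdetZ.
have -> : #|V|.-1%:R * tau r = \sum_(u | u != r) tau r.
  rewrite sumr_const mulr_natl; congr (_ *+ _).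
  by rewrite -(cardC1 r); apply: eq_card => u; rewrite !inE.
(* It remains to collect the contributions of a single edge, which come from the rows of its two
   ends. The case where one end is the root is direct. *)
rewrite (eq_bigr _ tG) [RHS]exchange_big; apply: eq_bigr => e _ /=.
set i := p e; set j := q e; have ij : i != j by exact: pq.
have eE w : edelta e w = unitrow i w - unitrow j w by [].
have GB u : G u (edelta e) = G u (unitrow i) - G u (unitrow j).
  by rewrite /G -fdetB; apply: eq_fdet => a w; rewrite /setrow eE.
have Gr u : u != r -> G u (unitrow r) = 0.
  by move=> ur; rewrite /G fdet_alt2 // eq_sym.
have sumE : \sum_(u | u != r) edelta e u * G u (edelta e) =
    (i != r)%:R * G i (edelta e) - (j != r)%:R * G j (edelta e).
  transitivity (\sum_(u | u != r) (unitrow i u * G u (edelta e)) -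
                \sum_(u | u != r) (unitrow j u * G u (edelta e))).
    by rewrite -sumrB; apply: eq_bigr => u _; rewrite eE mulrBl.
  have H k : \sum_(u | u != r) (unitrow k u * G u (edelta e)) =
      (k != r)%:R * G k (edelta e).
    rewrite big_mkcond (bigD1 k) //= big1 => [|u uk]; last first.
      by rewrite /unitrow [k == u]eq_sym (negPf uk) mul0r if_same.
    by rewrite addr0 /unitrow eqxx mul1r; case: ifP; rewrite ?mul1r ?mul0r.
  by rewrite !H.
rewrite sumE; clearbody i j.
have [ir|ir] := eqVneq i r.
  have jr : j != r by rewrite -ir eq_sym.
  by rewrite mul0r sub0r jr mul1r GB ir Gr // sub0r opprK /minor2.
rewrite mul1r; have [jr|jr] := eqVneq j r.
  by rewrite mul0r subr0 GB jr Gr // subr0 minor2C // jr.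
rewrite mul1r.
pose D (a b c : V -> rat) := fdet (setrow (setrow (setrow qlap r a) i b) j c).
have Gi x : G i x = D (unitrow r) x (qlap j).
  rewrite /D setrow_id // => w.
  by rewrite /setrow eq_sym (negPf ij) (negPf jr).
have Gj x : G j x = - D (unitrow r) x (qlap i).
  rewrite /D -fdet_swap // /G.
  apply: eq_fdet => u w; rewrite /setrow; case: (u == j) => //.
  by case: (eqVneq u i) => [->|//]; rewrite (negPf ir).
rewrite Gi Gj opprK.
(* The Laplacian rows of [i], [j] and [r] together are minus the sum of the others, all still
   present in the matrix. *)
have D0 : D (unitrow r) (edelta e) (qlap j) + D (unitrow r) (edelta e) (qlap i) +
    D (unitrow r) (edelta e) (qlap r) = 0.
  rewrite /D -!fdetD.
  rewrite -[RHS](@qlap_row_opp (setrow (setrow qlap r (unitrow r)) i (edelta e)) j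
     (fun u => (u == r) || (u == i))) /=.
  - apply: eq_fdet => u w; rewrite /setrow; case: (u == j) => //.
    rewrite (bigD1 r) ?eqxx //= (big_pred1 i) => [|v]; first by rewrite -addrA [qlap i w + _]addrC.
    by case: eqP => [->|] /=; rewrite ?andbT // ?andbF // eq_sym (negPf ir).
  - by rewrite negb_or jr eq_sym.
  - by move=> u w uj; rewrite negb_or => /andP[ur ui]; rewrite /setrow (negPf ui) (negPf ur).
have -> : D (unitrow r) (edelta e) (qlap j) + D (unitrow r) (edelta e) (qlap i) =
    D (qlap r) (edelta e) (unitrow r).
  apply/eqP; rewrite -subr_eq0; apply/eqP; rewrite -[RHS]D0; congr (_ + _).
  rewrite /D; have sC (a c : V -> rat) : fdet (setrow (setrow (setrow qlap r a) i (edelta e)) j c) =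
      fdet (setrow (setrow (setrow qlap i (edelta e)) r a) j c).
    apply: eq_fdet => u w; rewrite /setrow; case: (u == j) => //.
    by case: (eqVneq u i) => [->|//]; rewrite (negPf ir).
  by rewrite !sC fdet_swap ?opprK // eq_sym.
have -> : D (qlap r) (edelta e) (unitrow r) = D (qlap r) (edelta e) (unitrow j).
  apply/eqP; rewrite -subr_eq0 /D -fdetB; apply/eqP.
  apply: (@fdet_zerosum _ r) => u; rewrite /setrow.
  case: (u == j); first by rewrite sumrB !sum_unitrow subrr.
  case: (u == i); first exact: sum_edelta.
  by case: (u == r); rewrite sum_qlap.
have -> : D (qlap r) (edelta e) (unitrow j) =
    D (qlap r) (unitrow i) (unitrow j) - D (qlap r) (unitrow j) (unitrow j).
  rewrite /D !(setrowC _ _ _ ij) -fdetB; apply: eq_fdet => u w; rewrite /setrow.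
  by case: (u == i) => //; rewrite eE.
rewrite [X in _ - X]fdet_alt2 // subr0 /D /minor2.
apply: eq_fdet => u w; rewrite /setrow; case: (u == j) => //; case: (u == i) => //.
by case: eqP => // ->.
Qed.


Lemma fdet_colsum (M : V -> V -> rat) i :
  fdet (fun u w => if w == i then \sum_v M u v else M u w) = fdet M.
Proof.
rewrite -fdet_tr -[RHS]fdet_tr; set N := (fun u v => M v u).
transitivity (fdet (setrow N i (fun w => \sum_v N v w))).
  by apply: eq_fdet => u w; rewrite /setrow.
rewrite fdet_sum (bigD1 i) //= setrow_id // big1 ?addr0 // => v vi.
apply: (@fdet_alt _ _ i v) => [|w]; first by rewrite eq_sym.
by rewrite /setrow eqxx (negPf vi).
Qed.

(* Vertex [i] is split into two vertices, the new one (which is the root)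
   taking the edges of [S]. *)
Definition qlap_split S u w : rat :=
  \sum_(e in ~: S) edelta e u * edelta e w + \sum_(e in S) unitrow (q e) u * unitrow (q e) w.

(** Expanding along column [i] and row [i] deletes the rows [i], [a] and the columns [i], [b]. By
    the all-minors matrix-tree theorem this counts, for [a] and [b] different from [i], the spanning
    forests with two trees, one containing [i] and the other containing both [a] and [b]. *)
Definition glap2 i a b : rat :=
  fdet (fun u w => if w == i then unitrow a u
                   else if u == i then - unitrow b w else qlap u w).

(** Adding the edge [e] to a forest counted by [glap2 i (q e) b] gives a spanning tree, in which [e]
    is the first edge of the path from [i] to [b]. The determinants express this by summing
    columns. *)
Lemma glap2_sum i b : b != i -> (forall e, q e != i) ->
  \sum_(e | p e == i) glap2 i (q e) b = tau i.
Proof.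
move=> bi qi.
pose N (x : V -> rat) w u := if w == i then x u else if u == i then - unitrow b w else qlap u w.
have gE a : glap2 i a b = fdet (setrow (N (unitrow a)) i (unitrow a)).
  rewrite /glap2 -fdet_tr; apply: eq_fdet => w u; rewrite /setrow /N.
  by case: (w == i).
under eq_bigr => e _.
  rewrite gE; have -> : fdet (setrow (N (unitrow (q e))) i (unitrow (q e))) =
     fdet (setrow (N (fun=> 0)) i (unitrow (q e))).
    by apply: eq_fdet => w u; rewrite /setrow /N; case: (w == i).
  over.
rewrite -fdet_sum.
pose P u w := if u == i then unitrow i w - unitrow b w else if w == i then 0 else qlap u w.
transitivity (fdet P).
  rewrite -(fdet_colsum P i) -[RHS]fdet_tr; apply: eq_fdet => w u; rewrite /setrow /N /P.
  case: (eqVneq w i) => [wi|wi].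
    case: (eqVneq u i) => [->|ui].
      rewrite sumrB !sum_unitrow subrr big1 // => e _.
      by rewrite /unitrow (negPf (qi e)).
    transitivity (- qlap u i).
      rewrite /qlap -sumrN big_mkcond; apply: eq_bigr => e _.
      rewrite /edelta /unitrow [p e == u]eq_sym (negPf (qi e)) subr0.
      case: (eqVneq (p e) i) => [->|_]; last by rewrite mulr0 oppr0.
      by rewrite (negPf ui) sub0r mulr1 opprK.
    apply/eqP; rewrite -subr_eq0 -opprD oppr_eq0; apply/eqP.
    rewrite -[RHS](sum_qlap u) (bigD1 i) //= eqxx add0r [RHS](bigD1 i) //=; congr (_ + _).
    by apply: eq_bigr => v /negPf->.
  case: (eqVneq u i) => [_|ui] //.
  by rewrite [unitrow i w]/unitrow eq_sym (negPf wi) sub0r.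
pose P2 u w := if (u == i) || (w == i) then unitrow u w else qlap u w.
have PT : forall w, P^~ i w = (i == w)%:R.
  move=> w; rewrite /P; case: (eqVneq w i) => [_|wi]; last by rewrite eqxx.
  by rewrite /unitrow eqxx (negPf bi) subr0.
transitivity (fdet P2).
  rewrite -fdet_tr -[RHS]fdet_tr; apply: (@fdet_unitcol _ _ _ i).
  - exact: PT.
  - by move=> w; rewrite /P2 eqxx orbT /unitrow eq_sym.
  - by move=> u w wi; rewrite /P /P2 (negPf wi) /= /unitrow; case: eqP => // ->; rewrite (negPf wi).
apply: (@fdet_unitcol _ _ _ i).
- by move=> w; rewrite /P2 eqxx.
- by move=> w; rewrite /setrow eqxx.
- move=> u w wi; rewrite /P2 /setrow (negPf wi) orbF.
  by case: eqP => [->|].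
Qed.

Lemma glap2_diag i a : a != i -> glap2 i a a = minor2 i a.
Proof.
move=> ai; have ia : i != a by rewrite eq_sym.
pose B u w := if w == i then 0 else qlap u w.
have -> : glap2 i a a =
    fdet (setrow (setrow B i (fun w => - unitrow a w)) a
       (fun w => if w == i then 1 else qlap a w)).
  apply: eq_fdet => u w; rewrite /setrow /B.
  have [->|wi] := eqVneq w i.
    rewrite /unitrow (negPf ai) oppr0; by case: (eqVneq u a) => _; rewrite ?eqxx ?if_same.
  by case: (eqVneq u a) => [->|ua]; rewrite ?(negPf ai) ?(negPf wi).
rewrite fdet_swap // -[LHS]mulN1r -fdetZ.
transitivity (fdet (fun u w => if (u == i) || (u == a) then unitrow u w
                               else if w == i then 0 else qlap u w)); last first.
  apply: (@fdet_unitcol _ _ _ i) => [w|w|u w wi].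
  - by rewrite eqxx.
  - by rewrite /setrow eqxx (negPf ia).
  rewrite /setrow (negPf wi); case: (eqVneq u a) => [->|ua]; first by rewrite orbT.
  by rewrite orbF; case: (eqVneq u i) => [->|].
rewrite -fdet_tr -[RHS]fdet_tr; apply: (@fdet_unitcol _ _ _ i).
- move=> w; rewrite /setrow; case: (eqVneq w a) => [->|wa].
    by rewrite /unitrow (negPf ai) (negPf ia) oppr0 mulr0.
  by case: (eqVneq w i) => [_|wi]; rewrite /B !eqxx.
- move=> w; rewrite eqxx /unitrow [i == w]eq_sym.
  by case: (eqVneq w i) => _; case: (w == a).
- move=> w u ui; rewrite /setrow; case: (eqVneq u a) => [->|ua].
    by rewrite orbT /unitrow mulN1r opprK.
  by rewrite (negPf ui) /= /B; case: (w == i).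
Qed.

(** In a spanning tree of the split graph, the path between the two copies of [i] starts with some
    [e] in [S] and ends with some [e'] outside [S]. Removing both edges and merging the copies
    leaves a forest counted by [glap2 i (q e) (q e')]. *)
Lemma fdet_split i S : S \subset [set e | p e == i]%SET -> (forall e, q e != i) ->
  fdet (qlap_split S) =
  \sum_(e in S) \sum_(e' in [set e | p e == i] :\: S) glap2 i (q e) (q e').
Proof.
move=> /fintype.subsetP SA qi.
have pS e : e \in S -> p e = i by move=> /SA; rewrite inE => /eqP.
have rowi w : qlap_split S i w = \sum_(e' in [set e | p e == i] :\: S) edelta e' w.
  rewrite /qlap_split [X in _ + X]big1 ?addr0 => [|e eS]; last first.
    by rewrite {1}/unitrow (negPf (qi e)) mul0r.
  rewrite big_mkcond [RHS]big_mkcond; apply: eq_bigr => e _; rewrite !inE.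
  case: (e \in S) => //=; rewrite {1}/edelta (negPf (qi e)) subr0.
  by case: (p e == i); rewrite ?mul1r ?mul0r.
rewrite -(@setrow_id _ (qlap_split S) i _ (fun w => esym (rowi w))) fdet_sum.
under [RHS]eq_bigr => e _ do [].
rewrite [RHS]exchange_big; apply: eq_bigr => e'; rewrite !inE => /andP[_ /eqP pe'].
rewrite -(fdet_colsum _ i).
pose N (x : V -> rat) w u := if w == i then x u else if u == i then - unitrow (q e') w else qlap u w.
have gE a : glap2 i a (q e') = fdet (setrow (N (fun=> 0)) i (unitrow a)).
  rewrite /glap2 -fdet_tr; apply: eq_fdet => w u; rewrite /setrow /N.
  by case: (w == i).
under [RHS]eq_bigr do rewrite gE.
rewrite -fdet_sum -fdet_tr; apply: eq_fdet => w u; rewrite /setrow /N.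
case: (eqVneq w i) => [_|wi].
  case: (eqVneq u i) => [->|ui].
    rewrite sum_edelta big1 // => e eS.
    by rewrite /unitrow (negPf (qi e)).
  rewrite /qlap_split big_split /= -[RHS]add0r; congr (_ + _).
    by rewrite exchange_big big1 // => e _; rewrite -mulr_sumr sum_edelta mulr0.
  by rewrite exchange_big; apply: eq_bigr => e _; rewrite -mulr_sumr sum_unitrow mulr1.
case: (eqVneq u i) => [_|ui].
  by rewrite /edelta pe' eq_sym (negPf wi) sub0r.
rewrite /qlap_split /qlap [RHS](bigID [in S]) /= addrC; congr (_ + _).
  by apply: eq_bigl => e; rewrite inE.
apply: eq_bigr => e /pS pe.
by rewrite /edelta pe ![i == _]eq_sym (negPf wi) (negPf ui) !sub0r mulrNN.
Qed.

Definition split_end S e : option V := if e \in S then None else Some (p e).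

End Laplacian.

Lemma tau_split (E V : finType) (p q : E -> V) (S : {set E}) :
  tau (split_end p S) (Some \o q) None = fdet (qlap_split p q S).
Proof.
rewrite /tau fdet_option; last by move=> w; rewrite /setrow eqxx.
apply: eq_fdet => u w; rewrite /setrow /= /qlap /qlap_split (bigID [in S]) addrC /=.
congr (_ + _).
  apply: eq_bigr => e eS.
  by rewrite /edelta /split_end eS /= !sub0r mulrNN.
apply: eq_big => [e|e /negPf eS]; first by rewrite inE.
by rewrite /edelta /split_end eS /=.
Qed.

Lemma sum_subset_card (T : finType) (B : {set T}) (F : nat -> rat) :
  \sum_(S : {set T} | S \subset B) F #|S| = \sum_(m < #|B|.+1) 'C(#|B|, m)%:R * F m.
Proof.
pose h (S : {set T}) : 'I_#|B|.+1 := inord #|S|.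
rewrite (partition_big h xpredT) //=; apply: eq_bigr => m _.
have hE (S : {set T}) : S \subset B -> (h S == m) = (#|S| == m).
  by move=> /subset_leq_card SB; rewrite -(inj_eq val_inj) /= inordK.
rewrite -(cards_draws B m) mulr_natl -sumr_const.
apply: eq_big => [S|S /andP[SB]].
  by rewrite inE; case: (boolP (S \subset B)) => //= /hE ->.
by rewrite hE // => /eqP->.
Qed.

(** The sets with [#|S| = m + 1] together contribute [(#|A| - 2)!], and [m] takes [#|A| - 1] values.
    Equivalently, multiplication by the transposition of [e] and [e'] matches the full cycles on [A]
    with the permutations having two cycles that separate [e] from [e']. *)
Lemma sum_separating (T : finType) (A : {set T}) e e' :
  e \in A -> e' \in A -> e != e' ->
  \sum_(S : {set T} | [&& S \subset A, e \in S & e' \notin S])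
    ((#|S|.-1)`! * (#|A| - #|S|).-1`!)%:R = (#|A|.-1)`!%:R :> rat.
Proof.
move=> eA e'A ee'.
pose B := (A :\ e :\ e')%SET.
have cB : #|A| = #|B|.+2.
  by rewrite (cardsD1 e) eA (cardsD1 e') !inE eq_sym ee' e'A.
have eB : e \notin B by rewrite !inE eqxx andbF.
have e'B : e' \notin B by rewrite !inE eqxx.
rewrite (reindex_onto (fun S => e |: S)%SET (fun S => S :\ e)%SET) /=; last first.
  by move=> S /and3P[_ eS _]; rewrite finset.setD1K.
transitivity (\sum_(S : {set T} | S \subset B) ((#|S|) `! * (#|B| - #|S|)`!)%:R : rat).
  apply: eq_big => S.
    rewrite finset.setU11 /= !inE eq_sym (negPf ee') /=; apply/idP/idP.
      case/andP=> /andP[SA e'S] /eqP/setP E.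
      apply/fintype.subsetP => x xS; rewrite !inE.
      have xe : x != e by move: (E x); rewrite !inE xS; case: (x == e).
      rewrite xe (fintype.subsetP SA) ?inE ?xS ?orbT // !andbT.
      by apply: contraNneq e'S => <-.
    move=> SB; apply/andP; split; first (apply/andP; split).
    - apply/fintype.subsetP => x; rewrite !inE => /orP[/eqP->//|xS].
      by move: (fintype.subsetP SB _ xS); rewrite !inE => /and3P[].
    - by apply: contra e'B => /(fintype.subsetP SB).
    - apply/eqP/setP => x; rewrite !inE; case: (eqVneq x e) => //= ->.
      by apply/esym/negbTE; apply: contra eB => /(fintype.subsetP SB).
  case/andP=> /and3P[_ _ _] /eqP/setP/(_ e); rewrite !inE eqxx /= => /esym eS.
  rewrite cardsU1 eS cB add1n subSS.
  by have -> : (#|B|.+1 - #|S|).-1 = (#|B| - #|S|)%N by lia.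
rewrite (sum_subset_card B (fun m => (m`! * (#|B| - m)`!)%:R)) cB /= factS natrM.
rewrite mulr_natl -[X in _ *+ X](card_ord #|B|.+1) -sumr_const.
by apply: eq_bigr => m _; rewrite -natrM bin_fact // -ltnS.
Qed.

Section SplitSum.
Variables (E V : finType) (p q : E -> V).

(** Every pair of distinct edges at [i] receives the total weight [(#|A| - 1)!]. Completed by the
    diagonal, the pairs sum to [#|A|] times [tau] by [glap2_sum]; the diagonal terms to be
    subtracted are the values of [minor2]. *)
Lemma split_sum i (A := [set e | p e == i]%SET) : (forall e, q e != i) -> (0 < #|A|)%N ->
  \sum_(S : {set E} | S \subset A) ((#|S|.-1)`! * (#|A| - #|S|).-1`!)%:R *
    tau (split_end p S) (Some \o q) None =
  (#|A|.-1)`!%:R * (#|A|%:R * tau p q i - \sum_(e in A) minor2 p q i (q e)).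
Proof.
move=> qi A0.
under eq_bigr => S SA do rewrite tau_split (fdet_split SA qi) mulr_sumr.
transitivity (\sum_(e in A) \sum_(e' in A | e != e')
   (#|A|.-1)`!%:R * glap2 p q i (q e) (q e')).
  rewrite (exchange_big_dep [in A]) /=; last first.
    by move=> S e /fintype.subsetP SA /SA.
  apply: eq_bigr => e eA; under eq_bigr do rewrite mulr_sumr.
  rewrite (exchange_big_dep [in A]) /=; last first.
    by move=> S e' _; rewrite inE => /andP[].
  rewrite [LHS](bigID (fun e' => e == e')) /= big1 ?add0r => [|e']; last first.
    case/andP=> _ /eqP<-; rewrite big_pred0 // => S.
    by rewrite inE; case: (e \in S); rewrite ?andbF.
  apply: eq_bigr => e' /andP[e'A ee']; rewrite -mulr_suml; congr (_ * _).
  rewrite -(sum_separating eA e'A ee'); apply: eq_bigl => S.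
  by rewrite inE e'A andbT andbA.
set K := ((#|A|.-1)`!%:R : rat).
have full e : e \in A -> \sum_(e' in A | e != e') K * glap2 p q i (q e) (q e') =
    \sum_(e' in A) K * glap2 p q i (q e) (q e') - K * minor2 p q i (q e).
  move=> eA; rewrite [in RHS](bigD1 e) //= glap2_diag // addrC addrK.
  by apply: eq_bigl => e'; rewrite eq_sym.
rewrite (eq_bigr _ full) sumrB -mulr_sumr mulrBr; congr (_ - _).
rewrite exchange_big /= mulr_natl -sumr_const mulr_sumr; apply: eq_bigr => e' _.
rewrite -mulr_sumr; congr (_ * _); rewrite -(@glap2_sum _ _ p q i (q e')) //.
by apply: eq_bigl => e; rewrite inE.
Qed.

End SplitSum.

(** * Connectedness, cuts and the determinant of a tree *)

Section Connected.
Variables (E V : finType) (p q : E -> V).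
Implicit Types (S : {set V}) (e : E).

Definition conn : bool :=
  [forall S : {set V}, [forall e, (p e \in S) == (q e \in S)] ==>
     (S == finset.set0) || (S == [set: V]%SET)].

Definition is_cut e S : bool :=
  [&& p e \in S, q e \notin S &
      [forall e', (e' != e) ==> ((p e' \in S) == (q e' \in S))]].

Lemma connP : reflect (forall S, (forall e, (p e \in S) = (q e \in S)) ->
    S = finset.set0 \/ S = [set: V]%SET) conn.
Proof.
apply: (iffP forallP) => H S.
  move=> E0; have /implyP/(_ _)/orP := H S.
  by move=> /(_ _)[]; [apply/forallP => e; rewrite E0|move=> /eqP->; left|move=> /eqP->; right].
apply/implyP => /forallP E0; case: (H S) => [e|->|->]; first exact/eqP.
  by rewrite eqxx.
by rewrite eqxx orbT.
Qed.

Lemma conn_const (T : eqType) (y : V -> T) : conn ->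
  (forall e, y (p e) = y (q e)) -> forall u v, y u = y v.
Proof.
move=> /connP H yE u v.
have [e|S0|ST] := H [set x | y x == y v]%SET; first by rewrite !inE yE.
  by have := finset.in_set0 v; rewrite -S0 inE eqxx.
by have := finset.in_setT u; rewrite -ST inE => /eqP.
Qed.

(** The left kernel of the incidence matrix consists of constant vectors, so its rank is at least
    [#|V| - 1], while it has [#|E|] columns. *)
Lemma conn_card : conn -> (#|V| <= #|E|.+1)%N.
Proof.
move=> cn; pose M : 'M[rat]_(#|V|, #|E|) :=
  \matrix_(a, x) ((p (enum_val x) == enum_val a)%:R - (q (enum_val x) == enum_val a)%:R).
have : (kermx M <= (const_mx 1 : 'rV[rat]_#|V|))%MS.
  apply/rV_subP => y /sub_kermxP yM.
  have H u v : y 0 (enum_rank u) = y 0 (enum_rank v).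
    apply: (conn_const cn (y := fun u => y 0 (enum_rank u))) => e.
    move/rowP/(_ (enum_rank e)): yM; rewrite !mxE.
    under eq_bigr => a _ do rewrite mxE enum_rankK mulrBr.
    rewrite sumrB.
    have S w : \sum_a y 0 a * (w == enum_val a)%:R = y 0 (enum_rank w).
      rewrite (bigD1 (enum_rank w)) //= enum_rankK eqxx mulr1 big1 ?addr0 // => a aw.
      case: eqP => [wa|]; last by rewrite mulr0.
      by rewrite wa enum_valK eqxx in aw.
    by rewrite !S => /eqP; rewrite subr_eq0 => /eqP.
  apply/submxP; exists (if [pick u : V] is Some u then (y 0 (enum_rank u))%:M else 0).
  apply/rowP => a; case: pickP => [u _|/(_ (enum_val a))//].
  by rewrite mul_scalar_mx !mxE mulr1 -(H (enum_val a)) enum_valK.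
move=> /mxrankS; rewrite mxrank_ker => /leq_trans/(_ (rank_leq_row _)).
have := rank_leq_col M; lia.
Qed.

(** The indicator of a union of components that avoids the root is in the kernel. *)
Lemma tau_conn r : ~~ conn -> tau p q r = 0.
Proof.
rewrite negb_forall => /existsP[S]; rewrite negb_imply negb_or.
case/and3P => /forallP SE S0 ST.
wlog rS : S S0 ST SE / r \notin S.
  move=> W; case: (boolP (r \in S)) => rS; last exact: (W S).
  apply: (W (~: S)%SET).
  - by apply: contra ST => /eqP SC; rewrite -[S]finset.setCK SC finset.setC0.
  - by apply: contra S0 => /eqP SC; rewrite -[S]finset.setCK SC finset.setCT.
  - by move=> e; rewrite !inE (eqP (SE e)).
  - by rewrite inE rS.
have [v vS] := set0Pn _ S0.
apply: (@fdet_ker _ _ (fun u => (u \in S)%:R) v); first by rewrite vS oner_eq0.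
move=> u; rewrite /setrow; case: eqP => [_|ur].
  rewrite big1 // => w _; rewrite /unitrow; case: eqP => [<-|]; last by rewrite mul0r.
  by rewrite (negPf rS) mulr0.
under eq_bigr => w _ do rewrite /qlap mulr_suml.
rewrite exchange_big big1 // => e _.
under eq_bigr => w _ do rewrite -mulrA.
rewrite -mulr_sumr.
under eq_bigr => w _ do rewrite /edelta mulrBl.
rewrite sumrB.
have H x : \sum_w (x == w)%:R * (w \in S)%:R = (x \in S)%:R :> rat.
  rewrite (bigD1 x) //= eqxx mul1r big1 ?addr0 // => w.
  by rewrite eq_sym => /negPf->; rewrite mul0r.
by rewrite !H (eqP (SE e)) subrr mulr0.
Qed.

Lemma tau_isolated r v w : v != w ->
  (forall e, p e != v) -> (forall e, q e != v) -> tau p q r = 0.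
Proof.
move=> vw pv qv; apply: tau_conn; apply/negP => /connP H.
have [e|S0|ST] := H [set v]%SET; first by rewrite !inE (negPf (pv e)) (negPf (qv e)).
  by have := finset.in_set0 v; rewrite -S0 inE eqxx.
by have := finset.in_setT w; rewrite -ST inE eq_sym (negPf vw).
Qed.

End Connected.

(** Without [e] there are too few edges for connectedness, and the two sides that appear are joined
    by [e] alone. *)
Lemma tree_cut (E V : finType) (p q : E -> V) :
  conn p q -> #|V| = #|E|.+1 -> forall e, exists S, is_cut p q e S.
Proof.
move=> cn cV e; pose E' := {x : E | x != e}.
have cE' : #|{: E'}| = #|E|.-1.
  by rewrite card_sig -(cardC1 e); apply: eq_card => x; rewrite !inE.
have E0 : (0 < #|E|)%N by apply/card_gt0P; exists e.
have : ~~ conn (p \o val : E' -> V) (q \o val).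
  by apply/negP => /conn_card; rewrite cE' cV prednK // ltnn.
rewrite negb_forall => /existsP[S]; rewrite negb_imply negb_or.
case/and3P => /forallP SE S0 ST.
have SE' x : x != e -> (p x \in S) = (q x \in S).
  by move=> xe; apply/eqP; exact: (SE (exist _ x xe)).
have pq : (p e \in S) != (q e \in S).
  apply/negP => /eqP Se; case: (connP _ _ cn S) => [x|/eqP|/eqP]; last 2 first.
  - by rewrite (negPf S0).
  - by rewrite (negPf ST).
  by have [->|/SE'] := eqVneq x e.
case pS : (p e \in S) pq; case qS : (q e \in S) => // _.
  exists S; rewrite /is_cut pS qS /=; apply/forallP => x; apply/implyP => /SE' ->.
  by [].
exists (~: S)%SET; rewrite /is_cut !inE pS qS /=; apply/forallP => x.
by apply/implyP => /SE' xS; rewrite !inE xS.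
Qed.

Lemma fdet_mul (V : finType) (A C : V -> V -> rat) :
  fdet (fun u w => \sum_v A u v * C v w) = fdet A * fdet C.
Proof.
rewrite -det_mulmx; congr (\det _); apply/matrixP => a b; rewrite !mxE.
rewrite (reindex (@enum_val V V)) /=; last first.
  by apply/onW_bij/enum_val_bij.
by apply: eq_bigr => c _; rewrite !mxE.
Qed.

Lemma fdet_int (V : finType) (A : V -> V -> rat) :
  (forall u w, A u w \is a Num.int) -> fdet A \is a Num.int.
Proof.
move=> Ai; rewrite /fdet /determinant; apply: rpred_sum => s _.
by apply: rpredM; [exact: rpredX | apply: rpred_prod => a _; rewrite mxE].
Qed.

Lemma int_unit_sqr (x y : rat) : x \is a Num.int -> y \is a Num.int ->
  x * y = 1 -> y * y = 1.
Proof.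
move=> xi yi xy.
have x0 : x != 0 by apply: contra_eq_neq xy => ->; rewrite mul0r eq_sym oner_eq0.
have y0 : y != 0 by apply: contra_eq_neq xy => ->; rewrite mulr0 eq_sym oner_eq0.
have x1 := norm_intr_ge1 xi x0; have y1 := norm_intr_ge1 yi y0.
have n1 : `|x| * `|y| = 1 by rewrite -normrM xy normr1.
have ny : `|y| = 1 by apply/eqP; rewrite eq_le y1 andbT; nra.
by rewrite -expr2 -real_normK ?num_real // ny expr1n.
Qed.

Lemma sum_option (T : finType) (F : option T -> rat) :
  \sum_x F x = F None + \sum_t F (Some t).
Proof.
rewrite (bigD1 None) //=; congr (_ + _).
rewrite (reindex_omap Some id) /=; last by case.
by apply: eq_bigl => t; rewrite eqxx.
Qed.

(** [tau] is the square of the determinant of an integral incidence matrix. The fundamental cuts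
    provide an integral left inverse, so that determinant is 1 or -1. *)
Lemma tau_tree (E V : finType) (p q : E -> V) r :
  conn p q -> #|V| = #|E|.+1 -> tau p q r = 1.
Proof.
move=> cn cV.
pose B u (x : option E) : rat :=
  if x is Some e then (if u == r then 0 else edelta p q e u) else (u == r)%:R.
pose cut e := xchoose (tree_cut cn cV e).
pose y e u : rat := (u \in cut e)%:R - (r \in cut e)%:R.
pose C (x : option E) u : rat := if x is Some e then y e u else (u == r)%:R.
(* The additional column [None], reserved for the root, makes the incidence matrix square; [h]
   indexes its columns by vertices. *)
have [g gK Kg] : bijective (fun a : V => enum_val (cast_ord
    (etrans cV (esym (card_option E))) (enum_rank a)) : option E).
  apply: inj_card_bij; last by rewrite card_option cV.
  by move=> a b /enum_val_inj/cast_ord_inj/enum_rank_inj.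
set h := (fun a => _) in gK Kg.
pose B' u v := B u (h v); pose C' v u := C (h v) u.
have sumr_unit (F : V -> rat) v : \sum_u (v == u)%:R * F u = F v.
  rewrite (bigD1 v) //= eqxx mul1r big1 ?addr0 // => w.
  by rewrite eq_sym => /negPf->; rewrite mul0r.
have tauE : tau p q r = fdet B' * fdet B'.
  rewrite -[X in _ * X]fdet_tr -fdet_mul.
  have TE u w : \sum_v B' u v * B' w v =
      (u == r)%:R * (w == r)%:R + \sum_e B u (Some e) * B w (Some e).
    rewrite -[RHS](sum_option (fun x => B u x * B w x)).
    by rewrite [RHS](reindex h) //=; exists g => x _; [exact: gK|exact: Kg].
  apply: (@fdet_unitcol _ _ _ r) => [w|w|u w wr].
  - by rewrite /setrow eqxx.
  - rewrite TE eqxx mul1r big1 ?addr0 ?[r == w]eq_sym // => e _.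
    by rewrite /B eqxx mul0r.
  rewrite TE (negPf wr) mulr0 add0r /setrow; case: (eqVneq u r) => [->|ur].
    rewrite /unitrow eq_sym (negPf wr) big1 // => e _.
    by rewrite /B eqxx mul0r.
  by apply: eq_bigr => e _; rewrite /B (negPf ur) (negPf wr).
have CB : fdet C' * fdet B' = 1.
  rewrite -fdet_mul -[RHS](fdet1 V); apply: eq_fdet => v w.
  rewrite -(inj_eq (can_inj gK)) /B' /C'; move: (h v) (h w) => [e|] [e'|] /=.
  - have cutE x : (p x \in cut e)%:R - (q x \in cut e)%:R = (e == x)%:R :> rat.
      have /and3P[pe qe /forallP ce] := xchooseP (tree_cut cn cV e).
      have [<-|ex] := eqVneq e x; first by rewrite pe (negPf qe) subr0.
      by have /implyP/(_ _)/eqP-> := ce x; rewrite ?subrr // eq_sym.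
    transitivity (\sum_u (y e u * edelta p q e' u)).
      apply: eq_bigr => u _; case: eqP => // ->.
      by rewrite /y subrr !mul0r.
    under eq_bigr do rewrite /edelta mulrBr ![y e _ * _]mulrC.
    rewrite sumrB !sumr_unit /y opprB addrA subrK cutE.
    by congr (_%:R); apply/eqP/eqP => [->|[->]].
  - under eq_bigr do rewrite mulrC eq_sym.
    by rewrite sumr_unit /y subrr.
  - rewrite big1 // => u _; case: eqP; rewrite ?mulr0 ?mul0r //.
  - under eq_bigr => u _ do rewrite [u == r]eq_sym.
    by rewrite sumr_unit !eqxx.
rewrite tauE; apply: (int_unit_sqr _ _ CB); apply: fdet_int => u w.
- rewrite /C'; case: (h u) => [e|] /=; last exact: rpred_nat.
  by apply: rpredB; exact: rpred_nat.
- rewrite /B'; case: (h w) => [e|] /=; last exact: rpred_nat.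
  case: ifP => _; first exact: rpred0.
  by apply: rpredB; exact: rpred_nat.
Qed.

(** * Bipartite graphs *)

Section Bipartite.
Variable n : nat.
Variables (I J : finType).
Implicit Types (s : {ffun 'I_n -> I * J}) (e : 'I_n) (x : 'I_n * bool).

(* Dually to the boundary components of the ribbon graphs, [s] is a bipartite
   graph: the edge [e] joins the black vertex [(s e).1] to the white vertex
   [(s e).2].  An arc [(e, true)] goes from black to white, [(e, false)] back. *)
Definition bend s e : I + J := inl (s e).1.
Definition wend s e : I + J := inr (s e).2.
Definition bdeg s (i : I) : nat := #|[set e | (s e).1 == i]%SET|.
Definition wdeg s (j : J) : nat := #|[set e | (s e).2 == j]%SET|.

Definition arc_src s x : I + J := if x.2 then bend s x.1 else wend s x.1.
Definition arc_tgt s x : I + J := if x.2 then wend s x.1 else bend s x.1.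

(** The choice of the root is immaterial by [tau_root]; the default 0 concerns only a graph without
    vertices. *)
Definition btau s : rat :=
  if [pick r : I + J] is Some r then tau (bend s) (wend s) r else 0.

Lemma btauE s r : btau s = tau (bend s) (wend s) r.
Proof.
rewrite /btau; case: pickP => [r' _|/(_ r)//]; exact: tau_root.
Qed.

Definition cfact s : nat :=
  ((\prod_i (bdeg s i).-1`!) * \prod_j (wdeg s j).-1`!)%N.

Definition full_support s : bool :=
  [forall i, 0 < bdeg s i]%N && [forall j, 0 < wdeg s j]%N.

Definition nb_tours s : nat :=
  #|[set rho : {perm 'I_n * bool} | transitive_perm rho &
      [forall x, arc_src s (rho x) == arc_tgt s x]]%SET|.

Lemma bend_wend s e : bend s e != wend s e. Proof. by []. Qed.

Lemma sum_arcs (F : 'I_n * bool -> rat) : \sum_x F x = \sum_e (F (e, true) + F (e, false)).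
Proof.
transitivity (\sum_e \sum_(b : bool) F (e, b)).
  by rewrite pair_bigA; apply: eq_bigr => -[].
by apply: eq_bigr => e _; rewrite big_bool.
Qed.

Lemma outdeg_inl s i : outdeg (arc_src s) [set: _]%SET (inl i) = bdeg s i.
Proof.
rewrite /outdeg /bdeg -[RHS](card_imset _ (f := fun e => (e, true))); last by move=> e e' [].
apply: eq_card => -[e b]; rewrite !inE /=; apply/idP/imsetP.
  by rewrite /arc_src /bend /wend; case: b => //= /eqP[<-]; exists e; rewrite ?inE.
by case=> e'; rewrite inE => /eqP <- [-> ->].
Qed.

Lemma outdeg_inr s j : outdeg (arc_src s) [set: _]%SET (inr j) = wdeg s j.
Proof.
rewrite /outdeg /wdeg -[RHS](card_imset _ (f := fun e => (e, false))); last by move=> e e' [].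
apply: eq_card => -[e b]; rewrite !inE /=; apply/idP/imsetP.
  by rewrite /arc_src /bend /wend; case: b => //= /eqP[<-]; exists e; rewrite ?inE.
by case=> e'; rewrite inE => /eqP <- [-> ->].
Qed.

Lemma indeg_outdeg s v :
  indeg (arc_tgt s) [set: _]%SET v = outdeg (arc_src s) [set: _]%SET v.
Proof.
rewrite /indeg /outdeg -[RHS](card_imset _ (f := fun x => (x.1, ~~ x.2))); last first.
  by move=> [e b] [e' b'] [-> /negb_inj->].
apply: eq_card => -[e b]; rewrite !inE /=; apply/idP/imsetP.
  by move=> H; exists (e, ~~ b); rewrite ?negbK // !inE; move: H; case: b.
by case=> -[e' b']; rewrite !inE => H [-> ->]; move: H; case: b'.
Qed.

Lemma qlap_arcs s u w :
  qlap (bend s) (wend s) u w =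
  \sum_(x | arc_src s x == u) ((u == w)%:R - (arc_tgt s x == w)%:R).
Proof.
rewrite big_mkcond sum_arcs; apply: eq_bigr => e _.
rewrite /edelta /arc_src /arc_tgt /=.
case: (eqVneq (bend s e) u) => [<-|bu].
  rewrite [wend s e == bend s e]eq_sym (negPf (bend_wend s e)) subr0 mul1r.
  by rewrite addr0.
case: (eqVneq (wend s e) u) => [<-|wu]; first by rewrite sub0r mulN1r opprB add0r.
by rewrite subrr mul0r.
Qed.

Theorem nb_tours_best s : (0 < n)%N -> full_support s ->
  (nb_tours s)%:R = btau s * (cfact s)%:R.
Proof.
move=> n0 /andP[/forallP b0 /forallP w0].
pose a : 'I_n * bool := (Ordinal n0, true); pose r := arc_src s a.
have aT : a \in [set: 'I_n * bool]%SET by rewrite inE.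
have o0 v : (0 < outdeg (arc_src s) [set: _]%SET v)%N.
  by case: v => [i|j]; rewrite ?outdeg_inl ?outdeg_inr.
(* The tour starts with the arc [a], whose removal lowers the out-degree of the root by one. The
   factorial at the root thus becomes [(deg - 1)!], as at all other vertices. *)
have oD v : outdeg (arc_src s) ([set: _] :\ a)%SET v =
    (outdeg (arc_src s) [set: _]%SET v - (v == r))%N.
  by rewrite [in RHS](outdegD1 _ v aT) eq_sym addKn.
rewrite /nb_tours (card_transitive_perm _ _ a) best_trails; last 2 first.
- by have := cardsD1 a [set: 'I_n * bool]%SET; rewrite aT cardsT => ->.
- by apply: balancedD1 aT erefl _ => v; rewrite indeg_outdeg.
congr (_ * _).
  rewrite (btauE s r) /tau; apply: eq_fdet => u w; rewrite /setrow.
  case: (eqVneq u r) => [->|ur]; first by rewrite /lap eqxx.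
  rewrite /lap oD (negPf ur) subn0 eqn0Ngt o0 qlap_arcs /=.
  apply: eq_bigl => b; rewrite !inE andbT.
  by case: (eqVneq b a) => //= ->; rewrite eq_sym (negPf ur).
congr (_%:R); rewrite /degfact.
transitivity (\prod_v (outdeg (arc_src s) [set: _]%SET v).-1`!)%N.
  apply: eq_bigr => v _; rewrite oD; congr (_`!).
  by case: (v == r); rewrite /= ?subn0 ?subn1.
rewrite big_sumType; congr (_ * _)%N; apply: eq_bigr => v _.
  by rewrite outdeg_inl.
by rewrite outdeg_inr.
Qed.

End Bipartite.

(** * Weights generated by trees *)

Lemma tau_bij (E V W : finType) (p q : E -> V) (g : V -> W) r : bijective g ->
  tau (g \o p) (g \o q) (g r) = tau p q r.
Proof.
move=> gb; rewrite /tau -(fdet_reindex _ gb); apply: eq_fdet => u w.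
have gI := bij_inj gb.
rewrite /setrow /unitrow !(inj_eq gI); case: ifP => // _.
by apply: eq_bigr => e _; rewrite /edelta /= !(inj_eq gI).
Qed.

Section Push.
Variable n : nat.

Definition relabel (I J I' J' : finType) (phi : I -> I') (psi : J -> J')
    (s : {ffun 'I_n -> I * J}) : {ffun 'I_n -> I' * J'} :=
  [ffun e => (phi (s e).1, psi (s e).2)].

Definition push (I J I' J' : finType) (phi : I -> I') (psi : J -> J')
    (kappa : {ffun 'I_n -> I * J} -> rat) (s : {ffun 'I_n -> I' * J'}) : rat :=
  \sum_(t | relabel phi psi t == s) kappa t.

Definition onto (A B : finType) (f : A -> B) : bool := [forall b, exists a, f a == b].

Lemma ontoP (A B : finType) (f : A -> B) : reflect (forall b, exists a, f a = b) (onto f).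
Proof.
apply: (iffP forallP) => H b; first by have /existsP[a /eqP] := H b; exists a.
by have [a <-] := H b; apply/existsP; exists a.
Qed.

Definition tree_weight (I J : finType) (s : {ffun 'I_n -> I * J}) : rat :=
  btau s * (cfact s)%:R.

(* The weights generated by the weights of the trees with [n] edges. *)
Inductive treelike : forall I J : finType, ({ffun 'I_n -> I * J} -> rat) -> Prop :=
| treelike_tree (I J : finType) : (0 < #|I|)%N -> (0 < #|J|)%N -> (#|I| + #|J|)%N = n.+1 ->
    treelike (@tree_weight I J)
| treelike_push (I J I' J' : finType) (phi : I -> I') (psi : J -> J') kappa :
    onto phi -> onto psi -> treelike kappa -> treelike (push phi psi kappa)
| treelike_zero (I J : finType) : @treelike I J (fun=> 0)
| treelike_lin (I J : finType) (a : rat) (k1 k2 : {ffun 'I_n -> I * J} -> rat) :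
    treelike k1 -> treelike k2 -> treelike (fun s => k1 s + a * k2 s)
| treelike_ext (I J : finType) (k1 k2 : {ffun 'I_n -> I * J} -> rat) :
    treelike k1 -> k1 =1 k2 -> treelike k2.

Lemma treelike_sum (I J : finType) (T : Type) (r : seq T) (P : pred T)
    (k : T -> {ffun 'I_n -> I * J} -> rat) :
  (forall t, P t -> treelike (k t)) -> treelike (fun s => \sum_(t <- r | P t) k t s).
Proof.
move=> kP; elim: r => [|t r IH].
  by apply: treelike_ext (treelike_zero _ _) _ => s; rewrite big_nil.
have [Pt|Pt] := boolP (P t); last first.
  by apply: treelike_ext IH _ => s; rewrite big_cons (negPf Pt).
apply: treelike_ext (treelike_lin 1 (kP _ Pt) IH) _ => s.
by rewrite big_cons Pt mul1r.
Qed.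

Lemma treelike_scale (I J : finType) a (k : {ffun 'I_n -> I * J} -> rat) :
  treelike k -> treelike (fun s => a * k s).
Proof.
move=> kt; apply: treelike_ext (treelike_lin a (treelike_zero _ _) kt) _ => s.
by rewrite add0r.
Qed.

Section Split.
Variables (I J : finType).
Hypotheses (I0 : (0 < #|I|)%N) (J0 : (0 < #|J|)%N).
Implicit Types (s : {ffun 'I_n -> I * J}) (S : {set 'I_n}).

Lemma btau_full s : ~~ full_support s -> btau s = 0.
Proof.
have [i0 _] := card_gt0P I0; have [j0 _] := card_gt0P J0.
rewrite negb_and !negb_forall => /orP[]/existsP[v]; rewrite -eqn0Ngt cards_eq0 => /eqP sv.
  rewrite (btauE s (inl i0)); apply: (@tau_isolated _ _ _ _ _ (inl v) (inr j0)) => // e.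
  apply/eqP => -[ev]; have := finset.in_set0 e; rewrite -sv inE ev eqxx //.
rewrite (btauE s (inl i0)); apply: (@tau_isolated _ _ _ _ _ (inr v) (inl i0)) => // e.
apply/eqP => -[ev]; have := finset.in_set0 e; rewrite -sv inE ev eqxx //.
Qed.

Definition splitf s S : {ffun 'I_n -> option I * J} :=
  [ffun e => (if e \in S then None else Some (s e).1, (s e).2)].

Lemma btau_splitf s S :
  btau (splitf s S) = tau (split_end (bend s) S) (Some \o wend s) None.
Proof.
pose g (v : option (I + J)) : option I + J :=
  match v with None => inl None | Some (inl i) => inl (Some i) | Some (inr j) => inr j end.
have gb : bijective g.
  exists (fun w => match w with inl None => None | inl (Some i) => Some (inl i)
     | inr j => Some (inr j) end).
  - by move=> [[i|j]|].
  - by move=> [[i|]|j].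
rewrite (btauE _ (g None)) -(tau_bij _ _ _ gb).
rewrite /tau; apply: eq_fdet => u w; rewrite /setrow; case: ifP => // _.
apply: eq_bigr => e _; rewrite /edelta /bend /wend /= ffunE /split_end /=.
by case: (e \in S).
Qed.

Lemma cfact_splitf s S i (A := [set e | (s e).1 == i]%SET) : S \subset A ->
  cfact (splitf s S) = ((#|S|.-1)`! * (#|A| - #|S|).-1`! *
   ((\prod_(k | k != i) (bdeg s k).-1`!) * \prod_j (wdeg s j).-1`!))%N.
Proof.
move=> SA; rewrite /cfact mulnA; congr (_ * _)%N; last first.
  apply: eq_bigr => j _; congr (_.-1`!).
  by apply: eq_card => e; rewrite !inE ffunE.
rewrite (bigD1 None) //= -mulnA; congr (_ * _)%N.
  by congr (_.-1`!); apply: eq_card => e; rewrite !inE ffunE /=; case: (e \in S).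
rewrite (reindex_omap Some id) /=; last by case.
rewrite (eq_bigl xpredT); last by move=> k; rewrite eqxx.
rewrite (bigD1 i) //=; congr (_ * _)%N.
  congr (_.-1`!); rewrite -(cardsDS SA); apply: eq_card => e.
  by rewrite !inE ffunE /=; case: (e \in S).
apply: eq_bigr => k ki; congr (_.-1`!); apply: eq_card => e; rewrite !inE ffunE /=.
case eS: (e \in S) => //=; move/fintype.subsetP: SA => /(_ _ eS); rewrite inE => /eqP->.
by rewrite [i == k]eq_sym (negPf ki).
Qed.

(** A graph that becomes [s] when [None] is merged into [i] is given by the set of edges at [i] that
    were attached to [None]. *)
Lemma sum_splitf s i (F : {ffun 'I_n -> option I * J} -> rat) :
  push (oapp id i) id F s = \sum_(S : {set _} | S \subset [set e | (s e).1 == i]%SET) F (splitf s S).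
Proof.
rewrite /push (reindex_onto (splitf s) (fun t => [set e | (t e).1 == None]%SET)) /=.
  apply: eq_bigl => S; apply/idP/idP => [/andP[/eqP/ffunP E _]|SA].
    apply/fintype.subsetP => e eS; rewrite inE.
    by have := E e; rewrite !ffunE /= eS => <-.
  apply/andP; split.
    apply/eqP/ffunP => e; rewrite !ffunE /=; case eS: (e \in S) => /=; last by case: (s e).
    by move/fintype.subsetP: SA => /(_ _ eS); rewrite inE => /eqP<-; case: (s e).
  by apply/eqP/setP => e; rewrite !inE ffunE /=; case: (e \in S).
move=> t /eqP <-; apply/ffunP => e; rewrite !ffunE /= inE.
by case: (t e) => -[k|] j.
Qed.

(** In the sum of [split_sum] over the black vertices, the degrees add up to [n] and the minors to
    [(#|V| - 1) * tau] by Euler's relation. The coefficient on the left is the number of independent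
    cycles of a connected [s]. *)
Theorem tree_weight_split s :
  (n%:R - (#|I| + #|J|).-1%:R) * tree_weight s =
  \sum_i push (oapp id i) id (@tree_weight (option I) J) s.
Proof.
have [i0 _] := card_gt0P I0; have [j0 _] := card_gt0P J0.
have [fs|nfs] := boolP (full_support s); last first.
  rewrite /tree_weight btau_full // mul0r mulr0 big1 // => i _.
  rewrite /push big1 // => t /eqP tE.
  rewrite (btauE _ (inl None)).
  move: nfs; rewrite negb_and !negb_forall => /orP[]/existsP[v]; rewrite -eqn0Ngt cards_eq0 => /eqP sv.
    rewrite (@tau_isolated _ _ _ _ _ (inl (Some v)) (inr j0)) ?mul0r // => e.
    apply/eqP => -[ev]; have := finset.in_set0 e; rewrite -sv inE -tE ffunE /= ev /= eqxx //.
  rewrite (@tau_isolated _ _ _ _ _ (inr v) (inl None)) ?mul0r // => e.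
  apply/eqP => -[ev]; have := finset.in_set0 e; rewrite -sv inE -tE ffunE /= ev /= eqxx //.
have /andP[/forallP b0 _] := fs.
pose p := bend s; pose q := wend s.
have AE i : [set e | p e == inl i]%SET = [set e | (s e).1 == i]%SET.
  by apply/setP => e; rewrite !inE /p /bend.
have step i : push (oapp id i) id (@tree_weight (option I) J) s =
    (cfact s)%:R * ((bdeg s i)%:R * btau s - \sum_(e | p e == inl i) minor2 p q (p e) (q e)).
  rewrite sum_splitf.
  set R := ((\prod_(k | k != i) (bdeg s k).-1`!) * \prod_j (wdeg s j).-1`!)%N.
  have E S : S \subset [set e | (s e).1 == i]%SET -> tree_weight (splitf s S) =
      R%:R * (((#|S|.-1)`! * (bdeg s i - #|S|).-1`!)%:R *
              tau (split_end p S) (Some \o q) None).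
    by move=> SA; rewrite /tree_weight btau_splitf (cfact_splitf SA) natrM mulrC [_ * R%:R]mulrC mulrA.
  rewrite (eq_bigr _ E) -mulr_sumr.
  have := @split_sum _ _ p q (inl i); rewrite AE => /(_ _ (b0 i)) -> //.
  rewrite (btauE s (inl i)) -/(bdeg s i) -/p -/q.
  have -> : \sum_(e in [set e | (s e).1 == i]%SET) minor2 p q (inl i) (q e) =
     \sum_(e | p e == inl i) minor2 p q (p e) (q e).
    by apply: eq_big => [e|e]; rewrite inE // => /eqP {1}<-.
  rewrite mulrA; congr (_ * _); rewrite -natrM; congr (_%:R).
  by rewrite /cfact (bigD1 i) //= -mulnA [RHS]mulnC.
under eq_bigr => i _ do rewrite step.
rewrite -mulr_sumr sumrB -mulr_suml /tree_weight mulrA [RHS]mulrC; congr (_ * _).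
have -> : \sum_i (bdeg s i)%:R = n%:R :> rat.
  rewrite -natr_sum; congr (_%:R); rewrite -[RHS]card_ord -sum1_card.
  rewrite (partition_big (fun e => (s e).1) xpredT) //=.
  by apply: eq_bigr => i _; rewrite sum1dep_card.
have -> : \sum_i \sum_(e | p e == inl i) minor2 p q (p e) (q e) =
    \sum_e minor2 p q (p e) (q e).
  by rewrite (partition_big (fun e => (s e).1) xpredT) //=.
rewrite (sum_minor2 (inl i0)); last by move=> e; exact: bend_wend.
by rewrite card_sum (btauE s (inl i0)) -mulrBl.
Qed.

End Split.

(** Descending induction on the number of vertices: below [n + 1] vertices the coefficient in
    [tree_weight_split] can be inverted, and beyond [n + 1] no graph with [n] edges is connected. *)
Theorem treelike_tree_weight (I J : finType) : (0 < #|I|)%N -> (0 < #|J|)%N ->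
  treelike (@tree_weight I J).
Proof.
have [m] := ubnP (n.+1 - (#|I| + #|J|))%N.
elim: m => // m IH in I J *; move=> Im I0 J0.
have [lt|gt|eq] := ltngtP (#|I| + #|J|)%N n.+1; last exact: treelike_tree.
- have T : treelike (@tree_weight (option I) J).
    by apply: IH; rewrite ?card_option //; lia.
  apply: treelike_ext (treelike_scale ((n%:R - (#|I| + #|J|).-1%:R)^-1)
     (@treelike_sum I J I (index_enum I) xpredT (fun i => push (oapp id i) id (@tree_weight (option I) J)) _)) _.
    move=> i _; apply: treelike_push T; apply/ontoP => k; last by exists k.
    by exists (Some k).
  move=> s /=; rewrite -tree_weight_split // mulrA mulVf ?mul1r //.
  have h : ((#|I| + #|J|).-1 < n)%N by rewrite -ltnS prednK // addn_gt0 I0.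
  by rewrite -natrB ?(ltnW h) // pnatr_eq0 subn_eq0 -ltnNge.
- apply: treelike_ext (treelike_zero I J) _ => s.
  have [i0 _] := card_gt0P I0.
  rewrite /tree_weight (btauE s (inl i0)) tau_conn ?mul0r //.
  by apply/negP => /conn_card; rewrite card_sum card_ord; lia.
Qed.

End Push.

(** * One-vertex ribbon graphs as cyclic permutations of arcs *)

Lemma surj_leq (A B : finType) (f : A -> B) : onto f -> (#|B| <= #|A|)%N.
Proof.
move=> /ontoP fs; rewrite -[X in (X <= _)%N]cardsT -[X in (_ <= X)%N]cardsT.
apply: leq_trans (leq_imset_card f _); apply: subset_leq_card.
by apply/fintype.subsetP => b _; have [a <-] := fs b; apply: imset_f.
Qed.

Lemma surj_bij (A B : finType) (f : A -> B) : onto f -> (#|A| <= #|B|)%N -> injective f.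
Proof.
move=> /ontoP fs AB; suff /image_injP H : #|[seq f x | x in A]| == #|A|.
  by move=> x y; exact: H.
rewrite eqn_leq leq_image_card /=; apply: leq_trans AB _.
apply: subset_leq_card; apply/fintype.subsetP => b _.
by have [a <-] := fs b; apply: fintype.image_f.
Qed.

Section Gluings.
Variable n : nat.
Implicit Types (rho : {perm 'I_n * bool}) (x y : 'I_n * bool) (e : 'I_n).

Definition rev_arc x : 'I_n * bool := (x.1, ~~ x.2).

Lemma rev_arcK : involutive rev_arc.
Proof. by case=> e b; rewrite /rev_arc negbK. Qed.

Definition revp : {perm 'I_n * bool} := perm (inv_inj rev_arcK).

Definition facep rho : {perm 'I_n * bool} := (revp * rho^-1)%g.

Definition composable (I J : finType) (s : {ffun 'I_n -> I * J}) rho : bool :=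
  [forall x, arc_src s (rho x) == arc_tgt s x].

Definition labels_faces (I J : finType) (s : {ffun 'I_n -> I * J}) rho : bool :=
  [forall x, forall y, (arc_tgt s x == arc_tgt s y) ==
                       (porbit (facep rho) x == porbit (facep rho) y)].

Definition gluing (I J : finType) (s : {ffun 'I_n -> I * J}) rho : bool :=
  [&& composable s rho, labels_faces s rho & full_support s].

(* [rho] is the rotation at the unique vertex of a ribbon graph whose half-edges
   are the arcs; the face to the left of the arc [x] carries the label
   [arc_tgt s x]. *)
Definition nb_gluings (I J : finType) (s : {ffun 'I_n -> I * J}) : nat :=
  #|[set rho | transitive_perm rho && gluing s rho]%SET|.

Lemma arc_tgt_rev (I J : finType) (s : {ffun 'I_n -> I * J}) x :
  arc_src s (rev_arc x) = arc_tgt s x.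
Proof. by case: x => e []. Qed.

Lemma arc_tgt_face (I J : finType) (s : {ffun 'I_n -> I * J}) rho x :
  composable s rho -> arc_tgt s (facep rho x) = arc_tgt s x.
Proof.
move=> /forallP/(_ (facep rho x))/eqP <-.
by rewrite /facep permM permKV permE arc_tgt_rev.
Qed.

Lemma arc_tgt_porbit (I J : finType) (s : {ffun 'I_n -> I * J}) rho x y :
  composable s rho -> porbit (facep rho) x = porbit (facep rho) y ->
  arc_tgt s x = arc_tgt s y.
Proof.
move=> cs E; have : y \in porbit (facep rho) x by rewrite E porbit_id.
case/porbitP => i ->; elim: i => [|i IH]; first by rewrite expg0 perm1.
by rewrite expgSr permM arc_tgt_face.
Qed.

Lemma full_support1 (I J : finType) (s : {ffun 'I_n -> I * J}) i :
  full_support s -> exists e, (s e).1 == i.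
Proof.
move=> /andP[/forallP/(_ i) + _]; rewrite card_gt0 => /set0Pn[e].
by rewrite inE => ei; exists e.
Qed.

Lemma full_support2 (I J : finType) (s : {ffun 'I_n -> I * J}) j :
  full_support s -> exists e, (s e).2 == j.
Proof.
move=> /andP[_ /forallP/(_ j)]; rewrite card_gt0 => /set0Pn[e].
by rewrite inE => ej; exists e.
Qed.

Lemma relabel_full (I J I' J' : finType) (phi : I -> I') (psi : J -> J')
    (s : {ffun 'I_n -> I * J}) :
  full_support s -> full_support (relabel phi psi s) = onto phi && onto psi.
Proof.
move=> fs; apply/idP/andP.
  move=> fr; split; apply/ontoP => v.
    by have [e] := full_support1 v fr; rewrite ffunE => /eqP <-; exists (s e).1.
  by have [e] := full_support2 v fr; rewrite ffunE => /eqP <-; exists (s e).2.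
case=> /ontoP p1 /ontoP p2; apply/andP; split; apply/forallP => v; rewrite card_gt0; apply/set0Pn.
  have [i <-] := p1 v; have [e /eqP ei] := full_support1 i fs.
  by exists e; rewrite inE ffunE ei.
have [j <-] := p2 v; have [e /eqP ej] := full_support2 j fs.
by exists e; rewrite inE ffunE ej.
Qed.

Lemma relabel_eq (I J I' J' : finType) (phi phi' : I -> I') (psi psi' : J -> J')
    (s : {ffun 'I_n -> I * J}) : full_support s ->
  relabel phi psi s = relabel phi' psi' s -> phi =1 phi' /\ psi =1 psi'.
Proof.
move=> fs /ffunP E; split=> v.
  by have [e /eqP <-] := full_support1 v fs; have := E e; rewrite !ffunE => -[].
by have [e /eqP <-] := full_support2 v fs; have := E e; rewrite !ffunE => -[].
Qed.

Definition sum_map (I J I' J' : finType) (phi : I -> I') (psi : J -> J') (v : I + J) : I' + J' :=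
  match v with inl i => inl (phi i) | inr j => inr (psi j) end.

Lemma arc_src_relabel (I J I' J' : finType) (phi : I -> I') (psi : J -> J')
    (s : {ffun 'I_n -> I * J}) x :
  arc_src (relabel phi psi s) x = sum_map phi psi (arc_src s x).
Proof. by rewrite /arc_src /bend /wend ffunE; case: x.2. Qed.

Lemma arc_tgt_relabel (I J I' J' : finType) (phi : I -> I') (psi : J -> J')
    (s : {ffun 'I_n -> I * J}) x :
  arc_tgt (relabel phi psi s) x = sum_map phi psi (arc_tgt s x).
Proof. by rewrite /arc_tgt /bend /wend ffunE; case: x.2. Qed.

Lemma relabel_composable (I J I' J' : finType) (phi : I -> I') (psi : J -> J')
    (s : {ffun 'I_n -> I * J}) rho :
  composable s rho -> composable (relabel phi psi s) rho.
Proof.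
move=> /forallP cs; apply/forallP => x.
by rewrite arc_src_relabel arc_tgt_relabel (eqP (cs x)).
Qed.

Lemma relabel_gluing (I J I' J' : finType) (phi : I -> I') (psi : J -> J')
    (s : {ffun 'I_n -> I * J}) rho :
  injective phi -> injective psi -> onto phi -> onto psi ->
  gluing s rho -> gluing (relabel phi psi s) rho.
Proof.
move=> pI qI ps qs /and3P[cs /forallP ls fs]; apply/and3P; split.
- exact: relabel_composable.
- apply/forallP => x; apply/forallP => y; have /forallP/(_ y)/eqP <- := ls x.
  rewrite !arc_tgt_relabel; apply/eqP; apply/eqP/eqP => [|->//].
  by case: (arc_tgt s x) (arc_tgt s y) => [i|j] [i'|j'] //= [] => [/pI|/qI] ->.
- by rewrite relabel_full // ps qs.
Qed.

(** Labels composable along [rho] are constant on its faces, and the labels of [s] separate the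
    faces exactly, so those of [t] are functions of them. *)
Lemma gluing_factor (I J I' J' : finType) (s : {ffun 'I_n -> I * J})
    (t : {ffun 'I_n -> I' * J'}) rho : gluing s rho -> composable t rho ->
  exists (phi : {ffun I -> I'}) (psi : {ffun J -> J'}), relabel phi psi s = t.
Proof.
case/and3P => cs /forallP ls fs ct.
have F1 i := full_support1 i fs; have F2 j := full_support2 j fs.
exists [ffun i => (t (xchoose (F1 i))).1], [ffun j => (t (xchoose (F2 j))).2].
apply/ffunP => e; rewrite !ffunE [RHS]surjective_pairing; congr pair.
  have /eqP E := xchooseP (F1 (s e).1); move: (xchoose _) E => e' E.
  have : arc_tgt t (e', false) = arc_tgt t (e, false).
    apply: arc_tgt_porbit ct _; apply/eqP.
    by have /forallP/(_ (e, false))/eqP <- := ls (e', false); rewrite /arc_tgt /bend /= E.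
  by case.
have /eqP E := xchooseP (F2 (s e).2); move: (xchoose _) E => e' E.
have : arc_tgt t (e', true) = arc_tgt t (e, true).
  apply: arc_tgt_porbit ct _; apply/eqP.
  by have /forallP/(_ (e, true))/eqP <- := ls (e', true); rewrite /arc_tgt /wend /= E.
by case.
Qed.

(** Each face is its own label, the faces of the two colours being numbered separately. The
    labelling [s] is needed to know that no face has both colours. *)
Lemma gluing_exists (I J : finType) (s : {ffun 'I_n -> I * J}) rho : composable s rho ->
  exists K K', exists t : {ffun 'I_n -> 'I_K * 'I_K'}, gluing t rho.
Proof.
move=> cs.
pose B := [set porbit (facep rho) (e, false) | e : 'I_n]%SET.
pose W := [set porbit (facep rho) (e, true) | e : 'I_n]%SET.
have inB e : porbit (facep rho) (e, false) \in B by apply: imset_f.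
have inW e : porbit (facep rho) (e, true) \in W by apply: imset_f.
pose t : {ffun 'I_n -> 'I_#|B| * 'I_#|W|} :=
  [ffun e => (enum_rank_in (inB e) (porbit (facep rho) (e, false)),
              enum_rank_in (inW e) (porbit (facep rho) (e, true)))].
have vB e : enum_val (t e).1 = porbit (facep rho) (e, false) by rewrite ffunE enum_rankK_in.
have vW e : enum_val (t e).2 = porbit (facep rho) (e, true) by rewrite ffunE enum_rankK_in.
have face2 x y : porbit (facep rho) x = porbit (facep rho) y -> x.2 = y.2.
  move=> E; have := arc_tgt_porbit cs E; rewrite /arc_tgt.
  by case: x.2; case: y.2.
have tE x y : (arc_tgt t x == arc_tgt t y) = (porbit (facep rho) x == porbit (facep rho) y).
  have EB a b : (porbit (facep rho) (a, false) == porbit (facep rho) (b, false)) = ((t a).1 == (t b).1).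
    by rewrite -!vB (inj_eq enum_val_inj).
  have EW a b : (porbit (facep rho) (a, true) == porbit (facep rho) (b, true)) = ((t a).2 == (t b).2).
    by rewrite -!vW (inj_eq enum_val_inj).
  case: x y => [e []] [e' []]; rewrite /arc_tgt /bend /wend /=.
  - by rewrite EW.
  - by apply/esym/negbTE/eqP => /face2.
  - by apply/esym/negbTE/eqP => /face2.
  - by rewrite EB.
exists #|B|, #|W|, t; apply/and3P; split.
- apply/forallP => x.
  rewrite -[rho x]rev_arcK arc_tgt_rev tE -[X in _ == porbit _ X](_ : facep rho (rev_arc (rho x)) = x).
    by rewrite eq_sym eq_porbit_mem; have := mem_porbit (facep rho) 1 (rev_arc (rho x)); rewrite expg1.
  by rewrite /facep permM [revp _]permE rev_arcK permK.
- by apply/forallP => x; apply/forallP => y; rewrite tE.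
apply/andP; split; apply/forallP => v; rewrite card_gt0; apply/set0Pn.
  have /imsetP[e _ ve] := enum_valP v.
  by exists e; rewrite inE -(inj_eq enum_val_inj) vB ve.
have /imsetP[e _ ve] := enum_valP v.
by exists e; rewrite inE -(inj_eq enum_val_inj) vW ve.
Qed.

Lemma gluing_onto (I J I' J' : finType) (s : {ffun 'I_n -> I * J})
    (t : {ffun 'I_n -> I' * J'}) rho : gluing s rho -> composable t rho -> full_support t ->
  exists (phi : {ffun I -> I'}) (psi : {ffun J -> J'}),
    [/\ onto phi, onto psi & relabel phi psi s = t].
Proof.
move=> gs ct ft; have [phi [psi E]] := gluing_factor gs ct.
have /and3P[_ _ fs] := gs.
by exists phi, psi; move: ft; rewrite -E relabel_full // => /andP[].
Qed.

Lemma gluing_card (I J I' J' : finType) (s : {ffun 'I_n -> I * J})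
    (t : {ffun 'I_n -> I' * J'}) rho : gluing s rho -> gluing t rho ->
  #|I| = #|I'| /\ #|J| = #|J'|.
Proof.
move=> gs gt; have /and3P[cs _ fs] := gs; have /and3P[ct _ ft] := gt.
have [p [q [po qo _]]] := gluing_onto gs ct ft.
have [p' [q' [po' qo' _]]] := gluing_onto gt cs fs.
by split; apply/eqP; rewrite eqn_leq; apply/andP; split; apply: surj_leq; eassumption.
Qed.

(** By [gluing_onto] two gluings of [rho] with these label sets differ by surjections, hence by
    permutations, and full support makes the permutations unique. *)
Lemma card_gluing (K K' : nat) (t : {ffun 'I_n -> 'I_K * 'I_K'}) rho : gluing t rho ->
  #|[set u : {ffun 'I_n -> 'I_K * 'I_K'} | gluing u rho]%SET| = (K`! * K'`!)%N.
Proof.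
move=> gt; have /and3P[ct _ ft] := gt.
rewrite -!card_Sn -card_prod -cardsT.
pose F (b : {perm 'I_K} * {perm 'I_K'}) := relabel b.1 b.2 t.
have FI : injective F.
  move=> [b1 b2] [c1 c2] E; have [E1 E2] := relabel_eq ft E.
  by congr pair; apply/permP.
rewrite -(card_imset _ FI); apply: eq_card => u; rewrite inE; apply/idP/imsetP.
  move=> gu; have /and3P[cu _ fu] := gu.
  have [p [q [po qo E]]] := gluing_onto gt cu fu.
  have pI := surj_bij po (leqnn _); have qI := surj_bij qo (leqnn _).
  exists (perm pI, perm qI) => //; rewrite -E; apply/ffunP => e.
  by rewrite !ffunE !permE.
case=> -[b1 b2] _ ->; apply: relabel_gluing gt => //=; try exact: perm_inj.
  by apply/ontoP => v; exists (b1^-1%g v); rewrite permKV.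
by apply/ontoP => v; exists (b2^-1%g v); rewrite permKV.
Qed.

Lemma gluing_leq (K K' : nat) (t : {ffun 'I_n -> 'I_K * 'I_K'}) rho :
  gluing t rho -> (K <= n)%N /\ (K' <= n)%N.
Proof.
case/and3P => _ _ ft; split.
  rewrite -[X in (X <= _)%N](card_ord K) -[X in (_ <= X)%N](card_ord n).
  apply: (@surj_leq _ _ (fun e => (t e).1)); apply/ontoP => v.
  by have [e /eqP] := full_support1 v ft; exists e.
rewrite -[X in (X <= _)%N](card_ord K') -[X in (_ <= X)%N](card_ord n).
apply: (@surj_leq _ _ (fun e => (t e).2)); apply/ontoP => v.
by have [e /eqP] := full_support2 v ft; exists e.
Qed.

Section Expand.
Variables (I J : finType) (s : {ffun 'I_n -> I * J}) (rho : {perm 'I_n * bool}).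
Hypothesis fs : full_support s.

Let nb K K' : rat := \sum_(phi : {ffun 'I_K -> I} | onto phi) \sum_(psi : {ffun 'I_K' -> J} | onto psi)
  \sum_(t : {ffun 'I_n -> 'I_K * 'I_K'} | relabel phi psi t == s) (gluing t rho)%:R.

Lemma nb0 K K' : (forall t : {ffun 'I_n -> 'I_K * 'I_K'}, ~~ gluing t rho) \/ ~~ composable s rho ->
  nb K K' = 0.
Proof.
move=> H; rewrite /nb big1 // => phi _; rewrite big1 // => psi _; rewrite big1 // => t /eqP E.
case: H => [/(_ t)/negPf->//|nc]; case: (boolP (gluing t rho)) => // /and3P[ct _ _].
by move: nc; rewrite -E relabel_composable.
Qed.

Lemma nb_fact K K' (t : {ffun 'I_n -> 'I_K * 'I_K'}) : composable s rho -> gluing t rho ->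
  nb K K' = (K`! * K'`!)%:R.
Proof.
move=> cs gt; rewrite -(card_gluing gt) -sum1_card natr_sum big_mkcond /nb.
have -> : \sum_(phi : {ffun 'I_K -> I} | onto phi) \sum_(psi : {ffun 'I_K' -> J} | onto psi)
   \sum_(t : {ffun 'I_n -> 'I_K * 'I_K'} | relabel phi psi t == s) (gluing t rho)%:R =
   \sum_(phi : {ffun 'I_K -> I}) \sum_(psi : {ffun 'I_K' -> J})
   \sum_(t : {ffun 'I_n -> 'I_K * 'I_K'})
      ([&& onto phi, onto psi, relabel phi psi t == s & gluing t rho])%:R :> rat.
  rewrite big_mkcond; apply: eq_bigr => phi _; case: (onto phi); last first.
    by rewrite big1 // => psi _; rewrite big1.
  rewrite big_mkcond; apply: eq_bigr => psi _; case: (onto psi); last by rewrite big1.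
  by rewrite big_mkcond; apply: eq_bigr => u _; case: (relabel _ _ u == s).
under [LHS]eq_bigr => phi _ do rewrite exchange_big /=.
rewrite exchange_big; apply: eq_bigr => u _ /=; rewrite inE.
have [gu|gu] := boolP (gluing u rho); last first.
  by rewrite big1 // => phi _; rewrite big1 // => psi _; rewrite !andbF.
have [p [q [po qo E]]] := gluing_onto gu cs fs.
have /and3P[_ _ fu] := gu.
rewrite (bigD1 p) //= [X in _ + X]big1 ?addr0 => [|p' pp']; last first.
  rewrite big1 // => q' _; case: eqP => [E'|]; rewrite ?andbF //.
  case/negP: pp'; apply/eqP/ffunP => v.
  by have [] := relabel_eq fu (etrans E' (esym E)).
rewrite (bigD1 q) //= [X in _ + X]big1 ?addr0 => [|q' qq']; last first.
  case: eqP => [E'|]; rewrite ?andbF //.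
  case/negP: qq'; apply/eqP/ffunP => v.
  by have [_] := relabel_eq fu (etrans E' (esym E)).
by rewrite po qo E eqxx.
Qed.

(** A composable [rho] has definite numbers [K] and [K'] of black and white faces. Each of its
    [K! K'!] face labellings merges to [s] in exactly one way, whence the division. When [K + K']
    equals [#|I| + #|J|] the merging is bijective and [s] is itself a gluing. *)
Lemma composable_expand :
  (composable s rho)%:R = (gluing s rho)%:R +
   \sum_(K < n.+1) \sum_(K' < n.+1 | (#|I| + #|J| < K + K')%N)
      (K`! * K'`!)%:R^-1 * nb K K' :> rat.
Proof.
have [cs|nc] := boolP (composable s rho); last first.
  rewrite {1}/gluing (negPf nc) add0r big1 // => K _; rewrite big1 // => K' _.
  by rewrite nb0 ?mulr0 //; right.
have [K [K' [t gt]]] := gluing_exists cs.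
have [Kn K'n] := gluing_leq gt.
have [p [q [po qo E]]] := gluing_onto gt cs fs.
have H1 (k : 'I_n.+1) (k' : 'I_n.+1) : (k != K :> nat) || (k' != K' :> nat) -> nb k k' = 0.
  move=> kk; apply: nb0; left => u; apply: contraL kk => gu.
  by have [] := gluing_card gt gu; rewrite !card_ord => -> ->; rewrite !eqxx.
have -> : \sum_(k < n.+1) \sum_(k' < n.+1 | (#|I| + #|J| < k + k')%N)
      (k`! * k'`!)%:R^-1 * nb k k' = (#|I| + #|J| < K + K')%N%:R.
  pose a : 'I_n.+1 := inord K; pose b : 'I_n.+1 := inord K'.
  have aK : a = K :> nat by rewrite inordK.
  have bK : b = K' :> nat by rewrite inordK.
  rewrite (bigD1 a) //= [X in _ + X]big1 ?addr0 => [|k ka]; last first.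
    by rewrite big1 // => k' _; rewrite H1 ?mulr0 // -aK (inj_eq val_inj) ka.
  rewrite big_mkcond (bigD1 b) //= [X in _ + X]big1 ?addr0 => [|k' kb]; last first.
    by rewrite H1 ?mulr0 ?if_same // -bK (inj_eq val_inj) kb orbT.
  rewrite aK bK (nb_fact cs gt) mulVf; first by case: ifP.
  by rewrite pnatr_eq0 -lt0n muln_gt0 !fact_gt0.
have KI := surj_leq po; have KJ := surj_leq qo; rewrite !card_ord in KI KJ.
have [gs|ngs] := boolP (gluing s rho).
  have [] := gluing_card gt gs; rewrite !card_ord => -> ->.
  by rewrite ltnn addr0.
suff -> : (#|I| + #|J| < K + K')%N by rewrite add0r.
rewrite ltnNge; apply: contra ngs => le.
have eK : (K <= #|I|)%N by lia.
have eK' : (K' <= #|J|)%N by lia.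
rewrite -E; apply: relabel_gluing gt => //; apply: surj_bij; rewrite ?card_ord //.
Qed.

End Expand.

Lemma push_gluings (I J : finType) (K K' : nat) (phi : 'I_K -> I) (psi : 'I_K' -> J) s :
  push phi psi (fun t : {ffun 'I_n -> 'I_K * 'I_K'} => (nb_gluings t)%:R) s =
  \sum_(rho | transitive_perm rho) \sum_(t : {ffun 'I_n -> 'I_K * 'I_K'} | relabel phi psi t == s)
    (gluing t rho)%:R.
Proof.
rewrite [RHS]exchange_big; apply: eq_bigr => t _.
rewrite /nb_gluings -sum1_card natr_sum big_mkcond [RHS]big_mkcond.
by apply: eq_bigr => rho _; rewrite inE; case: (transitive_perm rho) => //=; case: (gluing t rho).
Qed.

(** Descending induction on the number of labels, which is at most [2n] because every label is
    carried by an edge. The count of gluings is the count of tours minus push-forwards of counts of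
    gluings with more labels. *)
Theorem treelike_gluings (I J : finType) : (0 < n)%N -> (0 < #|I|)%N -> (0 < #|J|)%N ->
  treelike (fun s : {ffun 'I_n -> I * J} => (nb_gluings s)%:R).
Proof.
move=> n0; have [m] := ubnP (n.*2.+1 - (#|I| + #|J|))%N.
elim: m => // m IH in I J *; move=> Im I0 J0.
pose F (K K' : 'I_n.+1) (phi : {ffun 'I_K -> I}) (psi : {ffun 'I_K' -> J}) :=
  push phi psi (fun t : {ffun 'I_n -> 'I_K * 'I_K'} => (nb_gluings t)%:R).
pose S s := \sum_(K < n.+1) \sum_(K' < n.+1 | (#|I| + #|J| < K + K')%N)
   \sum_(phi : {ffun 'I_K -> I} | onto phi) \sum_(psi : {ffun 'I_K' -> J} | onto psi)
      (K`! * K'`!)%:R^-1 * F K K' phi psi s.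
have TS : treelike S.
  rewrite /S; apply: treelike_sum => K _; apply: treelike_sum => K' lt.
  apply: treelike_sum => phi po; apply: treelike_sum => psi qo.
  apply: treelike_scale; apply: treelike_push => //.
  have := surj_leq po; have := surj_leq qo; rewrite !card_ord => h1 h2.
  have := ltn_ord K; have := ltn_ord K' => h3 h4.
  by apply: IH; rewrite !card_ord; lia.
apply: treelike_ext (treelike_lin (-1) (treelike_tree_weight n I0 J0) TS) _ => s.
rewrite mulN1r; have [fs|nfs] := boolP (full_support s); last first.
  rewrite /tree_weight btau_full // mul0r sub0r.
  have -> : nb_gluings s = 0%N.
    by apply/eqP; rewrite cards_eq0; apply/eqP/setP => rho; rewrite !inE /gluing (negPf nfs) !andbF.
  apply/eqP; rewrite oppr_eq0 /S big1 // => K _; rewrite big1 // => K' _.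
  rewrite big1 // => phi po; rewrite big1 // => psi qo.
  rewrite /F /push big1 ?mulr0 // => t /eqP E.
  apply/eqP; rewrite pnatr_eq0 cards_eq0; apply/eqP/setP => rho; rewrite !inE.
  apply/negbTE; apply: contra nfs => /andP[_ /and3P[_ _ ft]].
  by rewrite -E relabel_full // po qo.
rewrite /tree_weight -nb_tours_best //; apply/eqP; rewrite subr_eq; apply/eqP.
have cardE (P : pred {perm 'I_n * bool}) :
    #|[set rho | transitive_perm rho && P rho]%SET|%:R =
    \sum_(rho | transitive_perm rho) (P rho)%:R :> rat.
  rewrite -sum1_card natr_sum big_mkcond [RHS]big_mkcond; apply: eq_bigr => rho _.
  by rewrite inE; case: (transitive_perm rho) => //=; case: (P rho).
have -> : (nb_tours s)%:R = \sum_(rho | transitive_perm rho) (composable s rho)%:R :> rat.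
  exact: (cardE (composable s)).
have -> : (nb_gluings s)%:R = \sum_(rho | transitive_perm rho) (gluing s rho)%:R :> rat.
  exact: (cardE (gluing s)).
rewrite (eq_bigr _ (fun rho _ => composable_expand rho fs)) big_split /=; congr (_ + _).
rewrite exchange_big; apply: eq_bigr => K _ /=; rewrite exchange_big; apply: eq_bigr => K' _ /=.
rewrite -mulr_sumr.
under [RHS]eq_bigr => phi _ do rewrite -mulr_sumr.
rewrite -mulr_sumr; congr (_ * _).
rewrite exchange_big; apply: eq_bigr => phi _ /=; rewrite exchange_big; apply: eq_bigr => psi _.
by rewrite /F push_gluings.
Qed.

End Gluings.

(** * Weighted ribbon graphs *)

Section Weightings.
Variables (n : nat) (I J : finType).

(** The weights are taken in ['I_N.+1] to have a finite set; any [N] bounding the black sums loses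
    nothing. *)
Definition weightings N (s : {ffun 'I_n -> I * J}) (L : I -> nat) (L' : J -> nat) :
    {set {ffun 'I_n -> 'I_N.+1}} :=
  [set w : {ffun 'I_n -> 'I_N.+1} | [&& [forall e, (0 < w e)%N],
     [forall i, (\sum_(e | (s e).1 == i) w e == L i)%N] &
     [forall j, (\sum_(e | (s e).2 == j) w e == L' j)%N]]]%SET.

Definition nbw N s L L' : nat := #|weightings N s L L'|.

Lemma weightingsP N (s : {ffun 'I_n -> I * J}) L L' (w : {ffun 'I_n -> 'I_N.+1}) :
  reflect [/\ forall e, (0 < w e)%N,
     forall i, (\sum_(e | (s e).1 == i) w e = L i)%N &
     forall j, (\sum_(e | (s e).2 == j) w e = L' j)%N] (w \in weightings N s L L').
Proof.
rewrite inE; apply: (iffP and3P) => [[/forallP h1 /forallP h2 /forallP h3]|[h1 h2 h3]].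
  by split=> // v; apply/eqP.
by split; apply/forallP => v //; rewrite ?h2 ?h3.
Qed.

End Weightings.

Section Transport.
Variables (n k l : nat) (D : finType).
Hypothesis n0 : (0 < n)%N.
Implicit Types (G : labeled_map D k l) (s : {ffun 'I_n -> 'I_k * 'I_l})
  (rho : {perm 'I_n * bool}) (h : D) (K : {ffun D -> 'I_n * bool}).

(* [K] identifies the half-edges of [G] with arcs, [rho] being the rotation. *)
Definition models K G s rho : bool :=
  injectiveb K && [forall h, [&& rho (K h) == K (Defs.rot G h),
     rev_arc (K h) == K (Defs.opp G h) & arc_tgt s (K h) == Defs.side G h]].

Lemma modelsP K G s rho : reflect
  [/\ injective K, forall h, rho (K h) = K (Defs.rot G h),
      forall h, rev_arc (K h) = K (Defs.opp G h) & forall h, arc_tgt s (K h) = Defs.side G h]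
  (models K G s rho).
Proof.
apply: (iffP andP) => [[/injectiveP KI /forallP H]|[KI h1 h2 h3]].
  by split=> // h; have /and3P[/eqP h1 /eqP h2 /eqP h3] := H h.
by split; [exact/injectiveP|apply/forallP => h; rewrite h1 h2 h3 !eqxx].
Qed.

Hypothesis cD : #|D| = (n.*2)%N.

Lemma card_arcs : #|{: 'I_n * bool}| = n.*2.
Proof. by rewrite card_prod card_ord card_bool muln2. Qed.

Lemma arc_inj_bij K : injective K -> bijective K.
Proof. by move=> KI; apply: inj_card_bij => //; rewrite cD card_arcs. Qed.

Lemma porbit_conj (A B : finType) (f : A -> B) (a : {perm A}) (b : {perm B}) x y :
  injective f -> (forall z, b (f z) = f (a z)) ->
  (porbit a x == porbit a y) = (porbit b (f x) == porbit b (f y)).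
Proof.
move=> fI fE.
have fX i z : (b ^+ i)%g (f z) = f ((a ^+ i)%g z).
  by elim: i => [|i IH]; rewrite ?expg0 ?perm1 // !expgSr !permM IH fE.
rewrite !eq_porbit_mem; apply/porbitP/porbitP => -[i E]; exists i.
  by rewrite fX -E.
by apply: fI; rewrite -fX.
Qed.

Lemma card_porbits (A : finType) (C : finType) (a : {perm A}) (f : A -> C) :
  onto f -> (forall x y, (f x == f y) = (porbit a x == porbit a y)) ->
  #|porbits a| = #|C|.
Proof.
move=> /ontoP fo fE.
have H c : exists x, f x == c by have [x <-] := fo c; exists x.
pose g c := xchoose (H c); have gK c : f (g c) = c by apply/eqP/(xchooseP (H c)).
rewrite -cardsT -(card_imset _ (f := fun c => porbit a (g c))); last first.
  by move=> c d /eqP; rewrite -fE !gK => /eqP.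
apply: eq_card => O; apply/imsetP/imsetP => [[x _ ->]|[c _ ->]]; last by exists (g c).
by exists (f x) => //; apply/eqP; rewrite -fE gK.
Qed.

Lemma transitive_permE (A : finType) (a : {perm A}) (x0 : A) :
  transitive_perm a = [forall x, forall y, porbit a x == porbit a y].
Proof.
apply/idP/forallP => [ta x|H].
  by apply/forallP => y; rewrite !(transitive_permP _ ta).
apply/cards1P; exists (porbit a x0); apply/setP => O; rewrite inE.
apply/imsetP/eqP => [[x _ ->]|->]; last by exists x0.
exact/eqP/(forallP (H x)).
Qed.

Section Model.
Variables (K : {ffun D -> 'I_n * bool}) (G : labeled_map D k l)
  (s : {ffun 'I_n -> 'I_k * 'I_l}) (rho : {perm 'I_n * bool}).
Hypothesis KG : models K G s rho.

Let KI : injective K. Proof. by have [] := modelsP _ _ _ _ KG. Qed.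
Let Krot h : rho (K h) = K (Defs.rot G h). Proof. by have [] := modelsP _ _ _ _ KG. Qed.
Let Kopp h : rev_arc (K h) = K (Defs.opp G h). Proof. by have [] := modelsP _ _ _ _ KG. Qed.
Let Ktgt h : arc_tgt s (K h) = Defs.side G h. Proof. by have [] := modelsP _ _ _ _ KG. Qed.

Lemma model_face h : facep rho (K h) = K (face G h).
Proof.
rewrite /facep /face !permM [revp _ _]permE Kopp.
apply: (perm_inj (s := rho)); rewrite permKV Krot.
by rewrite -permM mulVg perm1.
Qed.

(** All conditions are transported along [K]. The genus comes for free: there are [n] edges and one
    vertex, and a bijection between faces and labels gives [k + l] faces. Composability follows
    because [rev_arc (rho x)] and [x] lie on the same face. *)
Lemma model_mem g : n = (2 * g + k + l).-1 -> (0 < k)%N -> (0 < l)%N ->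
  (G \in one_vertex_bicolored D k l g) = transitive_perm rho && gluing s rho.
Proof.
move=> nE k0 l0.
have [Ki K'K KK'] := arc_inj_bij KI.
have x0 : 'I_n * bool := (Ordinal n0, true).
have d0 : D := Ki x0.
have VE : (nb_vertices G == 1%N) = transitive_perm rho.
  rewrite -/(transitive_perm (Defs.rot G)) (transitive_permE _ d0) (transitive_permE _ x0).
  apply/forallP/forallP => H x; apply/forallP => y.
    by rewrite -[x]KK' -[y]KK' -(porbit_conj _ _ KI Krot); have /forallP := H (Ki x).
  by rewrite (porbit_conj _ _ KI Krot); have /forallP := H (K x).
have faceE x y : (porbit (face G) x == porbit (face G) y) =
    (porbit (facep rho) (K x) == porbit (facep rho) (K y)).
  by apply: porbit_conj => // z; rewrite model_face.
have tgt_full : [forall c, exists h, Defs.side G h == c] = full_support s.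
  apply/forallP/andP => [H|[/forallP b0 /forallP w0] [i|j]].
    split; apply/forallP => v; rewrite card_gt0; apply/set0Pn.
      have /existsP[h] := H (inl v); rewrite -Ktgt /arc_tgt.
      by case: (K h).2 => // /eqP[<-]; exists (K h).1; rewrite inE.
    have /existsP[h] := H (inr v); rewrite -Ktgt /arc_tgt.
    by case: (K h).2 => // /eqP[<-]; exists (K h).1; rewrite inE.
  - have := b0 i; rewrite card_gt0 => /set0Pn[e]; rewrite inE => /eqP ei.
    by apply/existsP; exists (Ki (e, false)); rewrite -Ktgt KK' /arc_tgt /bend /= ei.
  - have := w0 j; rewrite card_gt0 => /set0Pn[e]; rewrite inE => /eqP ej.
    by apply/existsP; exists (Ki (e, true)); rewrite -Ktgt KK' /arc_tgt /wend /= ej.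
have labE : [forall h, forall h', (Defs.side G h == Defs.side G h') == (porbit (face G) h == porbit (face G) h')]
    = labels_faces s rho.
  apply/forallP/forallP => H x; apply/forallP => y.
    by rewrite -[x]KK' -[y]KK' !Ktgt -faceE; have /forallP := H (Ki x).
  by rewrite faceE -!Ktgt; have /forallP := H (K x).
have ribE : transitive_perm rho -> is_ribbon_graph G.
  rewrite -VE => V1; apply/and3P; split.
  - by apply/forallP => h; apply/eqP/KI; rewrite -!Kopp rev_arcK.
  - apply/forallP => h; rewrite -(inj_eq KI) -Kopp; case: (K h) => e b.
    by rewrite /rev_arc /= xpair_eqE eqxx /=; case: b.
  - apply/forallP => h; apply/forallP => h'.
    have : h' \in porbit (Defs.rot G) h by rewrite (transitive_permP _ V1) inE.
    case/porbitP => i ->; elim: i => [|i IH]; first by rewrite expg0 perm1 connect0.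
    apply: connect_trans IH (connect1 _) => /=.
    by rewrite expgSr permM eqxx.
have biE : bicolored G.
  apply/forallP => h; rewrite -!Ktgt -Kopp; case: (K h) => e b.
  by rewrite /rev_arc /arc_tgt /=; case: b.
have genE : transitive_perm rho -> labels_faces s rho -> full_support s -> has_genus g G.
  move=> tr lf fs; rewrite /has_genus.
  have -> : nb_vertices G = 1%N by apply/eqP; rewrite VE.
  have -> : nb_edges G = n.
    rewrite -[RHS](card_ord n); apply: (@card_porbits _ _ _ (fun h => (K h).1)).
      by apply/ontoP => e; exists (Ki (e, true)); rewrite KK'.
    move=> x y; rewrite (porbit_conj (b := revp n) x y KI) => [|z]; last by rewrite permE.
    have revX i z : ((revp n ^+ i)%g z).1 = z.1.
      by elim: i => [|i IH]; rewrite ?expg0 ?perm1 // expgSr permM permE /= IH.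
    apply/eqP/idP => [E|]; last first.
      by rewrite eq_porbit_mem => /porbitP[i ->]; rewrite revX.
    rewrite eq_porbit_mem; apply/porbitP.
    have [E2|E2] := eqVneq (K x).2 (K y).2.
      by exists 0%N; rewrite expg0 perm1; apply/eqP; rewrite -pair_eqE /= E E2 !eqxx.
    exists 1%N; rewrite expg1 permE /rev_arc; apply/eqP; rewrite -pair_eqE /= E eqxx /=.
    by move: E2; case: (K x).2; case: (K y).2.
  have -> : nb_faces G = (k + l)%N.
    rewrite -[in RHS](card_ord k) -[in RHS](card_ord l) -card_sum.
    apply: (@card_porbits _ _ _ (Defs.side G)).
      by apply/ontoP => c; rewrite -tgt_full in fs; have /existsP[h /eqP] := forallP fs c; exists h.
    by move=> x y; rewrite -labE in lf; have /forallP/(_ y)/eqP := forallP lf x.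
  by apply/eqP; rewrite nE; lia.
rewrite inE VE /well_labeled labE tgt_full biE andbT; apply/idP/idP.
  case/and4P => /and3P[/forallP oK _ _] tr _ /andP[lf fs].
  rewrite tr /gluing lf fs !andbT; apply/forallP => x.
  rewrite -[rho x]rev_arcK arc_tgt_rev; have /forallP/(_ x)/eqP -> := forallP lf (rev_arc (rho x)).
  rewrite -[X in _ == porbit _ X](_ : facep rho (rev_arc (rho x)) = x).
    by rewrite eq_sym eq_porbit_mem; have := mem_porbit (facep rho) 1 (rev_arc (rho x)); rewrite expg1.
  by rewrite /facep permM [revp _ _]permE rev_arcK permK.
case/andP => tr /and3P[cs lf fs].
by rewrite ribE // tr genE // lf fs.
Qed.

Lemma sum_arc_tgt_inl i (F : 'I_n -> nat) :
  (\sum_(x : 'I_n * bool | arc_tgt s x == inl i) F x.1 = \sum_(e | (s e).1 == i) F e)%N.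
Proof.
rewrite [RHS](reindex_onto (fun x : 'I_n * bool => x.1) (fun e => (e, false))) //=.
apply: eq_bigl => -[e b]; rewrite /arc_tgt /bend /wend xpair_eqE /= eqxx.
by case: b; rewrite ?andbF // andbT.
Qed.

Lemma sum_arc_tgt_inr j (F : 'I_n -> nat) :
  (\sum_(x : 'I_n * bool | arc_tgt s x == inr j) F x.1 = \sum_(e | (s e).2 == j) F e)%N.
Proof.
rewrite [RHS](reindex_onto (fun x : 'I_n * bool => x.1) (fun e => (e, true))) //=.
apply: eq_bigl => -[e b]; rewrite /arc_tgt /bend /wend xpair_eqE /= eqxx.
by case: b; rewrite ?andbF // andbT.
Qed.

Lemma model_metrics N (L : 'rV[int]_k) (L' : 'rV[int]_l) (M : 'I_k -> nat) (M' : 'I_l -> nat) :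
  (forall i, L 0 i = Posz (M i)) -> (forall j, L' 0 j = Posz (M' j)) ->
  (forall i, (M i <= N)%N) -> nb_metrics G L L' = nbw N s M M'.
Proof.
move=> LM LM' MN; have [Ki K'K KK'] := arc_inj_bij KI.
pose F (w : {ffun 'I_n -> 'I_N.+1}) : {ffun D -> nat} := [ffun h => val (w (K h).1)].
have FI : injective F.
  move=> w w' /ffunP E; apply/ffunP => e; apply: val_inj.
  by have := E (Ki (e, true)); rewrite !ffunE KK'.
have kb : bijective K by exists Ki.
have per1 (f : 'I_n -> nat) i : (\sum_(h | Defs.side G h == inl i) f (K h).1 =
    \sum_(e | (s e).1 == i) f e)%N.
  rewrite -sum_arc_tgt_inl [RHS](reindex K) /=; last exact: onW_bij.
  by apply: eq_bigl => h; rewrite Ktgt.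
have per2 (f : 'I_n -> nat) j : (\sum_(h | Defs.side G h == inr j) f (K h).1 =
    \sum_(e | (s e).2 == j) f e)%N.
  rewrite -sum_arc_tgt_inr [RHS](reindex K) /=; last exact: onW_bij.
  by apply: eq_bigl => h; rewrite Ktgt.
have -> : nb_metrics G L L' = #|` [fset F w | w in weightings N s M M']%fset|%fset.
  congr (#|` _|%fset); rewrite -[RHS]set_fsetK; congr fset_set.
  apply/seteqP; split=> m /=.
    case=> m1 m2 m3; pose f e := m (Ki (e, true)).
    have mf h : m h = f (K h).1.
      rewrite /f; case E: (K h) => [e [|]] /=; first by rewrite -E K'K.
      have [_ <-] := m1 h; congr (m _); apply: KI.
      by rewrite -Kopp E KK'.
    have p1 i : (\sum_(e | (s e).1 == i) f e = M i)%N.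
      apply/eqP; rewrite -per1 -eqz_nat -LM -m2; apply/eqP; congr Posz.
      by apply: eq_bigr => h _; rewrite mf.
    have p2 j : (\sum_(e | (s e).2 == j) f e = M' j)%N.
      apply/eqP; rewrite -per2 -eqz_nat -LM' -m3; apply/eqP; congr Posz.
      by apply: eq_bigr => h _; rewrite mf.
    have fN e : (f e < N.+1)%N.
      rewrite ltnS (leq_trans _ (MN (s e).1)) // -p1 (bigD1 e) //= leq_addr //.
    apply/imfsetP; exists [ffun e => Ordinal (fN e)].
      apply/weightingsP; split=> [e|i|j].
      - by rewrite ffunE /=; have [] := m1 (Ki (e, true)).
      - by rewrite -p1; apply: eq_bigr => e _; rewrite ffunE.
      - by rewrite -p2; apply: eq_bigr => e _; rewrite ffunE.
    by apply/ffunP => h; rewrite !ffunE /= mf.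
  case/imfsetP => w /weightingsP[w0 w1 w2] ->; split=> [h|i|j].
  - by rewrite !ffunE w0 -Kopp.
  - rewrite LM -w1 /perimeter; congr Posz; rewrite -per1.
    by apply: eq_bigr => h _; rewrite ffunE.
  - rewrite LM' -w2 /perimeter; congr Posz; rewrite -per2.
    by apply: eq_bigr => h _; rewrite ffunE.
by rewrite card_imfset //= -cardE.
Qed.

End Model.
End Transport.

(** * Counting ribbon graphs up to isomorphism *)

Section IsoClasses.
Variables (D : finType) (k l : nat).
Implicit Types (G : labeled_map D k l) (f : {perm D}).

Lemma is_isoP f G G' : reflect
  [/\ forall h, Defs.rot G' (f h) = f (Defs.rot G h),
      forall h, Defs.opp G' (f h) = f (Defs.opp G h) &
      forall h, Defs.side G' (f h) = Defs.side G h] (is_iso f G G').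
Proof.
apply: (iffP forallP) => [H|[h1 h2 h3] h]; last by rewrite h1 h2 h3 !eqxx.
by split=> h; have /and3P[/eqP h1 /eqP h2 /eqP h3] := H h.
Qed.

Lemma isomorphic_equiv : equivalence_rel (@isomorphic D k l).
Proof.
have R G : isomorphic G G.
  by apply/existsP; exists 1%g; apply/is_isoP; split=> h; rewrite !perm1.
have S G G' : isomorphic G G' -> isomorphic G' G.
  case/existsP => f /is_isoP[h1 h2 h3]; apply/existsP; exists f^-1%g; apply/is_isoP.
  split=> h; last by rewrite -h3 permKV.
    by apply: (perm_inj (s := f)); rewrite permKV -h1 permKV.
  by apply: (perm_inj (s := f)); rewrite permKV -h2 permKV.
have T G1 G2 G3 : isomorphic G1 G2 -> isomorphic G2 G3 -> isomorphic G1 G3.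
  case/existsP => f /is_isoP[f1 f2 f3] /existsP[f' /is_isoP[g1 g2 g3]].
  apply/existsP; exists (f * f')%g; apply/is_isoP.
  by split=> h; rewrite !permM ?g1 ?g2 ?g3 ?f1 ?f2 ?f3.
move=> x y z; split=> // xy; apply/idP/idP => H; last exact: T xy H.
exact: T (S _ _ xy) H.
Qed.

End IsoClasses.

Lemma iso_class_repr (g k l : nat) (G : labeled_map 'I_(nb_half_edges g k l) k l) :
  G \in one_vertex_bicolored _ k l g ->
  exists2 G0, G0 \in iso_classes g k l &
    forall G', (G' \in iso_classes g k l) && isomorphic G G' = (G' == G0).
Proof.
move=> GE; rewrite /iso_classes; set E := one_vertex_bicolored _ _ _ _ in GE *.
set P := equivalence_partition _ _.
have eqR : {in E & &, equivalence_rel (@isomorphic 'I_(nb_half_edges g k l) k l)}.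
  by move=> x y z _ _ _; exact: isomorphic_equiv.
have partP : finset.partition P E by apply: equivalence_partitionP.
have /and3P[_ /fintype.subsetP XE /forall_inP XB] := transversalP partP.
have Gc : G \in finset.cover P by rewrite (cover_partition partP).
have /cards1P[G0 E0] := XB _ (pblock_mem Gc).
have H G' : (G' \in transversal P E) && isomorphic G G' = (G' == G0).
  rewrite -finset.in_set1 -E0 finset.in_setI; have [G'X|//] := boolP (G' \in _).
  by rewrite pblock_equivalence_partition // XE.
by exists G0 => //; have := H G0; rewrite eqxx => /andP[].
Qed.

Section CountModels.
Variables (n g k l : nat).
Hypotheses (n0 : (0 < n)%N) (k0 : (0 < k)%N) (l0 : (0 < l)%N).
Hypothesis nE : n = (2 * g + k + l).-1.
Notation D := 'I_(nb_half_edges g k l).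
Implicit Types (G : labeled_map D k l) (s : {ffun 'I_n -> 'I_k * 'I_l})
  (rho : {perm 'I_n * bool}) (h : D) (K : {ffun D -> 'I_n * bool}).

Lemma cardD : #|{: D}| = (n.*2)%N.
Proof. by rewrite card_ord /nb_half_edges -nE mul2n. Qed.

Lemma models_iso K K' G G' s rho : models K G s rho -> models K' G' s rho ->
  isomorphic G G'.
Proof.
case/modelsP => KI a1 a2 a3 /modelsP[K'I b1 b2 b3].
have [Ki K1 K2] := arc_inj_bij cardD K'I.
have fI : injective (fun h => Ki (K h)) by apply: inj_comp KI; exact: can_inj K2.
apply/existsP; exists (perm fI); apply/is_isoP; split=> h; rewrite !permE.
- by apply: K'I; rewrite -b1 !K2 a1.
- by apply: K'I; rewrite -b2 !K2 a2.
- by rewrite -b3 K2 a3.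
Qed.

Lemma models_comp K G G' s rho f : models K G s rho -> is_iso f G' G ->
  models [ffun h => K (f h)] G' s rho.
Proof.
case/modelsP => KI a1 a2 a3 /is_isoP[f1 f2 f3]; apply/modelsP; split=> [h h'|h|h|h].
- by rewrite !ffunE => /KI/perm_inj.
- by rewrite !ffunE a1 f1.
- by rewrite !ffunE a2 f2.
- by rewrite !ffunE a3 f3.
Qed.

Lemma models_exists s rho : exists K, exists G, models K G s rho.
Proof.
have cA : #|{: 'I_n * bool}| = #|{: D}| by rewrite cardD card_arcs.
pose K : {ffun D -> 'I_n * bool} := [ffun h => enum_val (cast_ord (esym cA) (enum_rank h))].
have KI : injective K by move=> h h'; rewrite !ffunE => /enum_val_inj/cast_ord_inj/enum_rank_inj.
have [Ki K1 K2] := arc_inj_bij cardD KI.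
have rI : injective (fun h => Ki (rho (K h))).
  by apply: inj_comp (can_inj K2) _; apply: inj_comp perm_inj KI.
have oI : injective (fun h => Ki (rev_arc (K h))).
  by apply: inj_comp (can_inj K2) _; apply: inj_comp (inv_inj (@rev_arcK n)) KI.
exists K, (LabeledMap (perm rI) (perm oI) [ffun h => arc_tgt s (K h)]).
by apply/modelsP; split=> // h; rewrite [RHS]/= ?permE ?K2 // [RHS]ffunE.
Qed.

(** All maps modelled by [s] and [rho] are isomorphic, and the models over the representative of
    their class form a single free orbit of its automorphism group. *)
Lemma sum_models_classes s rho : transitive_perm rho -> gluing s rho ->
  \sum_(G in iso_classes g k l)
     (#|Aut_map G|%:R)^-1 * #|[set K : {ffun D -> 'I_n * bool} | models K G s rho]%SET|%:R = 1 :> rat.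
Proof.
move=> tr gl; have [K1 [G1 KG1]] := models_exists s rho.
have G1E : G1 \in one_vertex_bicolored _ k l g.
  by rewrite (model_mem n0 cardD KG1) // tr gl.
have [G0 G0r G0P] := iso_class_repr G1E.
rewrite (bigD1 G0) //= [X in _ + X]big1 ?addr0 => [|G /andP[Gr GG0]]; last first.
  have -> : [set K : {ffun D -> 'I_n * bool} | models K G s rho]%SET = finset.set0; last by rewrite cards0 mulr0.
  apply/setP => K; rewrite !inE; apply/negbTE/negP => KG.
  by have := G0P G; rewrite Gr (models_iso KG1 KG) (negPf GG0).
have : isomorphic G0 G1.
  have := G0P G0; rewrite eqxx => /andP[_ i10].
  have [_ H] := isomorphic_equiv G1 G0 G1.
  by rewrite -H // (isomorphic_equiv G1 G1 G1).
case/existsP => f fi; pose K0 := [ffun h => K1 (f h)].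
have KG0 : models K0 G0 s rho by apply: models_comp fi.
have K0I : injective K0 by have [] := modelsP _ _ _ _ KG0.
have [Ki Ka Kb] := arc_inj_bij cardD K0I.
have -> : #|[set K : {ffun D -> 'I_n * bool} | models K G0 s rho]%SET| = #|Aut_map G0|.
  pose F (a : {perm D}) : {ffun D -> 'I_n * bool} := [ffun h => K0 (a h)].
  have FI : injective F.
    move=> a b /ffunP E; apply/permP => h; apply: K0I.
    by have := E h; rewrite ![F _ _]ffunE.
  rewrite -(card_imset _ FI); apply: eq_card => K; rewrite inE; apply/idP/imsetP.
    move=> KG; have /modelsP[KI a1 a2 a3] := KG; have /modelsP[_ b1 b2 b3] := KG0.
    have aI : injective (fun h => Ki (K h)) by apply: inj_comp (can_inj Kb) KI.
    exists (perm aI); last by apply/ffunP => h; rewrite [RHS]ffunE permE Kb.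
    rewrite inE; apply/is_isoP; split=> h; rewrite !permE.
    - by apply: K0I; rewrite -b1 !Kb a1.
    - by apply: K0I; rewrite -b2 !Kb a2.
    - by rewrite -b3 Kb a3.
  by case=> a; rewrite inE => ai ->; exact: models_comp ai.
rewrite mulVf // pnatr_eq0 -lt0n; apply/card_gt0P; exists 1%g.
by rewrite inE; apply/is_isoP; split=> h; rewrite !perm1.
Qed.

Definition lift_perm (pi : {perm 'I_n}) (x : 'I_n * bool) := (pi x.1, x.2).

Lemma lift_permK pi x : lift_perm pi^-1%g (lift_perm pi x) = x.
Proof. by case: x => e b; rewrite /lift_perm /= permK. Qed.

(** Each edge has exactly one half-edge with a white left side. Numbering these half-edges numbers
    the edges, and they become the arcs [(e, true)]. *)
Lemma models_of_map G : G \in one_vertex_bicolored _ k l g ->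
  exists K, exists s, exists rho, models K G s rho.
Proof.
rewrite inE => /and5P[/and3P[/forallP oppK _ _] _ _ _ /forallP bi].
pose W := [set h | ~~ is_black (Defs.side G h)]%SET.
have oK h : Defs.opp G (Defs.opp G h) = h by apply/eqP.
have oW h : (Defs.opp G h \in W) = (h \notin W).
  rewrite !inE; have := bi h.
  by case: (is_black _); case: (is_black _).
have cW : #|W| = n.
  have cWC : #|~: W| = #|W|.
    rewrite -(card_imset W (perm_inj (s := Defs.opp G))); apply: eq_card => h.
    rewrite finset.in_setC; apply/idP/imsetP => [hW|[h' h'W ->]]; last by rewrite oW h'W.
    by exists (Defs.opp G h); rewrite ?oK // oW.
  by have := cardsC W; rewrite cWC cardD; lia.
have hW0 h : (if h \in W then h else Defs.opp G h) \in W.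
  by case: ifP => // hW; rewrite oW hW.
pose idx h : 'I_n := cast_ord cW (enum_rank_in (hW0 h) (if h \in W then h else Defs.opp G h)).
pose K : {ffun D -> 'I_n * bool} := [ffun h => (idx h, h \in W)].
have idxV h : enum_val (cast_ord (esym cW) (idx h)) = if h \in W then h else Defs.opp G h.
  by rewrite /idx cast_ordK enum_rankK_in.
have KI : injective K.
  move=> h h'; rewrite !ffunE => E0.
  have E : idx h = idx h' := congr1 fst E0; have Wh : (h \in W) = (h' \in W) := congr1 snd E0.
  have : (if h \in W then h else Defs.opp G h) = (if h' \in W then h' else Defs.opp G h').
    by rewrite -!idxV E.
  by rewrite Wh; case: ifP => // _ /perm_inj.
have [Ki Ka Kb] := arc_inj_bij cardD KI.
have idx_opp h : idx (Defs.opp G h) = idx h.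
  apply: (can_inj (cast_ordKV cW)); apply: enum_val_inj.
  by rewrite !idxV oW oK; case: (h \in W).
pose bl (c : 'I_k + 'I_l) := if c is inl i then i else Ordinal k0.
pose wh (c : 'I_k + 'I_l) := if c is inr j then j else Ordinal l0.
pose s : {ffun 'I_n -> 'I_k * 'I_l} :=
  [ffun e => (bl (Defs.side G (Ki (e, false))), wh (Defs.side G (Ki (e, true))))].
have rI : injective (fun x => K (Defs.rot G (Ki x))).
  by apply: inj_comp KI _; apply: inj_comp perm_inj (can_inj Kb).
exists K, s, (perm rI); apply/modelsP; split=> // h.
- by rewrite permE Ka.
- by rewrite !ffunE /rev_arc /= idx_opp oW.
rewrite -[in RHS](Ka h); move: (K h) (Kb (K h)) => [e b] E.
rewrite /arc_tgt /bend /wend ffunE /=.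
have : (Ki (e, b) \in W) = b by move: E; rewrite ffunE => -[].
rewrite inE; case: b E => E; case: (Defs.side G _) => //.
Qed.

(** The colours force the direction of every arc, so a model amounts to a numbering of the edges;
    [s] and [rho] are then determined. *)
Lemma sum_models G : G \in one_vertex_bicolored _ k l g ->
  (\sum_(s : {ffun 'I_n -> 'I_k * 'I_l}) \sum_(rho : {perm 'I_n * bool}) #|[set K : {ffun D -> 'I_n * bool} | models K G s rho]%SET| = n`!)%N.
Proof.
move=> GE; have [K0 [s0 [rho0 KG]]] := models_of_map GE.
have /modelsP[K0I a1 a2 a3] := KG.
have [Ki Ka Kb] := arc_inj_bij cardD K0I.
transitivity #|[set x : {ffun D -> 'I_n * bool} * ({ffun 'I_n -> 'I_k * 'I_l} * {perm 'I_n * bool}) |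
   models x.1 G x.2.1 x.2.2]%SET|.
  rewrite -sum1dep_card [RHS]big_mkcond.
  transitivity (\sum_(K : {ffun D -> 'I_n * bool}) \sum_(p : {ffun 'I_n -> 'I_k * 'I_l} * {perm 'I_n * bool})
      (if models K G p.1 p.2 then 1 else 0))%N; last by rewrite pair_bigA.
  rewrite [RHS]exchange_big.
  transitivity (\sum_(s : {ffun 'I_n -> 'I_k * 'I_l}) \sum_(r : {perm 'I_n * bool})
      \sum_K (if models K G s r then 1 else 0))%N; last first.
    by rewrite [LHS](pair_bigA _ (fun s r => \sum_K (if models K G s r then 1 else 0))%N).
  by apply: eq_bigr => s _; apply: eq_bigr => r _; rewrite -sum1dep_card big_mkcond.
rewrite -card_Sn -cardsT.
have lI pi : injective (lift_perm pi) by move=> [e b] [e' b'] [/perm_inj-> ->].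
pose F (pi : {perm 'I_n}) : {ffun D -> 'I_n * bool} * ({ffun 'I_n -> 'I_k * 'I_l} * {perm 'I_n * bool}) :=
  ([ffun h => lift_perm pi (K0 h)],
   ([ffun e => s0 (pi^-1%g e)], (perm (lI (pi^-1)%g) * rho0 * perm (lI pi))%g)).
have FI : injective F.
  move=> p1 p2 [/ffunP E _ _]; apply/permP => e.
  by have := E (Ki (e, true)); rewrite !ffunE Kb => -[].
rewrite -(card_imset _ FI); apply: eq_card => -[K [s rho]]; rewrite inE; apply/idP/imsetP => /=.
  case/modelsP => KI b1 b2 b3.
  have K2 h : (K h).2 = (K0 h).2.
    by have := b3 h; rewrite -a3 /arc_tgt; case: (K h).2; case: (K0 h).2.
  pose q e := (K (Ki (e, true))).1.
  have Kq h : K h = (q (K0 h).1, (K0 h).2).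
    rewrite /q; case E : (K0 h) => [e b] /=.
    case: b E => E; first by rewrite -E Ka [LHS]surjective_pairing K2 E.
    have -> : Ki (e, true) = Defs.opp G h by apply: K0I; rewrite Kb -a2 E.
    by rewrite -b2 [LHS]surjective_pairing K2 E.
  have qI : injective q.
    move=> e e' E; have : K (Ki (e, true)) = K (Ki (e', true)) by rewrite !Kq !Kb /= E.
    by move/KI/(can_inj Kb) => [].
  exists (perm qI) => //; congr (_, (_, _)).
  - by apply/ffunP => h; rewrite ffunE /lift_perm permE Kq.
  - apply/ffunP => e; rewrite ffunE -{1}[e](permKV (perm qI)).
    move: ((perm qI)^-1%g e) => e'; rewrite permE.
    have := b3 (Ki (e', false)); have := b3 (Ki (e', true)).
    rewrite -!a3 !Kq !Kb /arc_tgt /bend /wend /= => -[E2] [E1].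
    by rewrite [LHS]surjective_pairing E1 E2 -surjective_pairing.
  - have KL h : K h = lift_perm (perm qI) (K0 h) by rewrite /lift_perm permE Kq.
    have [Ki' Ka' Kb'] := arc_inj_bij cardD KI.
    apply/permP => x; rewrite !permM !(permE (lI _)) -[x]Kb'; move: (Ki' x) => h.
    by rewrite b1 [in RHS]KL lift_permK a1 -KL.
case=> pi _ [-> -> ->]; apply/modelsP; split=> [h h'|h|h|h].
- by rewrite !ffunE => /lI/K0I.
- by rewrite !ffunE !permM !(permE (lI _)) lift_permK a1.
- by rewrite !ffunE -a2.
- by rewrite !ffunE /arc_tgt /bend /wend /lift_perm /= !ffunE permK -a3.
Qed.

(** Double counting of models: summed over [s] and [rho] they number [n!] for each class
    representative, and summed over the classes with weight [1 / |Aut|] they give 1 for each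
    admissible pair. *)
Theorem weighted_countE N (L : 'rV[int]_k) (L' : 'rV[int]_l) (M : 'I_k -> nat) (M' : 'I_l -> nat) :
  (forall i, L 0 i = Posz (M i)) -> (forall j, L' 0 j = Posz (M' j)) ->
  (forall i, (M i <= N)%N) ->
  weighted_count g L L' = (n`!)%:R^-1 *
    \sum_(s : {ffun 'I_n -> 'I_k * 'I_l}) (nb_gluings s)%:R * (nbw N s M M')%:R.
Proof.
move=> LM LM' MN; rewrite /weighted_count.
have classE G : G \in iso_classes g k l -> G \in one_vertex_bicolored D k l g.
  have eqR : {in one_vertex_bicolored D k l g & &, equivalence_rel (@isomorphic D k l)}.
    by move=> x y z _ _ _; exact: isomorphic_equiv.
  have /and3P[_ /fintype.subsetP XE _] := transversalP (equivalence_partitionP eqR).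
  exact: XE.
have n1 : (n`!)%:R != 0 :> rat by rewrite pnatr_eq0 -lt0n fact_gt0.
transitivity ((n`!)%:R^-1 * \sum_(G in iso_classes g k l)
   \sum_(s : {ffun 'I_n -> 'I_k * 'I_l}) \sum_(rho : {perm 'I_n * bool})
   (#|Aut_map G|%:R)^-1 * #|[set K : {ffun D -> 'I_n * bool} | models K G s rho]%SET|%:R * (nb_metrics G L L')%:R : rat).
  rewrite mulr_sumr; apply: eq_bigr => G Gr.
  under eq_bigr => s _ do (under eq_bigr => rho _ do rewrite mulrAC; rewrite -mulr_sumr).
  rewrite -mulr_sumr.
  have -> : \sum_(s : {ffun 'I_n -> 'I_k * 'I_l}) \sum_(rho : {perm 'I_n * bool})
      #|[set K : {ffun D -> 'I_n * bool} | models K G s rho]%SET|%:R = (n`!)%:R :> rat.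
    rewrite -(sum_models (classE _ Gr)) natr_sum; apply: eq_bigr => s _.
    by rewrite natr_sum.
  by rewrite mulrCA mulVf ?mulr1.
congr (_ * _); rewrite exchange_big; apply: eq_bigr => s _ /=; rewrite exchange_big /=.
rewrite /nb_gluings -sum1_card natr_sum mulr_suml [RHS]big_mkcond; apply: eq_bigr => rho _.
rewrite inE; case: ifP => [/andP[tr gl]|ng].
  rewrite -[1%:R](sum_models_classes tr gl) mulr_suml; apply: eq_bigr => G Gr.
  have [->|/set0Pn[K]] := eqVneq [set K : {ffun D -> 'I_n * bool} | models K G s rho]%SET finset.set0.
    by rewrite cards0 mulr0 !mul0r.
  by rewrite inE => KG; rewrite (model_metrics cardD KG LM LM' MN).
rewrite big1 // => G /classE GE.
have -> : [set K : {ffun D -> 'I_n * bool} | models K G s rho]%SET = finset.set0.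
  apply/setP => K; rewrite !inE; apply/negbTE/negP => KG.
  by move: GE; rewrite (model_mem n0 cardD KG nE) // ng.
by rewrite cards0 mulr0 mul0r.
Qed.

End CountModels.

(** * Flows on trees and their zero patterns *)

Definition bsum (V : finType) (b : V -> rat) (S : {set V}) : rat := \sum_(v in S) b v.

Lemma bsumT (V : finType) (b : V -> rat) : bsum b [set: V]%SET = \sum_v b v.
Proof. by apply: eq_bigl => v; rewrite inE. Qed.

Lemma bsumC (V : finType) (b : V -> rat) S : \sum_v b v = 0 -> bsum b (~: S)%SET = - bsum b S.
Proof.
move=> b0; have H : bsum b S + bsum b (~: S)%SET = 0.
  rewrite -[RHS]b0 [RHS](bigID [in S]) /=; congr (_ + _).
  by apply: eq_bigl => v; rewrite inE.
by apply/eqP; rewrite -addr_eq0 addrC H.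
Qed.

Lemma bsumE (V : finType) (b : V -> rat) S : bsum b S = \sum_v (v \in S)%:R * b v.
Proof. by rewrite /bsum big_mkcond; apply: eq_bigr => v _; case: (v \in S); rewrite ?mul1r ?mul0r. Qed.

Section EdgeSets.
Variables (E V : finType) (p q : E -> V).
Implicit Types (A : {set E}) (S : {set V}) (b : V -> rat) (e : E).

Definition econn A : bool :=
  [forall S : {set V}, [forall e in A, (p e \in S) == (q e \in S)] ==>
     (S == finset.set0) || (S == [set: V]%SET)].

Lemma econnP A : reflect (forall S, (forall e, e \in A -> (p e \in S) = (q e \in S)) ->
    S = finset.set0 \/ S = [set: V]%SET) (econn A).
Proof.
apply: (iffP forallP) => H S.
  move=> E0; have /implyP/(_ _)/orP := H S.
  by case; [apply/forall_inP => e /E0->|move=> /eqP->; left|move=> /eqP->; right].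
apply/implyP => /forall_inP E0; case: (H S) => [e /E0/eqP//|->|->]; first by rewrite eqxx.
by rewrite eqxx orbT.
Qed.

Lemma econnT : econn [set: E]%SET = conn p q.
Proof.
by apply/econnP/connP => H S SE; apply: H => e *; apply: SE; rewrite ?inE.
Qed.

Lemma econn_const (T : eqType) (y : V -> T) A : econn A ->
  (forall e, e \in A -> y (p e) = y (q e)) -> forall u v, y u = y v.
Proof.
move=> /econnP H yE u v.
have [e eA|S0|ST] := H [set x | y x == y v]%SET; first by rewrite !inE yE.
  by have := finset.in_set0 v; rewrite -S0 inE eqxx.
by have := finset.in_setT u; rewrite -ST inE => /eqP.
Qed.

(** For a spanning tree [A], the sets [C e] are its fundamental cuts, each containing the source of
    its edge. *)
Definition has_cuts A (C : E -> {set V}) : Prop :=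
  forall e e', e \in A -> e' \in A ->
    (p e' \in C e)%:R - (q e' \in C e)%:R = (e' == e)%:R :> rat.

(** The combination [z] of indicators of cuts has the same jumps as [y] along all edges of [A],
    hence differs from [y] by a constant, which pairs to 0 with [b]. *)
Lemma cut_flow A C b (y : V -> rat) : econn A -> has_cuts A C -> \sum_v b v = 0 ->
  \sum_v y v * b v = \sum_(e in A) (y (p e) - y (q e)) * bsum b (C e).
Proof.
move=> cA AC b0; pose z v := \sum_(e in A) (y (p e) - y (q e)) * (v \in C e)%:R.
have zE e : e \in A -> z (p e) - z (q e) = y (p e) - y (q e).
  move=> eA; rewrite /z -sumrB (bigD1 e) //= -mulrBr AC // eqxx mulr1.
  rewrite big1 ?addr0 // => e' /andP[e'A ee'].
  by rewrite -mulrBr AC // eq_sym (negPf ee') mulr0.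
have yz u v : y u - z u = y v - z v.
  apply: (econn_const (y := fun v => y v - z v) cA) => e eA.
  by have := zE e eA; move: (z _) (z _) (y _) (y _) => *; lra.
transitivity (\sum_v z v * b v).
  case: (pickP [pred v : V | true]) => [v0 _|V0]; last by rewrite !big1 // => v; have := V0 v.
  transitivity (\sum_v (z v * b v + (y v0 - z v0) * b v)).
    by apply: eq_bigr => v _; rewrite -(yz v v0); ring.
  by rewrite big_split /= -mulr_sumr b0 mulr0 addr0.
under eq_bigr => v _ do rewrite /z mulr_suml.
rewrite exchange_big; apply: eq_bigr => e _ /=.
by rewrite bsumE mulr_sumr; apply: eq_bigr => v _; rewrite mulrA.
Qed.

End EdgeSets.

Section TreeFlow.
Variables (E V : finType) (p q : E -> V).
Hypotheses (cn : conn p q) (cV : #|V| = #|E|.+1).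

Definition tcut e : {set V} := xchoose (tree_cut cn cV e).

Lemma tcutP e : is_cut p q e (tcut e).
Proof. exact: (xchooseP (tree_cut cn cV e)). Qed.

Lemma is_cut_diff e S e' : is_cut p q e S ->
  (p e' \in S)%:R - (q e' \in S)%:R = (e' == e)%:R :> rat.
Proof.
case/and3P => pe qe /forallP H; case: (eqVneq e' e) => [->|ee'].
  by rewrite pe (negPf qe) subr0.
by have /implyP/(_ ee')/eqP-> := H e'; rewrite subrr.
Qed.

Lemma tree_flow (b y : V -> rat) : \sum_v b v = 0 ->
  \sum_v y v * b v = \sum_e (y (p e) - y (q e)) * bsum b (tcut e).
Proof.
move=> b0; have cT : econn p q [set: E]%SET by rewrite econnT.
rewrite (cut_flow (C := tcut) y cT _ b0) => [|e e' _ _]; last exact: is_cut_diff (tcutP e).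
by apply: eq_bigl => e; rewrite inE.
Qed.

Lemma tree_flow_set (b : V -> rat) S : \sum_v b v = 0 ->
  bsum b S = \sum_e ((p e \in S)%:R - (q e \in S)%:R) * bsum b (tcut e).
Proof. by move=> b0; rewrite bsumE (tree_flow _ b0). Qed.

Lemma bsum_cut (b : V -> rat) e S : \sum_v b v = 0 -> is_cut p q e S ->
  bsum b S = bsum b (tcut e).
Proof.
move=> b0 cS; rewrite (tree_flow_set _ b0) (bigD1 e) //= (is_cut_diff _ cS) eqxx mul1r.
by rewrite big1 ?addr0 // => e' /negPf ee'; rewrite (is_cut_diff _ cS) ee' mul0r.
Qed.

End TreeFlow.

Fixpoint rising (a m : nat) : nat := if m is m'.+1 then (a * rising a.+1 m')%N else 1%N.

(* Inserting the ends of the edges [z] of [Z] at the vertices of the blocks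
   [beta z]. *)
Section RisingFactorials.
Variables (n : nat) (I B : finType) (r : I -> B).
Implicit Types (f : {ffun 'I_n -> I}) (Z : {set 'I_n}).

Definition degout Z f (i : I) : nat := #|[set e | (e \notin Z) && (f e == i)]%SET|.

Definition extends Z (beta : 'I_n -> B) f0 f : bool :=
  [forall e, if e \in Z then r (f e) == beta e else f e == f0 e].

Lemma degoutD1 Z z (f : {ffun 'I_n -> I}) i : z \in Z ->
  degout (Z :\ z)%SET f i = (degout Z f i + (f z == i))%N.
Proof.
move=> zZ; rewrite /degout (cardsD1 z) !inE eqxx /= addnC; congr (_ + _)%N.
apply: eq_card => e; rewrite !inE negb_and negbK.
by case: (eqVneq e z) => [->|]; rewrite ?zZ.
Qed.

(** The ends are inserted one after another. Attaching [z] at [i] multiplies the factorial at [i] by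
    its current degree, and the sum over [i] in the block is the number of ends already there, which
    then grows by one. *)
Lemma sum_rising Z beta f0 : (forall i, 0 < degout Z f0 i)%N ->
  (\sum_(f | extends Z beta f0 f) \prod_i (degout finset.set0 f i).-1`! =
   (\prod_i (degout Z f0 i).-1`!) *
   \prod_c rising #|[set e | (e \notin Z) && (r (f0 e) == c)]| #|[set e in Z | beta e == c]|)%N.
Proof.
have [m] := ubnP #|Z|; elim: m => // m IH in Z f0 *; rewrite ltnS => Zm a0.
have [Z0|[z zZ]] := set_0Vmem Z.
  rewrite (big_pred1 f0) => [|f]; last first.
    apply/forallP/eqP => [H|-> e]; last by rewrite Z0 inE.
    by apply/ffunP => e; have := H e; rewrite Z0 inE => /eqP.
  rewrite -{1}Z0 [X in (_ * X)%N]big1 ?muln1 // => c _.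
  rewrite (_ : [set e in Z | beta e == c]%SET = finset.set0) ?cards0 //.
  by apply/setP => e; rewrite Z0 !inE.
pose upd i : {ffun 'I_n -> I} := [ffun e => if e == z then i else f0 e].
have degu i k : degout (Z :\ z)%SET (upd i) k = (degout Z f0 k + (i == k))%N.
  rewrite degoutD1 // ffunE eqxx; congr (_ + _)%N; apply: eq_card => e.
  rewrite !inE ffunE; case: (eqVneq e z) => [->|//]; by rewrite zZ.
have ext f : extends Z beta f0 f = (r (f z) == beta z) && extends (Z :\ z)%SET beta (upd (f z)) f.
  apply/forallP/andP => [H|[H1 /forallP H2] e].
    split; first by have := H z; rewrite zZ.
    apply/forallP => e; have := H e; rewrite !inE ffunE.
    by case: (eqVneq e z) => [->|_] /=; rewrite ?eqxx.
  have := H2 e; rewrite !inE ffunE; case: (eqVneq e z) => [->|//]; by rewrite zZ H1.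
rewrite (partition_big (fun f => f z) (fun i => r i == beta z)) /=; last first.
  by move=> f; rewrite ext => /andP[].
transitivity (\sum_(i | r i == beta z) \sum_(f | extends (Z :\ z)%SET beta (upd i) f)
    \prod_k (degout finset.set0 f k).-1`!)%N.
  apply: eq_bigr => i ri; apply: eq_bigl => f; rewrite ext.
  apply/andP/idP => [[/andP[_ H] /eqP fz]|H]; first by rewrite -fz.
  have /eqP fz : f z == i.
    by have /forallP/(_ z) := H; rewrite !inE eqxx /= ffunE eqxx.
  by rewrite fz ri H eqxx.
pose A c := #|[set e | (e \notin Z) && (r (f0 e) == c)]|.
pose N c := #|[set e in Z | beta e == c]|.
have NE c : N c = ((beta z == c) + #|[set e in (Z :\ z)%SET | beta e == c]|)%N.
  rewrite /N (cardsD1 z) !inE zZ /=; congr (_ + _)%N.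
  by apply: eq_card => e; rewrite !inE andbA.
have AE i c : r i = beta z ->
    #|[set e | (e \notin (Z :\ z)%SET) && (r (upd i e) == c)]| = ((beta z == c) + A c)%N.
  move=> ri; rewrite (cardsD1 z) !inE eqxx /= ffunE eqxx ri; congr (_ + _)%N.
  apply: eq_card => e; rewrite !inE ffunE; case: (eqVneq e z) => [->|//]; by rewrite zZ.
transitivity (\sum_(i | r i == beta z) (degout Z f0 i * ((\prod_k (degout Z f0 k).-1`!) *
   (rising (A (beta z)).+1 (N (beta z)).-1 * \prod_(c | c != beta z) rising (A c) (N c)))))%N.
  apply: eq_bigr => i /eqP ri; rewrite IH; last 2 first.
  - by move: Zm; rewrite (cardsD1 z Z) zZ add1n.
  - by move=> k; rewrite degu addn_gt0 a0.
  rewrite mulnA; congr (_ * _)%N.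
    rewrite (bigD1 i) //= [in RHS](bigD1 i) //= mulnA; congr (_ * _)%N.
      rewrite degu eqxx addn1 /=; case: (degout Z f0 i) (a0 i) => // d _.
    by apply: eq_bigr => k; rewrite eq_sym => /negPf ki; rewrite degu ki addn0.
  rewrite (bigD1 (beta z)) //=; congr (_ * _)%N.
    by rewrite AE // eqxx add1n NE eqxx.
  apply: eq_bigr => c; rewrite eq_sym => /negPf cz.
  by rewrite AE // NE cz.
rewrite -big_distrl /=.
have -> : (\sum_(i | r i == beta z) degout Z f0 i = A (beta z))%N.
  rewrite /A -sum1_card (partition_big f0 (fun i => r i == beta z)) /=; last first.
    by move=> e; rewrite inE => /andP[].
  apply: eq_bigr => i /eqP ri; rewrite /degout -sum1_card; apply: eq_bigl => e.
  rewrite !inE; case: (eqVneq (f0 e) i) => [->|]; rewrite ?andbF // ri eqxx !andbT //.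
rewrite mulnCA; congr (_ * _)%N; rewrite [RHS](bigD1 (beta z)) //= mulnA.
by congr (_ * _)%N; rewrite -/(A _) -/(N _) NE eqxx.
Qed.

End RisingFactorials.

(** * Crossing a wall by reversing edges *)

Section Reversal.
Variables (n : nat) (I J : finType).
Hypothesis cIJ : (#|I| + #|J| = n.+1)%N.
Notation V := (I + J)%type.
Implicit Types (s : {ffun 'I_n -> I * J}) (S : {set V}) (Z : {set 'I_n}) (x y : V).

Lemma card_vertices : #|{: V}| = #|{: 'I_n}|.+1.
Proof. by rewrite card_sum card_ord. Qed.

Definition tree_count (P : pred {set V}) : nat :=
  (\sum_(s : {ffun 'I_n -> I * J} | conn (bend s) (wend s) &&
     [forall e, forall S, is_cut (bend s) (wend s) e S ==> P S]) cfact s)%N.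

Variables (b0 w : V -> rat).
Hypotheses (b0I : forall i, 0 < b0 (inl i)) (b0J : forall j, b0 (inr j) < 0).
Hypotheses (b00 : \sum_v b0 v = 0) (w00 : \sum_v w v = 0).

(** Positivity of the sum over [S] of [b0 + t w], or of [b0 - t w] when [sg] holds, for all small
    [t > 0]. *)
Definition lexpos (sg : bool) S : bool :=
  (0 < bsum b0 S) || ((bsum b0 S == 0) && (0 < (-1) ^+ sg * bsum w S)).

Definition sat s Z S : bool :=
  [forall e, (e \notin Z) ==> ((bend s e \in S) == (wend s e \in S))].

(** The connected component of [x] once the edges of [Z] are removed. *)
Definition blk s Z x : {set V} := [set y | [forall S, sat s Z S && (x \in S) ==> (y \in S)]]%SET.

Lemma blk_sat s Z S x y : sat s Z S -> blk s Z x = blk s Z y -> (x \in S) = (y \in S).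
Proof.
move=> sS E; have xx z : z \in blk s Z z.
  by rewrite inE; apply/forallP => T; apply/implyP => /andP[].
have H z z' : z' \in blk s Z z -> z \in S -> z' \in S.
  by rewrite inE => /forallP/(_ S)/implyP H zS; apply: H; rewrite sS.
by apply/idP/idP; apply: H; rewrite ?E // -E.
Qed.

Lemma blk_edge s Z e : e \notin Z -> blk s Z (bend s e) = blk s Z (wend s e).
Proof.
move=> eZ; apply/setP => y; rewrite !inE; apply: eq_forallb => S.
by case: (boolP (sat s Z S)) => //= /forallP/(_ e)/implyP/(_ eZ)/eqP->.
Qed.

Lemma sat_agree s s' Z : (forall e, e \notin Z -> s' e = s e) -> sat s' Z =1 sat s Z.
Proof.
move=> H S; apply: eq_forallb => e; case: (boolP (e \in Z)) => //= eZ.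
by rewrite /bend /wend H.
Qed.

Lemma blk_agree s s' Z : (forall e, e \notin Z -> s' e = s e) -> blk s' Z =1 blk s Z.
Proof.
by move=> H x; apply/setP => y; rewrite !inE; apply: eq_forallb => S; rewrite (sat_agree H).
Qed.

(** Says that [s] is a tree whose cuts are all [lexpos sg], and records as [Z] the edges with zero
    cut sum at [b0]. *)
Definition cond s Z (sg : bool) : bool :=
  [&& conn (bend s) (wend s),
    [forall e, forall S, (e \notin Z) && is_cut (bend s) (wend s) e S ==> (0 < bsum b0 S)] &
    [forall e, forall S, (e \in Z) && is_cut (bend s) (wend s) e S ==>
        (bsum b0 S == 0) && (0 < (-1) ^+ sg * bsum w S)]].

Lemma condP s Z (sg : bool) : reflect
  [/\ conn (bend s) (wend s),
     forall e S, e \notin Z -> is_cut (bend s) (wend s) e S -> 0 < bsum b0 S,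
     forall e S, e \in Z -> is_cut (bend s) (wend s) e S -> bsum b0 S = 0 &
     forall e S, e \in Z -> is_cut (bend s) (wend s) e S -> 0 < (-1) ^+ sg * bsum w S]
  (cond s Z sg).
Proof.
apply: (iffP and3P) => [[cn H1 H2]|[cn H1 H2 H3]]; split=> //.
- by move=> e S eZ cS; have /forallP/(_ S)/implyP := forallP H1 e; rewrite eZ cS; apply.
- move=> e S eZ cS; have /forallP/(_ S)/implyP := forallP H2 e; rewrite eZ cS.
  by case/(_ isT)/andP => /eqP.
- move=> e S eZ cS; have /forallP/(_ S)/implyP := forallP H2 e; rewrite eZ cS.
  by case/(_ isT)/andP.
- apply/forallP => e; apply/forallP => S; apply/implyP => /andP[eZ cS]; exact: H1 eZ cS.
- apply/forallP => e; apply/forallP => S; apply/implyP => /andP[eZ cS].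
  by rewrite (H2 _ _ eZ cS) eqxx (H3 _ _ eZ cS).
Qed.

(** The edges of [Z] are reattached anywhere inside the blocks of their ends; with [sg] the blocks
    of the black and of the white end are exchanged. *)
Definition related (sg : bool) Z s s' : Prop :=
  (forall e, e \notin Z -> s' e = s e) /\
  (forall z, z \in Z -> blk s Z (bend s' z) = blk s Z (if sg then wend s z else bend s z) /\
                        blk s Z (wend s' z) = blk s Z (if sg then bend s z else wend s z)).

Lemma is_cut_sat s Z z S : z \in Z -> is_cut (bend s) (wend s) z S -> sat s Z S.
Proof.
move=> zZ /and3P[_ _ /forallP H]; apply/forallP => e; apply/implyP => eZ.
by have /implyP := H e; apply; apply: contraNneq eZ => ->.
Qed.

(** Contracting the blocks leaves a tree with edge set [Z]. Its cuts survive a move of the ends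
    inside the blocks and are complemented by a reversal, which changes the sign of the sums of [w].
    The other cuts keep their [b0]-sums, since the edges of [Z] carry no flow of [b0]. *)
Lemma cond_related (sg sg' : bool) Z s s' : cond s Z sg' -> related sg Z s s' -> cond s' Z (sg' (+) sg).
Proof.
case/condP => cn c1 c2 c3 [r1 r2].
have satE := sat_agree r1.
have ends S z : sat s Z S -> z \in Z ->
    ((bend s' z \in S) = ((if sg then wend s z else bend s z) \in S)) *
    ((wend s' z \in S) = ((if sg then bend s z else wend s z) \in S)).
  by move=> sS zZ; have [E1 E2] := r2 _ zZ; split; [exact: blk_sat sS E1|exact: blk_sat sS E2].
have cut0 z : z \in Z -> bsum b0 (tcut cn card_vertices z) = 0.
  by move=> zZ; apply: c2 zZ (tcutP _ _ _).
apply/condP; split.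
- apply/connP => S SE; apply: (connP _ _ cn) => e.
  have sS : sat s Z S by rewrite -satE; apply/forallP => e'; rewrite SE eqxx implybT.
  have [eZ|eZ] := boolP (e \in Z); last by have := SE e; rewrite /bend /wend r1.
  by have := SE e; rewrite !ends //; case: sg {r2 ends}.
- move=> e S eZ cS; rewrite (tree_flow_set cn card_vertices S b00) (bigD1 e) //=.
  have dE e' : e' \notin Z ->
      (bend s e' \in S)%:R - (wend s e' \in S)%:R = (e' == e)%:R :> rat.
    by move=> e'Z; rewrite -(is_cut_diff e' cS) /bend /wend r1.
  rewrite dE // eqxx mul1r big1 ?addr0 => [|e' ee'].
    exact: c1 eZ (tcutP _ _ _).
  have [e'Z|e'Z] := boolP (e' \in Z); first by rewrite cut0 ?mulr0.
  by rewrite dE // (negPf ee') mul0r.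
- move=> z S zZ cS; have sS : sat s Z S by rewrite -satE; exact: is_cut_sat cS.
  rewrite (tree_flow_set cn card_vertices S b00) big1 // => e _.
  have [eZ|eZ] := boolP (e \in Z); first by rewrite cut0 ?mulr0.
  by have /forallP/(_ e)/implyP/(_ eZ)/eqP-> := sS; rewrite subrr mul0r.
- move=> z S zZ cS; have sS : sat s Z S by rewrite -satE; exact: is_cut_sat cS.
  have /and3P[pz qz /forallP oth] := cS.
  have edge e : e != z -> (bend s e \in S) = (wend s e \in S).
    move=> ez; have [eZ|eZ] := boolP (e \in Z).
      have /implyP/(_ ez)/eqP := oth e; rewrite !ends //.
      by case: sg {r2 ends}.
    by have /forallP/(_ e)/implyP/(_ eZ)/eqP := sS.
  move: pz qz; rewrite !ends //; case: sg {r2 ends} => pz qz; last first.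
    rewrite addbF; apply: c3 zZ _; rewrite /is_cut pz qz /=.
    by apply/forallP => e; apply/implyP => /edge->.
  have : is_cut (bend s) (wend s) z (~: S)%SET.
    rewrite /is_cut !inE pz qz /=; apply/forallP => e; apply/implyP => /edge E.
    by rewrite !inE E.
  move/(c3 _ _ zZ); rewrite bsumC // mulrN -mulNr addbT signrN.
  by [].
Qed.

(** Turns [related] into an equality of keys, up to [swapk], so that sums can be partitioned by
    key. *)
Definition bkey Z s : {ffun 'I_n -> option (I * J)} * {ffun 'I_n -> {set V} * {set V}} :=
  ([ffun e => if e \in Z then None else Some (s e)],
   [ffun e => if e \in Z then (blk s Z (bend s e), blk s Z (wend s e))
              else (finset.set0, finset.set0)]).

Definition swapk (sg : bool) (k : {ffun 'I_n -> option (I * J)} * {ffun 'I_n -> {set V} * {set V}}) :=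
  (k.1, [ffun e => if sg then ((k.2 e).2, (k.2 e).1) else k.2 e]).

Lemma bkeyP (sg : bool) Z s s' : (bkey Z s' = swapk sg (bkey Z s)) <-> related sg Z s s'.
Proof.
split=> [[/ffunP E1 /ffunP E2]|[r1 r2]].
  have r1 e : e \notin Z -> s' e = s e.
    by move=> eZ; have := E1 e; rewrite !ffunE (negPf eZ) => -[].
  split=> // z zZ; have := E2 z; rewrite !ffunE zZ !(blk_agree r1).
  by case: sg {E1 E2} => /= -[-> ->].
congr pair; apply/ffunP => e; rewrite !ffunE.
  by case: ifP => // /negbT/r1->.
rewrite !(blk_agree r1); case: (boolP (e \in Z)) => [/r2[-> ->]|_]; case: sg {r2} => //.
Qed.

(** The black and the white ends of [Z] are inserted independently, each giving a product over
    blocks by [sum_rising]. Reversal exchanges the two numbers of ends to insert in each block, and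
    the starting number [A c] is common to both colours. *)
Lemma sum_related (sg : bool) Z s : cond s Z false \/ cond s Z true ->
  (\sum_(s' | bkey Z s' == swapk sg (bkey Z s)) cfact s' =
   \sum_(s' | bkey Z s' == swapk false (bkey Z s)) cfact s')%N.
Proof.
move=> cs.
have {cs}[cn c2] : conn (bend s) (wend s) /\
    forall e S, e \in Z -> is_cut (bend s) (wend s) e S -> bsum b0 S = 0.
  by case: cs => /condP[].
have cut0 z : z \in Z -> bsum b0 (tcut cn card_vertices z) = 0.
  by move=> zZ; apply: c2 zZ (tcutP _ _ _).
have sat0 S : sat s Z S -> bsum b0 S = 0.
  move=> sS; rewrite (tree_flow_set cn card_vertices S b00) big1 // => e _.
  have [eZ|eZ] := boolP (e \in Z); first by rewrite cut0 ?mulr0.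
  by have /forallP/(_ e)/implyP/(_ eZ)/eqP-> := sS; rewrite subrr mul0r.
pose f0 : {ffun 'I_n -> I} := [ffun e => (s e).1].
pose h0 : {ffun 'I_n -> J} := [ffun e => (s e).2].
(* A vertex all of whose edges lie in [Z] would be a block by itself, where [b0] would vanish,
   against its strict sign. *)
have a0 i : (0 < degout Z f0 i)%N.
  rewrite lt0n; apply/negP => /eqP/cards0_eq/setP H.
  have : sat s Z [set inl i]%SET.
    apply/forallP => e; apply/implyP => eZ; rewrite !inE /bend /wend.
    by have := H e; rewrite !inE eZ ffunE => /= E; rewrite -[inl _ == inl i]/((s e).1 == i) E.
  by move/sat0; rewrite /bsum big_set1 => E; have := b0I i; rewrite E ltxx.
have a0' j : (0 < degout Z h0 j)%N.
  rewrite lt0n; apply/negP => /eqP/cards0_eq/setP H.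
  have : sat s Z [set inr j]%SET.
    apply/forallP => e; apply/implyP => eZ; rewrite !inE /bend /wend.
    by have := H e; rewrite !inE eZ ffunE => /= E; rewrite -[inr _ == inr j]/((s e).2 == j) E.
  by move/sat0; rewrite /bsum big_set1 => E; have := b0J j; rewrite E ltxx.
pose b1 sg e := blk s Z (if sg then wend s e else bend s e).
pose r1 (i : I) := blk s Z (inl i); pose r2 (j : J) := blk s Z (inr j).
pose A c := #|[set e | (e \notin Z) && (r1 (f0 e) == c)]%SET|.
pose N sg c := #|[set e in Z | b1 sg e == c]%SET|.
(* An edge outside [Z] stays within one block and gives it one black and one white corner. *)
have AE c : #|[set e | (e \notin Z) && (r2 (h0 e) == c)]%SET| = A c.
  apply: eq_card => e; rewrite !inE; case: (boolP (e \in Z)) => //= eZ.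
  by rewrite /r1 /r2 !ffunE -[inl _]/(bend s e) -[inr _]/(wend s e) blk_edge.
suff H sg1 : (\sum_(s' | bkey Z s' == swapk sg1 (bkey Z s)) cfact s' =
    ((\prod_i (degout Z f0 i).-1`!) * \prod_c rising (A c) (N sg1 c)) *
    ((\prod_j (degout Z h0 j).-1`!) * \prod_c rising (A c) (N (~~ sg1) c)))%N.
  by rewrite !H; case: sg => //=; rewrite mulnACA [RHS]mulnACA; congr (_ * _)%N; rewrite mulnC.
have S1 := @sum_rising _ _ _ r1 Z (b1 sg1) f0 a0.
have S2 := @sum_rising _ _ _ r2 Z (b1 (~~ sg1)) h0 a0'.
transitivity ((\sum_(f | extends r1 Z (b1 sg1) f0 f) \prod_i (degout finset.set0 f i).-1`!) *
  (\sum_(h | extends r2 Z (b1 (~~ sg1)) h0 h) \prod_j (degout finset.set0 h j).-1`!))%N; last first.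
  rewrite S1 S2; congr (_ * (_ * _))%N.
  by apply: eq_bigr => c _; rewrite AE.
rewrite big_distrlr /= pair_big /=.
rewrite (reindex (fun p : {ffun 'I_n -> I} * {ffun 'I_n -> J} =>
   [ffun e => (p.1 e, p.2 e)] : {ffun 'I_n -> I * J})) /=; last first.
  exists (fun s' : {ffun 'I_n -> I * J} => ([ffun e => (s' e).1], [ffun e => (s' e).2])).
    by move=> [f h] _ /=; congr pair; apply/ffunP => e; rewrite !ffunE.
  by move=> s' _; apply/ffunP => e; rewrite !ffunE -surjective_pairing.
apply: eq_big => [[f h]|[f h] _] /=; last first.
  rewrite /cfact; congr (_ * _)%N; apply: eq_bigr => v _; congr (_.-1`!);
  by apply: eq_card => e; rewrite !inE ffunE.
apply/eqP/andP.
  case/bkeyP => [q1 q2]; split; apply/forallP => e.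
    case: ifP => [eZ|/negbT eZ]; last by have := q1 e eZ; rewrite !ffunE => <- /=.
    by have [E _] := q2 e eZ; rewrite /r1 /b1 -E /bend ffunE.
  case: ifP => [eZ|/negbT eZ]; last by have := q1 e eZ; rewrite !ffunE => <- /=.
  have [_ E] := q2 e eZ; rewrite /r2 /b1.
  have -> : (if ~~ sg1 then wend s e else bend s e) = (if sg1 then bend s e else wend s e).
    by case: (sg1).
  by rewrite -E /wend ffunE.
case=> /forallP q1 /forallP q2; apply/bkeyP; split=> [e eZ|z zZ].
  have := q1 e; have := q2 e; rewrite (negPf eZ) !ffunE => /eqP-> /eqP->.
  by rewrite -surjective_pairing.
have := q1 z; have := q2 z; rewrite zZ /bend /wend !ffunE /= => /eqP E2 /eqP E1.
rewrite -[blk s Z (inl _)]/(r1 (f z)) -[blk s Z (inr (h z))]/(r2 (h z)) E1 E2 /b1.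
by case: (sg1).
Qed.

Lemma swapkK k : swapk true (swapk true k) = k.
Proof.
case: k => a b; rewrite /swapk /=; congr pair; apply/ffunP => e.
by rewrite !ffunE -surjective_pairing.
Qed.

Lemma swapk_false k : swapk false k = k.
Proof. by case: k => a b; congr pair; apply/ffunP => e; rewrite !ffunE. Qed.

Lemma sum_cond_fiber Z (sg : bool) s1 : cond s1 Z sg ->
  (\sum_(s | bkey Z s == bkey Z s1) cfact s * cond s Z sg =
   \sum_(s | bkey Z s == swapk true (bkey Z s1)) cfact s * cond s Z (~~ sg))%N.
Proof.
move=> c1.
transitivity (\sum_(s | bkey Z s == swapk false (bkey Z s1)) cfact s)%N.
  rewrite swapk_false; apply: eq_bigr => s; rewrite -[X in _ == X]swapk_false => /eqP/bkeyP r.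
  by have := cond_related c1 r; rewrite addbF => ->; rewrite muln1.
rewrite -(@sum_related true); last by case: sg c1; [right|left].
apply: eq_bigr => s /eqP/bkeyP r.
by have := cond_related c1 r; rewrite addbT => ->; rewrite muln1.
Qed.

Lemma sum_cond Z (sg : bool) :
  (\sum_s cfact s * cond s Z sg = \sum_s cfact s * cond s Z (~~ sg))%N.
Proof.
rewrite (partition_big (bkey Z) xpredT) //= [RHS](partition_big (bkey Z) xpredT) //=.
rewrite [RHS](reindex_inj (inv_inj swapkK)); apply: eq_bigr => k _.
have [/existsP[s1 /andP[/eqP <- c1]]|H1] :=
    boolP [exists s1, (bkey Z s1 == k) && cond s1 Z sg].
  exact: sum_cond_fiber.
have [/existsP[s1 /andP[/eqP E c1]]|H2] :=
    boolP [exists s1, (bkey Z s1 == swapk true k) && cond s1 Z (~~ sg)].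
  by rewrite -E (sum_cond_fiber c1) E swapkK negbK.
rewrite !big1 // => s /eqP E; [move: H2|move: H1]; rewrite negb_exists => /forallP/(_ s).
  by rewrite E eqxx /= => /negPf->; rewrite muln0.
by rewrite E eqxx /= => /negPf->; rewrite muln0.
Qed.

(** For a given tree only one [Z] can satisfy [cond], namely the set [Z0] of edges whose cut sum
    vanishes at [b0]. *)
Lemma tree_count_lexpos sg :
  tree_count (lexpos sg) = (\sum_(Z : {set 'I_n}) \sum_s cfact s * cond s Z sg)%N.
Proof.
rewrite exchange_big /tree_count big_mkcond; apply: eq_bigr => s _ /=.
rewrite -big_distrr /=.
pose Z0 := [set e | [exists S, is_cut (bend s) (wend s) e S && (bsum b0 S == 0)]]%SET.
have ZZ0 Z : cond s Z sg -> Z = Z0.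
  case/condP => cn c1 c2 c3; apply/setP => e; rewrite inE; apply/idP/existsP.
    move=> eZ; exists (tcut cn card_vertices e); rewrite tcutP /=.
    by rewrite (c2 _ _ eZ (tcutP _ _ _)).
  case=> S /andP[cS /eqP S0]; apply: contraT => eZ.
  by have := c1 _ _ eZ cS; rewrite S0 ltxx.
rewrite (bigD1 Z0) //= big1 ?addn0 => [|Z ZN]; last first.
  by case: (boolP (cond s Z sg)) => // /ZZ0 E; rewrite E eqxx in ZN.
set c := (X in if X then _ else _); have -> : cond s Z0 sg = c; last first.
  by case: c; rewrite ?muln1 ?muln0.
apply/condP/andP => [[cn c1 c2 c3]|[cn /forallP H]].
  split=> //; apply/forallP => e; apply/forallP => S; apply/implyP => cS.
  have [eZ|eZ] := boolP (e \in Z0); last by rewrite /lexpos (c1 _ _ eZ cS).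
  by rewrite /lexpos (c2 _ _ eZ cS) (c3 _ _ eZ cS) eqxx orbT.
have lp e S : is_cut (bend s) (wend s) e S -> lexpos sg S.
  by move=> cS; have /forallP/(_ S)/implyP := H e; apply.
have z0 e S : e \in Z0 -> is_cut (bend s) (wend s) e S -> bsum b0 S = 0.
  rewrite inE => /existsP[S' /andP[cS' /eqP S'0]] cS.
  by rewrite (bsum_cut cn card_vertices b00 cS) -(bsum_cut cn card_vertices b00 cS').
split=> // [e S eZ cS|e S eZ cS].
  have := lp _ _ cS; case/orP => // /andP[S0 _].
  by case/negP: eZ; rewrite inE; apply/existsP; exists S; rewrite cS.
by have := lp _ _ cS; rewrite /lexpos (z0 _ _ eZ cS) ltxx eqxx.
Qed.

Lemma tree_count_reverse : tree_count (lexpos true) = tree_count (lexpos false).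
Proof. by rewrite !tree_count_lexpos; apply: eq_bigr => Z _; rewrite sum_cond. Qed.

End Reversal.

Lemma eq_tree_count (n : nat) (I J : finType) (P Q : pred {set I + J}) : P =1 Q ->
  tree_count n P = tree_count n Q.
Proof.
move=> E; apply: eq_bigl => s; congr (_ && _).
by apply: eq_forallb => e; apply: eq_forallb => S; rewrite E.
Qed.

(** * Constancy of the tree count along a segment *)

Section Path.
Variables (n : nat) (I J : finType).
Hypothesis cIJ : (#|I| + #|J| = n.+1)%N.
Notation V := (I + J)%type.

Definition balanced_vec (b : V -> rat) : Prop :=
  [/\ forall i, 0 < b (inl i), forall j, b (inr j) < 0 & \sum_v b v = 0].

Definition line (b c : V -> rat) (t : rat) v : rat := b v + t * (c v - b v).

Lemma bsum_line b c t S : bsum (line b c t) S = bsum b S + t * (bsum c S - bsum b S).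
Proof. by rewrite /bsum big_split /= -mulr_sumr sumrB. Qed.

Lemma line_balanced b c t : balanced_vec b -> balanced_vec c -> 0 <= t <= 1 ->
  balanced_vec (line b c t).
Proof.
move=> [b1 b2 b3] [c1 c2 c3] /andP[t0 t1]; split.
- by move=> i; have := b1 i; have := c1 i; rewrite /line => h1 h2; nra.
- by move=> j; have := b2 j; have := c2 j; rewrite /line => h1 h2; nra.
- by rewrite -bsumT bsum_line !bsumT b3 c3; lra.
Qed.

Lemma line_pos (x y t : rat) : y < 0 < x -> (0 < x + t * (y - x)) = (t < x / (x - y)).
Proof.
case/andP => y0 x0; rewrite ltr_pdivlMr; last by lra.
by apply/idP/idP; lra.
Qed.

Lemma line_neg (x y t : rat) : x < 0 < y -> (0 < x + t * (y - x)) = (x / (x - y) < t).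
Proof.
case/andP => x0 y0; rewrite ltr_ndivrMr; last by lra.
by apply/idP/idP; lra.
Qed.

Lemma mul_lt0_pos (x y : rat) : x * y < 0 -> 0 < x -> y < 0 < x.
Proof. by move=> h hx; rewrite hx andbT -(pmulr_rlt0 _ hx). Qed.

Lemma mul_lt0_neg (x y : rat) : x * y < 0 -> x <= 0 -> x < 0 < y.
Proof.
move=> h; rewrite le_eqVlt => /orP[/eqP x0|hx]; first by rewrite x0 mul0r ltxx in h.
by rewrite hx -(nmulr_rlt0 _ hx).
Qed.

Lemma same_sign (x y : rat) : 0 <= x * y -> (x == 0) = (y == 0) -> (0 < x) = (0 < y).
Proof.
move=> h; case: (ltrgtP x 0) => hx; case: (ltrgtP y 0) => hy //; rewrite ?hx ?hy ?eqxx //; nra.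
Qed.

Lemma line_same_sign (x y t : rat) : 0 <= x * y -> (x == 0) = (y == 0) -> 0 <= t <= 1 ->
  (0 < x + t * (y - x)) = (0 < x) /\ (x + t * (y - x) == 0) = (x == 0).
Proof.
move=> h xy /andP[t0 t1]; case: (ltrgtP x 0) => hx.
- have hy : y < 0.
    by rewrite lt_neqAle -xy (lt_eqF hx) /= -(nmulr_rge0 _ hx).
  have hz : x + t * (y - x) < 0.
    have : (1 - t) * x <= 0 by rewrite mulr_ge0_le0 ?subr_ge0 // ltW.
    have : t * y <= 0 by rewrite mulr_ge0_le0 // ltW.
    have [->|tn1 h1 h2] := eqVneq t 1; first by lra.
    have : (1 - t) * x < 0 by rewrite pmulr_rlt0 // subr_gt0 lt_neqAle tn1.
    by lra.
  by rewrite (lt_eqF hz) lt_gtF.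
- have hy : 0 < y.
    by rewrite lt_neqAle eq_sym -xy (gt_eqF hx) /= -(pmulr_rge0 _ hx).
  have hz : 0 < x + t * (y - x).
    have : 0 <= (1 - t) * x by rewrite mulr_ge0 ?subr_ge0 // ltW.
    have : 0 <= t * y by rewrite mulr_ge0 // ltW.
    have [->|tn1 h1 h2] := eqVneq t 1; first by lra.
    have : 0 < (1 - t) * x by rewrite pmulr_rgt0 // subr_gt0 lt_neqAle tn1.
    by lra.
  by rewrite (gt_eqF hz) hz.
- have y0 : y = 0 by apply/eqP; rewrite -xy hx.
  by rewrite hx y0 subrr mulr0 addr0 ltxx eqxx.
Qed.

Lemma crit_01 (x y : rat) : x * y < 0 -> 0 < x / (x - y) < 1.
Proof.
move=> h; case: (ltrgtP x 0) => hx; last by rewrite hx mul0r ltxx in h.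
- by have hy : 0 < y by [nra]; rewrite ltr_ndivlMr ?ltr_ndivrMr; lra.
- by have hy : y < 0 by [nra]; rewrite ltr_pdivlMr ?ltr_pdivrMr; lra.
Qed.

(* Moving along a segment, the sign of a cut sum changes only when passing the
   point [crit S]; all the cut sums vanishing there change sign together. *)
Lemma tree_count_const (b c : V -> rat) : balanced_vec b -> balanced_vec c ->
  (forall S, (bsum b S == 0) = (bsum c S == 0)) ->
  tree_count n (fun S => 0 < bsum b S) = tree_count n (fun S => 0 < bsum c S).
Proof.
have [m] := ubnP #|[set S | bsum b S * bsum c S < 0]%SET|.
elim: m => // m IH in b *; rewrite ltnS => bm bb bc zz.
pose X := [set S | bsum b S * bsum c S < 0]%SET.
pose crit S := bsum b S / (bsum b S - bsum c S).
have [X0|[S0 S0X]] := set_0Vmem X.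
  apply: eq_tree_count => S; have : S \notin X by rewrite X0 inE.
  by rewrite inE -leNgt => h; exact: same_sign h (zz S).
have [Sm SmX Smin] : exists2 Sm, Sm \in X & forall S, S \in X -> crit Sm <= crit S.
  have := @arg_minP _ _ _ S0 [in X] crit S0X; case=> S SX H.
  by exists S.
(* [k] is the first time at which a subset sum changes sign, and [k2] lies strictly between [k] and
   the next such time, or is 1 if there is none. *)
pose k := crit Sm.
pose Y := [set S in X | k < crit S]%SET.
pose k2 : rat := if [pick S in Y] is Some S1 then
   (k + crit [arg min_(S < S1 in Y) crit S]%O) / 2 else 1.
have critX S : S \in X -> 0 < crit S < 1.
  by rewrite inE; exact: crit_01.
have k01 : 0 < k < 1 by exact: critX.
have [kk2 k21 Yk2] : [/\ k < k2, k2 <= 1 & forall S, S \in Y -> k2 < crit S].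
  rewrite /k2; case: pickP => [S1 S1Y|Y0].
    case: arg_minP => // S2 S2Y H.
    have k2S : k < crit S2 by move: S2Y; rewrite inE => /andP[].
    have c1 : crit S2 < 1 by move: S2Y; rewrite inE => /andP[/critX/andP[]].
    split; [lra|lra|move=> S SY]; have := H S SY; lra.
  split=> //; first by case/andP: k01.
  by move=> S SY; have := Y0 S; rewrite SY.
have XE S : S \in X -> crit S = k \/ S \in Y.
  move=> SX; have := Smin S SX; rewrite -/k le_eqVlt => /orP[/eqP->|]; first by left.
  by right; rewrite inE SX.
have B t : 0 <= t <= 1 -> balanced_vec (line b c t) by exact: line_balanced.
have kB : balanced_vec (line b c k) by apply: B; case/andP: k01; lra.
have k2B : balanced_vec (line b c k2) by apply: B; case/andP: k01; lra.
pose w v := c v - b v.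
have wE S : bsum w S = bsum c S - bsum b S by rewrite /bsum sumrB.
have w0 : \sum_v w v = 0.
  by rewrite -bsumT wE !bsumT; case: bb => _ _ ->; case: bc => _ _ ->; rewrite subrr.
have lineE t S : bsum (line b c t) S = bsum b S + t * (bsum c S - bsum b S) by exact: bsum_line.
have sgn S t : S \in X -> (0 < bsum (line b c t) S) = (if 0 < bsum b S then t < crit S else crit S < t).
  rewrite inE lineE /crit; move: (bsum b S) (bsum c S) => x y h.
  by case: (ltrP 0 x) => hx; [rewrite line_pos ?(mul_lt0_pos h)|rewrite line_neg ?(mul_lt0_neg h)].
have zero S t : S \in X -> (bsum (line b c t) S == 0) = (t == crit S).
  rewrite inE lineE /crit; move: (bsum b S) (bsum c S) => x y h.
  have xy : x - y != 0 by apply/eqP => xy; have : x = y by [lra]; move=> E; rewrite E in h; nra.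
  apply/eqP/eqP => [E|->]; last by field.
  by apply: (mulIf xy); rewrite divfK //; lra.
have nX S t : S \notin X -> 0 <= t <= 1 ->
    (0 < bsum (line b c t) S) = (0 < bsum b S) /\
    (bsum (line b c t) S == 0) = (bsum b S == 0).
  by rewrite inE -leNgt lineE => h t01; exact: line_same_sign h (zz S) t01.
have [kB1 kB2 kB3] := kB.
(* Around the wall point at time [k], the vector [b] shows the signs on the side [-w] and the vector
   at time [k2] those on the side [+w]. *)
have rev := tree_count_reverse cIJ kB1 kB2 kB3 w0.
have E1 : tree_count n (fun S => 0 < bsum b S) = tree_count n (lexpos (line b c k) w true).
  apply: eq_tree_count => S; rewrite /lexpos mulN1r oppr_gt0 wE subr_lt0.
  have [SX|SX] := boolP (S \in X).
    rewrite sgn // zero //; move: (SX); rewrite inE.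
    have := XE S SX; have : S \in Y -> k < crit S by rewrite inE => /andP[].
    move: (crit S) (bsum b S) (bsum c S) => z x y kz [->|/kz{}kz] h.
      rewrite eqxx ltxx if_same /=; apply/idP/idP; nra.
    rewrite (lt_eqF kz) kz andFb orbF; case: ltrP => // _.
    by rewrite ltNge (ltW kz).
  have [|-> ->] := nX S k SX; first by case/andP: k01; lra.
  have := zz S; case: (eqVneq (bsum b S) 0) => [->|_ _]; last by rewrite orbF.
  by move=> /esym/eqP->; rewrite ltxx.
have E2 : tree_count n (fun S => 0 < bsum (line b c k2) S) = tree_count n (lexpos (line b c k) w false).
  apply: eq_tree_count => S; rewrite /lexpos mul1r wE subr_gt0.
  have [SX|SX] := boolP (S \in X).
    rewrite !sgn // zero //; move: (SX); rewrite inE.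
    have := XE S SX; have := Yk2 S; have : S \in Y -> k < crit S by rewrite inE => /andP[].
    move: (crit S) (bsum b S) (bsum c S) => z x y kz k2z [->|SY] h.
      rewrite eqxx ltxx if_same /= kk2 (lt_gtF kk2); case: ltrP => hx; apply/esym; [apply/negbTE; rewrite -leNgt; nra|nra].
    have {}kz := kz SY; have {}k2z := k2z SY.
    by rewrite (lt_eqF kz) andFb orbF kz k2z !(lt_gtF kz) (lt_gtF k2z).
  have [|-> ->] := nX S k SX; first by case/andP: k01; lra.
  have [|-> _] := nX S k2 SX; first by case/andP: k01; lra.
  have := zz S; case: (eqVneq (bsum b S) 0) => [->|_ _]; last by rewrite orbF.
  by move=> /esym/eqP->; rewrite ltxx.
(* Replacing [b] by the point at time [k2] keeps the count, and [Sm] leaves the set of sums that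
   still have to change sign. *)
rewrite E1 rev -E2; apply: IH => //.
  apply: leq_trans bm; apply: proper_card; apply/properP; split.
    apply/fintype.subsetP => S; rewrite !inE; apply: contraTT => SX.
    rewrite -leNgt; move: SX (SX); rewrite {1}(_ : (bsum b S * bsum c S < 0) = (S \in X)); last by rewrite inE.
    move/nX => /(_ k2) [|h1 h2]; first by case/andP: k01; lra.
    rewrite -leNgt; move: h1 h2; move: (bsum _ S) (bsum b S) (bsum c S) => z x y h1 h2.
    case: (ltrgtP z 0) h1 h2 => hz; case: (ltrgtP x 0) => hx //; rewrite ?hz ?hx ?eqxx // => _ _; nra.
  exists Sm; first by move: SmX; rewrite !inE.
  rewrite inE -leNgt; have := sgn Sm k2 SmX; rewrite -/k (lt_gtF kk2) kk2.
  move: SmX; rewrite inE; move: (bsum _ Sm) (bsum b Sm) (bsum c Sm) => z x y h.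
  by case: (ltrP 0 x) => hx; [move/negbT; rewrite -leNgt|] => hz; nra.
move=> S; have [SX|SX] := boolP (S \in X).
  rewrite zero //; have -> : (bsum c S == 0) = false.
    by apply/negbTE; move: SX; rewrite inE; apply: contraTneq => ->; rewrite mulr0 ltxx.
  have [->|SY] := XE S SX; first by rewrite gt_eqF.
  by rewrite lt_eqF // Yk2.
have [|_ ->] := nX S k2 SX; first by case/andP: k01; lra.
exact: zz.
Qed.

End Path.

(** * Polynomial functions *)

Section PolynomialFunctions.
Variable V : finType.
Notation pt := (V -> rat).
Implicit Types (f g h : pt -> rat) (d : nat).

(** Predicates on functions instead of polynomials: coefficients are never inspected, and the
    passage to [mpoly] at the end is an induction on derivations. *)
Inductive hpol : nat -> (pt -> rat) -> Prop :=
| hpol_zero d : hpol d (fun=> 0)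
| hpol_const c : hpol 0 (fun=> c)
| hpol_var v : hpol 1 (fun x => x v)
| hpol_add d f g : hpol d f -> hpol d g -> hpol d (fun x => f x + g x)
| hpol_mul d e f g : hpol d f -> hpol e g -> hpol (d + e) (fun x => f x * g x)
| hpol_ext d f g : hpol d f -> f =1 g -> hpol d g.

(* Polynomial functions of degree less than [d]. *)
Inductive polt : nat -> (pt -> rat) -> Prop :=
| polt_zero d : polt d (fun=> 0)
| polt_const c : polt 1 (fun=> c)
| polt_var v : polt 2 (fun x => x v)
| polt_add d f g : polt d f -> polt d g -> polt d (fun x => f x + g x)
| polt_mul d e f g : polt d.+1 f -> polt e.+1 g -> polt (d + e).+1 (fun x => f x * g x)
| polt_weak d e f : polt d f -> (d <= e)%N -> polt e f
| polt_ext d f g : polt d f -> f =1 g -> polt d g.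

Lemma polt0 f : polt 0 f -> forall x, f x = 0.
Proof.
have : forall m f, polt m f -> m = 0%N -> forall x, f x = 0.
  move=> m {}f; elim=> //.
  - by move=> d g h _ IHg _ IHh d0 x; rewrite IHg ?IHh ?addr0.
  - by move=> d e g _ IH de e0; apply: IH; move: de; rewrite e0 leqn0 => /eqP.
  - by move=> d g h _ IH gh d0 x; rewrite -gh IH.
by move=> H /H; apply.
Qed.

Lemma polt_mulS d e f g : polt d.+1 f -> polt e g -> polt (d + e) (fun x => f x * g x).
Proof.
case: e => [|e] pf pg; last by rewrite addnS; exact: polt_mul.
by apply: polt_ext (polt_zero _) _ => x; rewrite (polt0 pg) mulr0.
Qed.

Lemma polt_scale d c f : polt d f -> polt d (fun x => c * f x).
Proof. by move=> pf; have := polt_mulS (polt_const c) pf. Qed.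

Lemma polt_sub d f g : polt d f -> polt d g -> polt d (fun x => f x - g x).
Proof.
move=> pf pg; apply: polt_ext (polt_add pf (polt_scale (-1) pg)) _ => x.
by rewrite mulN1r.
Qed.

Lemma polt_sum (T : Type) (r : seq T) (P : pred T) d (F : T -> pt -> rat) :
  (forall t, P t -> polt d (F t)) -> polt d (fun x => \sum_(t <- r | P t) F t x).
Proof.
move=> pF; elim: r => [|t r IH].
  by apply: polt_ext (polt_zero d) _ => x; rewrite big_nil.
have [Pt|Pt] := boolP (P t); last first.
  by apply: polt_ext IH _ => x; rewrite big_cons (negPf Pt).
by apply: polt_ext (polt_add (pF _ Pt) IH) _ => x; rewrite big_cons Pt.
Qed.

Lemma polt_prod (T : Type) (r : seq T) (D : T -> nat) (F : T -> pt -> rat) :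
  (forall t, polt (D t).+1 (F t)) ->
  polt (\sum_(t <- r) D t).+1 (fun x => \prod_(t <- r) F t x).
Proof.
move=> pF; elim: r => [|t r IH].
  by rewrite big_nil; apply: polt_ext (polt_const 1) _ => x; rewrite big_nil.
by rewrite big_cons; apply: polt_ext (polt_mul (pF t) IH) _ => x; rewrite big_cons.
Qed.

Lemma hpol_polt d f : hpol d f -> polt d.+1 f.
Proof.
elim=> {d f}.
- by move=> d; exact: polt_zero.
- by move=> c; exact: polt_const.
- by move=> v; exact: polt_var.
- by move=> d f g _ pf _ pg; exact: polt_add.
- by move=> d e f g _ pf _ pg; exact: polt_mul.
- by move=> d f g _ pf E; exact: polt_ext E.
Qed.

Lemma hpol_scale d c f : hpol d f -> hpol d (fun x => c * f x).
Proof. by move=> pf; have := hpol_mul (hpol_const c) pf. Qed.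

(** The leading form is built along the derivation. For a product with factors [f], [g] and leading
    forms [hf], [hg], the remainder is [hf * (g - hg) + g * (f - hf)]. *)
Lemma polt_top d f : polt d.+1 f ->
  exists2 h, hpol d h & polt d (fun x => f x - h x).
Proof.
have : forall m f, polt m f -> forall d, m = d.+1 ->
    exists2 h, hpol d h & polt d (fun x => f x - h x).
  move=> m {d}f; elim=> {m f}.
  - move=> m d _; exists (fun=> 0); first exact: hpol_zero.
    by apply: polt_ext (polt_zero d) _ => x; rewrite subr0.
  - move=> c d [<-]; exists (fun=> c); first exact: hpol_const.
    by apply: polt_ext (polt_zero 0) _ => x; rewrite subrr.
  - move=> v d [<-]; exists (fun x => x v); first exact: hpol_var.
    by apply: polt_ext (polt_zero 1) _ => x; rewrite subrr.
  - move=> m f g _ IHf _ IHg d md.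
    have [hf hf1 hf2] := IHf _ md; have [hg hg1 hg2] := IHg _ md.
    exists (fun x => hf x + hg x); first exact: hpol_add.
    by apply: polt_ext (polt_add hf2 hg2) _ => x; ring.
  - move=> a b f g pf IHf pg IHg d [<-].
    have [hf hf1 hf2] := IHf _ erefl; have [hg hg1 hg2] := IHg _ erefl.
    exists (fun x => hf x * hg x); first exact: hpol_mul.
    have p1 := polt_mulS (hpol_polt hf1) hg2; have p2 := polt_mulS pg hf2.
    rewrite addnC in p2.
    by apply: polt_ext (polt_add p1 p2) _ => x; ring.
  - move=> a m f pf IH am d md; rewrite md in am.
    case: (ltngtP a d.+1) am => // [ad _|ad _]; last exact: IH.
    exists (fun=> 0); first exact: hpol_zero.
    by apply: polt_weak (_ : polt a _) _ => //; apply: polt_ext pf _ => x; rewrite subr0.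
  - move=> m f g _ IH fg d md; have [h h1 h2] := IH _ md; exists h => //.
    by apply: polt_ext h2 _ => x; rewrite fg.
by move=> H /H; apply.
Qed.

(** The factor [N] on the left stands for the exponent [d - 1] on the right, so that [d = 0] is
    covered as well. *)
Lemma polt_growth d f : polt d f -> exists C : rat, 0 <= C /\
  forall (N : rat) x, 1 <= N -> (forall v, `|x v| <= N) -> N * `|f x| <= C * N ^+ d.
Proof.
elim=> {d f}.
- by move=> d; exists 0; split=> // N x _ _; rewrite normr0 mulr0 mul0r.
- by move=> c; exists `|c|; split=> // N x _ _; rewrite expr1 mulrC.
- move=> v; exists 1; split=> // N x N1 xN.
  by rewrite mul1r expr2 ler_wpM2l // (le_trans ler01).
- move=> d f g _ [Cf [Cf0 Hf]] _ [Cg [Cg0 Hg]]; exists (Cf + Cg); split; first exact: addr_ge0.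
  move=> N x N1 xN; rewrite mulrDl; apply: le_trans (lerD (Hf _ _ N1 xN) (Hg _ _ N1 xN)).
  by rewrite -mulrDr ler_wpM2l ?ler_normD // (le_trans ler01).
- move=> d e f g _ [Cf [Cf0 Hf]] _ [Cg [Cg0 Hg]]; exists (Cf * Cg); split; first exact: mulr_ge0.
  move=> N x N1 xN; have N0 : 0 < N by exact: lt_le_trans N1.
  have := Hf _ _ N1 xN; have := Hg _ _ N1 xN.
  rewrite !exprS !(mulrCA _ N) !ler_pM2l // => h1 h2.
  rewrite normrM exprD mulrACA; apply: ler_pM => //.
- move=> d e f _ [C [C0 H]] de; exists C; split=> // N x N1 xN.
  apply: le_trans (H _ _ N1 xN) _; rewrite ler_wpM2l //.
  exact: ler_weXn2l.
- move=> d f g _ [C [C0 H]] fg; exists C; split=> // N x N1 xN.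
  by rewrite -fg; exact: H.
Qed.

End PolynomialFunctions.

(** * Piecewise polynomiality of flow counts *)

Section FlowCount.
Variables (E V : finType) (p q : E -> V).
Hypothesis pq : forall e e', p e != q e'.
Local Notation econn := (econn p q).
Local Notation has_cuts := (has_cuts p q).
Implicit Types (A T : {set E}) (S : {set V}) (m t : E -> nat) (b : V -> rat) (e f : E).

Definition bdry (a : E -> rat) v : rat := \sum_e a e * edelta p q e v.

(* The coefficient of [b] in the product over the edges [e] of the series
   [(1 - X_e)^-(m e)], where [X_e] is the monomial of the boundary of [e];
   [N] has to be large enough. *)
Definition flow_count N m b : rat :=
  \sum_(w : {ffun E -> 'I_N.+1} | [forall v, bdry (fun e => (w e)%:R) v == b v])
    (\prod_e 'C((w e + m e).-1, w e))%:R.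

(** The coefficient of [b] in the product of the series [X_e^(t e) (1 - X_e)^-(m e)]. *)
Definition shifted m t N b : rat :=
  flow_count N m (fun v => b v - bdry (fun e => (t e)%:R) v).

Lemma sum_bdry a : \sum_v bdry a v = 0.
Proof.
rewrite /bdry exchange_big big1 // => e _.
by rewrite -mulr_sumr sum_edelta mulr0.
Qed.

Lemma sum_delta (F : V -> rat) u : \sum_v F v * (u == v)%:R = F u.
Proof.
rewrite (bigD1 u) //= eqxx mulr1 big1 ?addr0 // => v.
by rewrite eq_sym => /negPf->; rewrite mulr0.
Qed.

Lemma bsum_edelta e S : bsum (edelta p q e) S = (p e \in S)%:R - (q e \in S)%:R.
Proof.
rewrite bsumE /edelta; under eq_bigr => v _ do rewrite mulrBr.
by rewrite sumrB !sum_delta.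
Qed.

Lemma bsum_bdry a S : bsum (bdry a) S = \sum_e a e * ((p e \in S)%:R - (q e \in S)%:R).
Proof.
rewrite /bsum /bdry exchange_big; apply: eq_bigr => e _.
by rewrite -mulr_sumr -/(bsum _ _) bsum_edelta.
Qed.

Lemma eq_bdry a a' : a =1 a' -> bdry a =1 bdry a'.
Proof. by move=> aa v; apply: eq_bigr => e _; rewrite aa. Qed.

(** A source is never a target by [pq], so nothing cancels at [p e]. This is how a bound on [b] at
    the sources bounds all flows. *)
Lemma bdry_src a e : (forall e, 0 <= a e) -> a e <= bdry a (p e).
Proof.
move=> a0; rewrite /bdry (bigD1 e) //= /edelta eqxx eq_sym (negPf (pq _ _)) subr0 mulr1.
rewrite lerDl sumr_ge0 // => e' _; rewrite (eq_sym (q e')) (negPf (pq _ _)) subr0.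
by rewrite mulr_ge0.
Qed.

Lemma bdry_src_ge0 a e : (forall e, 0 <= a e) -> 0 <= bdry a (p e).
Proof. by move=> a0; apply: le_trans (bdry_src e a0). Qed.

Lemma eq_flow_count N m m' b b' : m =1 m' -> b =1 b' -> flow_count N m b = flow_count N m' b'.
Proof.
move=> mm bb; apply: eq_big => w.
  by apply: eq_forallb => v; rewrite bb.
by move=> _; congr (_%:R); apply: eq_bigr => e _; rewrite mm.
Qed.

Definition decr m e : E -> nat := fun e' => (m e' - (e' == e))%N.
Definition incr m e : E -> nat := fun e' => (m e' + (e' == e))%N.

Lemma bdry_incr t e v : bdry (fun e' => (incr t e e')%:R) v =
  bdry (fun e' => (t e')%:R) v + edelta p q e v.
Proof.
rewrite /bdry /incr; under eq_bigr => e' _ do rewrite natrD mulrDl.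
rewrite big_split /=; congr (_ + _); rewrite (bigD1 e) //= eqxx mul1r big1 ?addr0 // => e'.
by move=> /negPf->; rewrite mul0r.
Qed.

(** Multiplication of the series by [1 - X_e] lowers the exponent at [e]; on coefficients this is
    Pascal's rule after raising [w e] by one. The bound on [b] keeps the raised weight inside
    ['I_N.+1]. *)
Lemma flow_count_pascal N m e b : (0 < m e)%N -> (forall e, b (p e) <= N%:R) ->
  flow_count N m b - flow_count N m (fun v => b v - edelta p q e v) = flow_count N (decr m e) b.
Proof.
move=> me bN.
pose h (w : {ffun E -> 'I_N.+1}) : {ffun E -> 'I_N.+1} := [ffun e' => inord (w e' + (e' == e))].
pose h' (w : {ffun E -> 'I_N.+1}) : {ffun E -> 'I_N.+1} := [ffun e' => inord (w e' - (e' == e))].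
have hE (w : {ffun E -> 'I_N.+1}) : (w e < N)%N -> forall e', (h w e' : nat) = incr (fun x => w x : nat) e e'.
  move=> wN e'; rewrite ffunE inordK // /incr ltnS.
  by case: eqVneq => [->|_]; rewrite ?addn1 // addn0 -ltnS.
have ltN (w : {ffun E -> 'I_N.+1}) :
    (forall v, bdry (fun e => (w e)%:R) v == b v - edelta p q e v) -> (w e < N)%N.
  move=> wb; rewrite -(ltr_nat rat); have := bN e; have /eqP := wb (p e).
  have := @bdry_src (fun e => (w e)%:R) e (fun e => ler0n _ _).
  rewrite /edelta [q e == _]eq_sym (negPf (pq _ _)) subr0 (_ : (p e == p e)%:R = 1); last first.
    by rewrite eqxx.
  move: (bdry _ _) (b _) (w e)%:R N%:R => x y z u *; lra.
have -> : flow_count N m (fun v => b v - edelta p q e v) =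
  \sum_(w : {ffun E -> 'I_N.+1} | [forall v, bdry (fun e => (w e)%:R) v == b v])
    (if (0 < w e)%N then (\prod_(e' | e' != e) 'C((w e' + m e').-1, w e')) *
        'C((w e).-1 + (m e).-1, (w e).-1) else 0)%:R.
  rewrite [RHS](bigID (fun w : {ffun E -> 'I_N.+1} => 0 < w e)%N) /=.
  rewrite [X in _ + X]big1 ?addr0; last by move=> w /andP[_ /negPf->].
  rewrite (reindex_onto h h') /=; last first.
    move=> w /andP[_ w0]; apply/ffunP => e'; apply: val_inj; rewrite !ffunE /=.
    have lt : (w e' - (e' == e) < N.+1)%N by rewrite (leq_ltn_trans (leq_subr _ _)).
    rewrite (inordK lt); case: (eqVneq e' e) => [->|_]; last by rewrite subn0 addn0 inord_val.
    by rewrite subnK // inord_val.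
  apply: eq_big => [w|w /forallP wb].
    apply/forallP/andP => [wb|[/andP[/forallP wb w0] _] v].
      have wN := ltN _ wb.
      split; last first.
        apply/eqP/ffunP => e'; apply: val_inj; rewrite ffunE /= hE // /incr addnK.
        by rewrite inordK.
      rewrite hE // /incr eqxx addn1 andbT; apply/forallP => v.
      rewrite (@eq_bdry _ (fun e' => (incr (fun x => w x : nat) e e')%:R)) => [|e']; last by rewrite hE.
      by rewrite bdry_incr (eqP (wb v)) subrK.
    have wN : (w e < N)%N.
      have := ltn_ord (w e); rewrite ltnS leq_eqVlt => /orP[/eqP wN|//].
      by move: w0; rewrite ffunE eqxx addn1 /inord /insubd insubF //= wN ltnn.
    have := wb v; rewrite (@eq_bdry _ (fun e' => (incr (fun x => w x : nat) e e')%:R)) => [|e']; last by rewrite hE.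
    by rewrite bdry_incr => /eqP<-; rewrite addrK.
  have wN := ltN _ wb.
  rewrite !hE // /incr eqxx addn1 /=; congr (_%:R).
  rewrite (bigD1 e) //= mulnC; congr (_ * _)%N.
    by apply: eq_bigr => e' /negPf ee; rewrite hE // /incr ee addn0.
  by case: (m e) me => //= k _; rewrite addnS.
rewrite /flow_count -sumrB; apply: eq_bigr => w _.
rewrite (bigD1 e) //= [in RHS](bigD1 e) //= /decr eqxx.
have -> : (\prod_(e' | e' != e) 'C((w e' + (m e' - (e' == e))).-1, w e') =
  \prod_(e' | e' != e) 'C((w e' + m e').-1, w e'))%N.
  by apply: eq_bigr => e' /negPf->; rewrite subn0.
move: (\prod_(e' | _) _)%N => P; case: (m e) me => // k _; rewrite subn1 /=.
case: (nat_of_ord (w e)) => [|u]; first by rewrite !bin0 subr0.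
have -> : (u.+1 + k.+1).-1 = (u + k).+1 by lia.
have -> : (u.+1 + k).-1 = (u + k)%N by lia.
rewrite binS /= natrM natrD natrM [X in _ - X = _]natrM.
by move: (_%:R) (_%:R) (_%:R) => x y z; lra.
Qed.

Lemma shifted_step M t N b e : (0 < M e)%N -> (forall e, b (p e) <= N%:R) ->
  shifted M t N b - shifted M (incr t e) N b = shifted (decr M e) t N b.
Proof.
move=> Me bN; rewrite /shifted -flow_count_pascal // => [|e'].
  by congr (_ - _); apply: eq_flow_count => // v; rewrite bdry_incr opprD addrA.
by rewrite lerBlDr (le_trans (bN e')) // lerDl bdry_src_ge0.
Qed.

Lemma econn_card A : econn A -> (#|V| <= #|A|.+1)%N.
Proof.
move=> cA; rewrite -[#|A|](card_sig (fun e => e \in A)).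
apply: (@conn_card _ _ (fun x : {e | e \in A} => p (val x)) (fun x => q (val x))).
apply/connP => S SE; apply: (econnP _ _ _ cA) => e eA; exact: (SE (exist _ e eA)).
Qed.

Lemma minimal_cuts A : econn A -> (forall e, e \in A -> ~~ econn (A :\ e)%SET) ->
  exists C, has_cuts A C.
Proof.
move=> cA mA.
have H e : e \in A -> exists S, forall e', e' \in A ->
    (p e' \in S)%:R - (q e' \in S)%:R = (e' == e)%:R :> rat.
  move=> eA; have := mA e eA; rewrite negb_forall => /existsP[S].
  rewrite negb_imply negb_or => /and3P[/forall_inP SE S0 ST].
  have SE' e' : e' \in A -> e' != e -> (p e' \in S) = (q e' \in S).
    by move=> e'A ee'; apply/eqP/SE; rewrite !inE ee'.
  have : (p e \in S) != (q e \in S).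
    apply/negP => /eqP pqe; have [e' e'A|S1|S1] := econnP _ _ _ cA S.
    - by case: (eqVneq e' e) => [->//|]; exact: SE'.
    - by rewrite S1 eqxx in S0.
    - by rewrite S1 eqxx in ST.
  have [pS|pS] := boolP (p e \in S); have [qS|qS] := boolP (q e \in S) => // _.
    exists S => e' e'A; case: (eqVneq e' e) => [->|ee'].
      by rewrite pS (negPf qS) subr0.
    by rewrite SE' // subrr.
  exists (~: S)%SET => e' e'A; rewrite !inE; case: (eqVneq e' e) => [->|ee'].
    by rewrite pS qS subr0.
  by rewrite SE' // subrr.
have /choice[C HC] : forall e, exists S : {set V}, e \in A -> forall e', e' \in A ->
    (p e' \in S)%:R - (q e' \in S)%:R = (e' == e)%:R :> rat.
  move=> e; have [/H[S HS]|] := boolP (e \in A); first by exists S.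
  by exists finset.set0.
by exists C => e e' eA; exact: HC.
Qed.

Lemma minimal_subset A : econn A -> exists T, [/\ T \subset A, econn T &
  forall e, e \in T -> ~~ econn (T :\ e)%SET].
Proof.
move=> cA; case: (@arg_minnP _ A (fun T => (T \subset A) && econn T) (fun T => #|T|)).
  by rewrite fintype.subxx cA.
move=> T /andP[TA cT] Tmin; exists T; split=> // e eT; apply/negP => cTe.
have := Tmin (T :\ e)%SET; rewrite cTe andbT (fintype.subset_trans (subD1set _ _)) //.
by move=> /(_ isT); rewrite (cardsD1 e T) eT ltnn.
Qed.

Section Good.
Variable d : nat.

(** A cell prescribes the signs of all subset sums. The polynomial may depend on the cell, but not
    on the bound [N]. *)
Definition cellwise_polt (F : nat -> (V -> rat) -> rat) : Prop :=
  forall sg : {set V} -> rat, exists2 Q, polt d Q & forall N b,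
    (forall v, b v \is a Num.int) -> \sum_v b v = 0 -> (forall e, b (p e) <= N%:R) ->
    (forall S, Num.sg (bsum b S) = sg S) -> F N b = Q b.

Lemma cellwise_zero : cellwise_polt (fun _ _ => 0).
Proof. by move=> sg; exists (fun=> 0) => //; exact: polt_zero. Qed.

Lemma cellwise_sub F G : cellwise_polt F -> cellwise_polt G ->
  cellwise_polt (fun N b => F N b - G N b).
Proof.
move=> HF HG sg; have [P pP PE] := HF sg; have [Q pQ QE] := HG sg.
exists (fun b => P b - Q b); first exact: polt_sub.
by move=> N b *; rewrite PE // QE.
Qed.

Lemma cellwise_add F G : cellwise_polt F -> cellwise_polt G ->
  cellwise_polt (fun N b => F N b + G N b).
Proof.
move=> HF HG sg; have [P pP PE] := HF sg; have [Q pQ QE] := HG sg.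
exists (fun b => P b + Q b); first exact: polt_add.
by move=> N b *; rewrite PE // QE.
Qed.

Lemma cellwise_ext F G : cellwise_polt F ->
  (forall N b, (forall v, b v \is a Num.int) -> \sum_v b v = 0 ->
     (forall e, b (p e) <= N%:R) -> F N b = G N b) -> cellwise_polt G.
Proof.
move=> HF FG sg; have [P pP PE] := HF sg; exists P => // N b *.
by rewrite -FG // PE.
Qed.

(** The coordinates are moved from [t] to [t2] one at a time, each by one unit. By [shifted_step]
    each move changes the value by plus or minus some [shifted (decr M e)], to which the last
    hypothesis applies. *)
Lemma shifted_walk M t t2 : (forall e, t e <= M e)%N -> (forall e, t2 e <= M e)%N ->
  (forall e, t e <= (t2 e).+1)%N -> (forall e, t2 e <= (t e).+1)%N ->
  (forall e t', t e != t2 e -> (forall e', t' e' <= decr M e e')%N ->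
     cellwise_polt (shifted (decr M e) t')) ->
  cellwise_polt (fun N b => shifted M t N b - shifted M t2 N b).
Proof.
have [k] := ubnP #|[set e | t e != t2 e]%SET|; elim: k => // k IH in t *.
move=> tk tM t2M tt2 t2t H.
have [T0|[e]] := set_0Vmem [set e | t e != t2 e]%SET.
  apply: cellwise_ext cellwise_zero _ => N b _ _ _; apply/esym/eqP; rewrite subr_eq0; apply/eqP.
  apply: eq_flow_count => // v; congr (_ - _); apply: eq_bdry => e.
  have : e \notin [set e | t e != t2 e]%SET by rewrite T0 inE.
  by rewrite inE negbK => /eqP->.
rewrite inE => te.
pose t3 x := if x == e then t2 x else t x.
have step : cellwise_polt (fun N b => shifted M t N b - shifted M t3 N b).
  have Me : (0 < M e)%N.
    by move: te (tM e) (t2M e); move: (t e) (t2 e) (M e) => x y z; lia.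
  have := tt2 e; have := t2t e; rewrite leq_eqVlt => /orP[/eqP E1 _|lt1].
    apply: (@cellwise_ext (shifted (decr M e) t)) => [|N b _ _ bN].
      apply: H te _ => e'; rewrite /decr; case: (eqVneq e' e) => [->|_]; last by rewrite subn0.
      by have := t2M e; rewrite E1; lia.
    rewrite -shifted_step //; congr (_ - _); apply: eq_flow_count => // v; congr (_ - _).
    apply: eq_bdry => e'; rewrite /t3 /incr; case: eqVneq => [->|_]; last by rewrite addn0.
    by rewrite E1 addn1.
  rewrite leq_eqVlt => /orP[/eqP E1|lt2]; last first.
    by move: lt1 lt2 te; move: (t e) (t2 e) => x y; lia.
  apply: (@cellwise_ext (fun N b => 0 - shifted (decr M e) t3 N b)) => [|N b _ _ bN].
    apply: cellwise_sub cellwise_zero _; apply: H te _ => e'; rewrite /decr /t3.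
    case: (eqVneq e' e) => [->|_]; last by rewrite subn0.
    by have := tM e; rewrite E1; lia.
  rewrite -shifted_step // sub0r opprB; congr (_ - _); apply: eq_flow_count => // v; congr (_ - _).
  apply: eq_bdry => e'; rewrite /t3 /incr; case: eqVneq => [->|_]; last by rewrite addn0.
  by rewrite E1 addn1.
apply: cellwise_ext (cellwise_add step (IH t3 _ _ _ _ _ _)) _ => //.
- rewrite -ltnS; apply: leq_trans tk; rewrite ltnS; apply: proper_card.
  apply/fintype.properP; split.
    apply/fintype.subsetP => x; rewrite !inE /t3; case: (eqVneq x e) => // _.
    by rewrite eqxx.
  by exists e; rewrite !inE // /t3 !eqxx.
- by move=> x; rewrite /t3; case: ifP.
- by move=> x; rewrite /t3; case: ifP.
- by move=> x; rewrite /t3; case: ifP.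
- by move=> x t'; rewrite /t3; case: (eqVneq x e); rewrite ?eqxx // => _; exact: H.
- by move=> N b _ _ _ /=; rewrite addrA subrK.
Qed.

End Good.
Lemma bin_prod (u k : nat) :
  'C(u + k, u)%:R = \prod_(i < k) (u%:R + 1 + i%:R) / (k`!)%:R :> rat.
Proof.
have k0 : (k`!)%:R != 0 :> rat by rewrite pnatr_eq0 -lt0n fact_gt0.
apply: (mulIf k0); rewrite mulfVK // -natrM.
elim: k {k0} => [|k IH]; first by rewrite big_ord0 addn0 binn.
rewrite big_ord_recr /= -IH factS -[in RHS](natrD _ u 1) -natrD -natrM; congr _%:R.
have E1 : 'C(u + k.+1, u) = 'C((u + k).+1, k.+1).
  by rewrite addnS -[RHS]bin_sub ?ltnS ?leq_addl // subSS addnK.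
have E2 : 'C(u + k, u) = 'C(u + k, k) by rewrite -[RHS]bin_sub ?leq_addl // addnK.
have := mul_bin_diag (u + k).+1 k; rewrite /= -E1 -E2 addn1 addSn.
move: 'C(u + k.+1, u) 'C(u + k, u) (k`!) => x y z xy.
transitivity (z * (k.+1 * x))%N; first by ring.
by rewrite -xy; ring.
Qed.

Lemma polt_bsum S : polt 2 (fun b : V -> rat => bsum b S).
Proof. by apply: polt_sum => v _; exact: polt_var. Qed.

Lemma polt_bin S (c : rat) k :
  polt k.+1 (fun b : V -> rat => \prod_(i < k) (bsum b S - c + 1 + i%:R) / (k`!)%:R).
Proof.
have : polt (\sum_(i < k) 1).+1 (fun b : V -> rat => \prod_(i < k) (bsum b S - c + 1 + i%:R)).
  apply: polt_prod => i; apply: polt_ext (polt_add (polt_bsum S)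
     (polt_weak (polt_const _ (- c + 1 + i%:R)) _)) _ => // b.
  by ring.
rewrite sum1_card card_ord => H.
by apply: polt_ext (polt_scale ((k`!)%:R)^-1 H) _ => b; rewrite mulrC.
Qed.

(** A tree carries a single flow, whose value on each edge is a cut sum, so the count is a product
    of binomial coefficients in these sums. *)
Lemma tree_cellwise A C m t : econn A -> has_cuts A C ->
  (forall e, (0 < m e)%N = (e \in A)) -> (forall e, t e <= m e)%N ->
  cellwise_polt (\sum_e (m e).-1).+1 (shifted m t).
Proof.
move=> cA AC mA tm sg.
have m0 e : e \notin A -> m e = 0%N by rewrite -mA -eqn0Ngt => /eqP.
have t0 e : e \notin A -> t e = 0%N by move=> /m0 me0; apply/eqP; rewrite -leqn0 -me0.
pose u e (b : V -> rat) := if e \in A then Num.truncn (bsum b (C e) - (t e)%:R) else 0%N.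
pose G e (b : V -> rat) : rat := if e \in A then
    if (t e)%:R <= bsum b (C e) then ('C((u e b + m e).-1, u e b))%:R else 0 else 1.
have valE N b : (forall v, b v \is a Num.int) -> \sum_v b v = 0 -> (forall e, b (p e) <= N%:R) ->
    shifted m t N b = \prod_e G e b.
  move=> bi b0 bN; rewrite /shifted /flow_count.
  set b' := (fun v => b v - bdry (fun e => (t e)%:R) v).
  have bsb S : bsum b' S = bsum b S - bsum (bdry (fun e => (t e)%:R)) S.
    by rewrite /bsum sumrB.
  have b'0 : \sum_v b' v = 0 by rewrite sumrB b0 sum_bdry subrr.
  have cutE (a : E -> rat) e : e \in A -> (forall e', e' \notin A -> a e' = 0) ->
      bsum (bdry a) (C e) = a e.
    move=> eA a0; rewrite bsum_bdry (bigD1 e) //= AC // eqxx mulr1 big1 ?addr0 // => e' ee'.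
    have [e'A|e'A] := boolP (e' \in A); last by rewrite a0 ?mul0r.
    by rewrite AC // (negPf ee') mulr0.
  have b'C e : e \in A -> bsum b' (C e) = bsum b (C e) - (t e)%:R.
    by move=> eA; rewrite bsb cutE // => e' /t0->.
  have wE (w : {ffun E -> 'I_N.+1}) : [forall v, bdry (fun e => (w e)%:R) v == b' v] ->
      (forall e, e \notin A -> w e = 0%N :> nat) -> forall e, e \in A ->
      (w e)%:R = bsum b (C e) - (t e)%:R.
    move=> /forallP wb w0 e eA; rewrite -b'C // -[LHS](cutE (fun e => (w e)%:R)) //.
      by apply: eq_bigr => v _; exact/eqP.
    by move=> e' /w0->.
  have w0P (w : {ffun E -> 'I_N.+1}) :
      (forall e, e \notin A -> w e = 0%N :> nat) \/ \prod_e 'C((w e + m e).-1, w e) = 0%N.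
    have [/forall_inP H|] := boolP [forall (e | e \notin A), w e == 0%N :> nat].
      by left=> e /H/eqP.
    rewrite negb_forall => /existsP[e]; rewrite negb_imply => /andP[eA we].
    right; rewrite (bigD1 e) //= m0 // addn0; move: we.
    by case: (nat_of_ord (w e)) => //= k _; rewrite bin_small.
  have [/forall_inP pos|] := boolP [forall e in A, (t e)%:R <= bsum b (C e)]; last first.
    rewrite negb_forall => /existsP[e]; rewrite negb_imply => /andP[eA te].
    rewrite [RHS](bigD1 e) //= /G eA (negPf te) mul0r big1 // => w wb.
    case: (w0P w) => [w0|->//]; case/negP: te.
    by rewrite -subr_ge0 -(wE w).
  have uE e : e \in A -> (u e b)%:R = bsum b (C e) - (t e)%:R.
    move=> eA; rewrite /u eA truncnK // natrEint subr_ge0 pos // andbT.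
    by apply: rpredB; [apply: rpred_sum => v _; exact: bi|exact: rpred_nat].
  have u0 e : e \notin A -> u e b = 0%N by rewrite /u => /negPf->.
  have ub v : bdry (fun e => (u e b)%:R) v = b' v.
    have := cut_flow (fun x => (x == v)%:R) cA AC b'0.
    under eq_bigr => x _ do rewrite mulrC.
    rewrite (eq_bigr (fun x => b' x * (v == x)%:R)) => [|x _]; last by rewrite eq_sym.
    rewrite sum_delta => ->; rewrite /bdry [LHS](bigID [in A]) /= [X in _ + X]big1 ?addr0.
      by apply: eq_bigr => e eA; rewrite uE // -b'C // mulrC.
    by move=> e /u0->; rewrite mul0r.
  have uN e : (u e b < N.+1)%N.
    rewrite ltnS -(ler_nat rat); apply: le_trans (bN e).
    apply: le_trans (bdry_src (a := fun e => (u e b)%:R) e _) _ => //.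
    by rewrite ub /b' gerBl bdry_src_ge0.
  rewrite (bigD1 [ffun e => Ordinal (uN e)]) /=; last first.
    apply/forallP => v; rewrite [X in _ == X](_ : _ = b' v) // -ub; apply/eqP.
    by apply: eq_bdry => e; rewrite ffunE.
  rewrite [X in _ + X]big1 ?addr0 => [|w /andP[wb]].
    rewrite natr_prod; apply: eq_bigr => e _; rewrite ffunE /= /G.
    have [eA|eA] := boolP (e \in A); first by rewrite pos.
    by rewrite u0 // bin0.
  case: (w0P w) => [w0|->//]; case/eqP.
  apply/ffunP => e; apply: val_inj; rewrite ffunE /=; apply/eqP.
  have [eA|eA] := boolP (e \in A); last by rewrite w0 // u0.
  by rewrite -(eqr_nat rat) uE // (wE w).
(* For a positive cut sum the polynomial is correct even below [t e], where the count is 0: its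
   roots are the integers from [t e - m e + 1] to [t e - 1], and [t e <= m e] makes them include all
   of 1, ..., [t e - 1]. *)
pose P e (b : V -> rat) : rat := if e \in A then
    if sg (C e) < 0 then 0 else if sg (C e) == 0 then (t e == 0%N)%:R else
    \prod_(i < (m e).-1) (bsum b (C e) - (t e)%:R + 1 + i%:R) / ((m e).-1`!)%:R else 1.
exists (fun b => \prod_e P e b).
  apply: polt_prod => e; rewrite /P.
  have pc c : polt (m e).-1.+1 (fun=> c : rat).
    by apply: polt_weak (polt_const _ _) _.
  case: (e \in A); last exact: pc.
  case: (sg (C e) < 0); first exact: pc.
  by case: (sg (C e) == 0); [exact: pc|exact: polt_bin].
move=> N b bi b0 bN bsg; rewrite valE //; apply: eq_bigr => e _.
rewrite /G /P; case: ifP => // eA; rewrite -bsg sgr_lt0 sgr_eq0.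
have xi : bsum b (C e) \is a Num.int by apply: rpred_sum => v _; exact: bi.
have [x0|x0|x0] := ltrgtP (bsum b (C e)) 0.
- by case: ifP => // h; have := le_lt_trans h x0; rewrite ltrn0.
- have ue : (t e)%:R <= bsum b (C e) -> (u e b)%:R = bsum b (C e) - (t e)%:R.
    by move=> te; rewrite /u eA truncnK // natrEint subr_ge0 te andbT rpredB ?rpred_nat.
  have me : (0 < m e)%N by rewrite mA.
  case: ifP => te.
    by rewrite -ue // -{1}(prednK me) addnS /= bin_prod.
  have /natrP[x xE] : bsum b (C e) \is a Num.nat by rewrite natrEint xi ltW.
  move: te; rewrite xE ler_nat => /negbT; rewrite -ltnNge => te.
  have x1 : (0 < x)%N by rewrite -(ltr_nat rat) -xE.
  have lt : (t e - x.+1 < (m e).-1)%N by have := tm e; lia.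
  rewrite (bigD1 (Ordinal lt)) //= natrB // -natr1; set y := (X in X * _ / _).
  have -> : y = 0 by rewrite /y; ring.
  by rewrite mul0r mul0r.
- rewrite x0 lern0; case: eqP => // te; rewrite /u eA te x0 subrr.
  by rewrite (_ : Num.truncn 0 = 0%N) ?bin0 //; exact: (@natrK rat 0).
Qed.

Lemma natb_sub (x y : bool) : x%:R - y%:R = 0 :> rat -> x = y.
Proof. by case: x y => [] [] // /eqP; rewrite ?subr0 ?sub0r ?oppr_eq0 oner_eq0. Qed.

(** One step in the requested direction, arranged so that swapping [up] and [down] gives a
    complementary move: a difference of 1 is realised by raising one copy below the ceiling [m], and
    by lowering the other copy at the ceiling. Neither copy leaves the interval from 0 to [m]. *)
Definition nudge (up down : bool) (t m : nat) : nat :=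
  if up && (t < m)%N then t.+1 else if down && (m <= t)%N then t.-1 else t.

Lemma nudge_bounds up down (t m : nat) : (t <= m)%N ->
  [/\ nudge up down t m <= m, t <= (nudge up down t m).+1 & nudge up down t m <= t.+1]%N.
Proof. by rewrite /nudge; case: up; case: down; case: ltnP => /= *; split; lia. Qed.

(* Induction on the support, then on the total multiplicity of the edges other
   than an edge [f] outside a spanning tree [T].  Writing the boundary of [f] as
   a signed sum of boundaries of edges of [T] gives two walks, starting at [t]
   and at [t] plus one copy of [f], that end at the same boundary vector and do
   not leave the box below [M = m + 1_f]. *)
Theorem cellwise_shifted m t : econn [set e | 0 < m e]%N%SET -> (forall e, t e <= m e)%N ->
  cellwise_polt ((\sum_e m e).+1 - #|V|).+1 (shifted m t).
Proof.
have [K] := ubnP #|[set e | 0 < m e]%N%SET|; elim: K => // K OIH in m t *.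
move=> mK cm tm; set A := [set e | 0 < m e]%N%SET in mK cm.
have [|noF] := boolP [exists f in A, econn (A :\ f)%SET]; last first.
  have [C AC] : exists C, has_cuts A C.
    by apply: minimal_cuts cm _ => e eA; apply: contraNN noF => H; apply/exists_inP; exists e.
  move=> sg; have [e|Q pQ QE] := tree_cellwise cm AC _ tm sg; first by rewrite inE.
  exists Q => //; apply: polt_weak pQ _; rewrite ltnS.
  have E1 : (\sum_e m e = \sum_e (m e).-1 + #|A|)%N.
    rewrite -sum1_card [X in _ = (_ + X)%N]big_mkcond -big_split; apply: eq_bigr => e _ /=.
    by rewrite inE; case: (m e) => //= k; rewrite addn1.
  have := econn_card cm; lia.
case/exists_inP => f fA cf; have [T [TA cT Tmin]] := minimal_subset cf.
have [C TC] := minimal_cuts cT Tmin.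
have Tf e : e \in T -> e != f by move=> /(fintype.subsetP TA); rewrite !inE => /andP[].
have TinA e : e \in T -> e \in A by move=> /(fintype.subsetP TA); rewrite !inE => /andP[].
pose c e : rat := (p f \in C e)%:R - (q f \in C e)%:R.
(* Dual form of the expression of the boundary of [f] by boundaries of edges of [T], with
   coefficients [c e] equal to 0, 1 or -1. *)
have circ (y : V -> rat) : y (p f) - y (q f) = \sum_(e in T) (y (p e) - y (q e)) * c e.
  have := cut_flow y cT TC (sum_edelta p q f).
  under [in RHS]eq_bigr => e _ do rewrite bsum_edelta.
  move=> <-; rewrite /edelta; under eq_bigr => v _ do rewrite mulrBr.
  by rewrite sumrB !sum_delta.
(* Exchange property: a tree edge with [c e != 0] lies on the cycle closed by [f], so [f] can
   replace it. *)
have cut_conn e : e \in T -> c e != 0 -> econn (A :\ e)%SET.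
  move=> eT ce; apply/econnP => S SE; apply: (econnP _ _ _ cT) => e' e'T.
  have [->|ee'] := eqVneq e' e; last by apply: SE; rewrite in_setD1 ee' TinA.
  have := circ (fun v => (v \in S)%:R).
  rewrite SE ?in_setD1 1?eq_sym ?Tf // subrr (bigD1 e) //= big1 ?addr0.
    by move=> /esym/eqP; rewrite mulf_eq0 (negPf ce) orbF => /eqP/natb_sub.
  move=> x /andP[xT xe]; rewrite SE ?in_setD1 ?xe ?TinA //.
  by rewrite subrr mul0r.
pose D := (\sum_e m e)%N; rewrite -/D.
have inner k m' t' : [set e | 0 < m' e]%N%SET = A -> (\sum_e m' e)%N = D -> (D - m' f < k)%N ->
    (forall e, t' e <= m' e)%N -> cellwise_polt (D.+1 - #|V|).+1 (shifted m' t').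
  elim: k m' t' => // k IIH {tm t}m1 t mA mD mk tm.
  have mpos e : (0 < m1 e)%N = (e \in A) by rewrite -mA inE.
  pose M := incr m1 f.
  (* One unit moves from [e] to [f]. Either [e] stays in the support and the inner induction applies
     because [m f] has grown, or [e] leaves it and the outer induction applies to the still
     connected remainder. *)
  have key e t' : e \in T -> c e != 0 -> (forall e', t' e' <= decr M e e')%N ->
      cellwise_polt (D.+1 - #|V|).+1 (shifted (decr M e) t').
    move=> eT ce tM; have ef := Tf _ eT; have me : (0 < m1 e)%N by rewrite mpos TinA.
    have MD : (\sum_e' decr M e e' = D)%N.
      rewrite -mD (bigD1 e) //= (bigD1 f) /= 1?eq_sym // [RHS](bigD1 e) //= [in RHS](bigD1 f) /= 1?eq_sym //.
      rewrite /decr /M /incr !eqxx (negPf ef) [f == e]eq_sym (negPf ef) !addnA.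
      congr (_ + _)%N; first by lia.
      by apply: eq_bigr => x /andP[/negPf-> /negPf->]; rewrite addn0 subn0.
    have Mf : decr M e f = (m1 f).+1.
      by rewrite /decr /M /incr eqxx [f == e]eq_sym (negPf ef) subn0 addn1.
    have mfD : (m1 f < D)%N.
      rewrite -mD (bigD1 f) //= (bigD1 e) //=; lia.
    have [m1e|m1e] := ltnP 1 (m1 e).
      apply: IIH => //; last by rewrite Mf; lia.
      apply/setP => x; rewrite -mA !inE /decr /M /incr.
      case: (eqVneq x e) => [->|_]; first by rewrite (negPf ef); lia.
      case: (eqVneq x f) => [->|_]; first by rewrite mpos fA; lia.
      by rewrite addn0 subn0.
    have sE : [set x | 0 < decr M e x]%N%SET = (A :\ e)%SET.
      apply/setP => x; rewrite in_setD1 -mA !inE /decr /M /incr.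
      case: (eqVneq x e) => [->|_] /=; first by rewrite (negPf ef); lia.
      case: (eqVneq x f) => [->|_]; first by rewrite mpos fA; lia.
      by rewrite addn0 subn0.
    rewrite -MD; apply: OIH => //; rewrite sE; last exact: cut_conn.
    by move: mK; rewrite (cardsD1 e A) TinA.
  have n01 : (0 == 1 :> rat) = false by [].
  have n0m1 : (0 == -1 :> rat) = false by [].
  (* The two end points differ by [c] on [T] and by -1 at [f], hence have the same boundary. The
     walks to them use only tree edges with [c] nonzero. *)
  pose tm1 x := if x \in T then nudge (c x == 1) (c x == -1) (t x) (m1 x) else t x.
  pose tm2 x := if x \in T then nudge (c x == -1) (c x == 1) (t x) (m1 x) else incr t f x.
  have mM x : (m1 x <= M x)%N by rewrite /M /incr leq_addr.
  have tE x : (t x <= M x)%N by apply: leq_trans (tm x) (mM x).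
  have itE x : (incr t f x <= M x)%N by rewrite /M /incr leq_add2r tm.
  have t1E x : (tm1 x <= M x)%N.
    rewrite /tm1; case: ifP => // _; apply: leq_trans (mM x).
    by case: (nudge_bounds (c x == 1) (c x == -1) (tm x)).
  have t2E x : (tm2 x <= M x)%N.
    rewrite /tm2; case: ifP => // _; apply: leq_trans (mM x).
    by case: (nudge_bounds (c x == -1) (c x == 1) (tm x)).
  have w1 : cellwise_polt (D.+1 - #|V|).+1 (fun N b => shifted M t N b - shifted M tm1 N b).
    apply: shifted_walk => //.
    - by move=> x; rewrite /tm1; case: ifP => // _; case: (nudge_bounds (c x == 1) (c x == -1) (tm x)).
    - by move=> x; rewrite /tm1; case: ifP => // _; case: (nudge_bounds (c x == 1) (c x == -1) (tm x)).
    move=> x t' tx; apply: key; move: tx; rewrite /tm1.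
      by case: ifP => //; rewrite eqxx.
    rewrite /nudge; case: ifP => [xT|_]; last by rewrite eqxx.
    by apply: contraNneq => ->; rewrite n01 n0m1.
  have w2 : cellwise_polt (D.+1 - #|V|).+1 (fun N b => shifted M tm2 N b - shifted M (incr t f) N b).
    have itT x : x \in T -> incr t f x = t x by move=> /Tf/negPf xf; rewrite /incr xf addn0.
    apply: shifted_walk => //.
    - move=> x; rewrite /tm2; case: ifP => [/itT->|//].
      by case: (nudge_bounds (c x == -1) (c x == 1) (tm x)).
    - move=> x; rewrite /tm2; case: ifP => [/itT->|//].
      by case: (nudge_bounds (c x == -1) (c x == 1) (tm x)).
    move=> x t' tx; apply: key; move: tx; rewrite /tm2.
      by case: ifP => //; rewrite eqxx.
    rewrite /nudge; case: ifP => [xT|_]; last by rewrite eqxx.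
    rewrite itT //.
    by apply: contraNneq => ->; rewrite n01 n0m1.
  apply: cellwise_ext (cellwise_add w1 w2) _ => N b _ _ bN /=.
  have -> : shifted m1 t N b = shifted M t N b - shifted M (incr t f) N b.
    rewrite shifted_step // /M /incr ?eqxx ?addn1 //; apply: eq_flow_count => // x.
    by rewrite /decr addnK.
  suff -> : shifted M tm1 N b = shifted M tm2 N b by rewrite addrA subrK.
  apply: eq_flow_count => // v; congr (_ - _); apply/eqP; rewrite -subr_eq0 -sumrB; apply/eqP.

  have dE v1 : edelta p q f v1 = \sum_(e in T) edelta p q e v1 * c e.
    exact: (circ (fun x => (x == v1)%:R)).
  rewrite (bigID [in T]) /= [X in _ + X](bigD1 f) /=; last by apply/negP => /Tf; rewrite eqxx.
  rewrite [X in _ + (_ + X)]big1 ?addr0; last first.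
    by move=> x /andP[/negPf xT /negPf xf]; rewrite /tm1 /tm2 xT /incr xf addn0 subrr.
  have fT : (f \in T) = false by apply/negP => /Tf; rewrite eqxx.
  have -> : tm1 f = t f by rewrite /tm1 fT.
  have -> : tm2 f = (t f).+1 by rewrite /tm2 fT /incr eqxx addn1.
  rewrite -natr1 mulrDl mul1r opprD [X in _ + X]addrA subrr add0r.
  apply/eqP; rewrite subr_eq0 dE; apply/eqP; apply: eq_bigr => x xT.
  rewrite -mulrBl mulrC; congr (_ * _); rewrite /tm1 /tm2 xT /nudge.
  have m0 : (0 < m1 x)%N by rewrite mpos TinA.
  have : c x \in [:: 0; 1; -1] by rewrite /c; case: (_ \in _); case: (_ \in _).
  rewrite !inE => /or3P[] /eqP->; rewrite ?n01 ?n0m1 /= ?subrr //.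
    by case: ltnP => h; [rewrite -natr1 addrC addKr|rewrite -{1}(@prednK (t x)) -?natr1; [ring|lia]].
  case: ltnP => h; first by rewrite -natr1; ring.
  by rewrite -{2}(@prednK (t x)) -?natr1; [ring|lia].
by apply: (inner D.+1) => //; lia.
Qed.

(** With all multiplicities 1 the binomial coefficients are 1, and the shift by one on every edge
    turns nonnegative flows into positive ones. *)
Lemma shifted_one N b : (forall e, b (p e) <= N%:R) ->
  shifted (fun=> 1%N) (fun=> 1%N) N b =
  #|[set w : {ffun E -> 'I_N.+1} | [forall e, 0 < w e]%N &&
      [forall v, bdry (fun e => (w e)%:R) v == b v]]%SET|%:R.
Proof.
move=> bN; rewrite -sum1_card natr_sum /shifted /flow_count.
pose h (w : {ffun E -> 'I_N.+1}) : {ffun E -> 'I_N.+1} := [ffun e => inord (w e).+1].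
pose h' (w : {ffun E -> 'I_N.+1}) : {ffun E -> 'I_N.+1} := [ffun e => inord (w e).-1].
have bdS (w : {ffun E -> 'I_N.+1}) v : bdry (fun e => ((w e).+1)%:R) v =
    bdry (fun e => (w e)%:R) v + bdry (fun=> 1%:R) v.
  by rewrite /bdry -big_split; apply: eq_bigr => e _; rewrite -natr1 mulrDl.
rewrite [RHS](reindex_onto h h') /=; last first.
  move=> w; rewrite inE => /andP[/forallP w0 _]; apply/ffunP => e; apply: val_inj.
  rewrite !ffunE /= (@inordK _ (w e).-1); last by rewrite (leq_ltn_trans (leq_pred _)).
  by rewrite prednK // inordK.
apply: eq_big => [w|w _]; last by rewrite big1 // => e _; rewrite addn1 binn.
apply/forallP/andP => [wb|[]].
  have wN e : (w e < N)%N.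
    rewrite -(ler_nat rat); apply: le_trans (bN e).
    apply: le_trans (bdry_src (a := fun e => ((w e).+1)%:R) e _) _ => //.
    by rewrite bdS (eqP (wb _)) subrK.
  have hE e : (h w e : nat) = (w e).+1 by rewrite ffunE inordK // ltnS.
  split; last first.
    by apply/eqP/ffunP => e; apply: val_inj; rewrite [h' _ _]ffunE hE /= inordK.
  rewrite inE; apply/andP; split; apply/forallP => v; first by rewrite hE.
  rewrite (@eq_bdry _ (fun e => ((w e).+1)%:R)) => [|e]; last by rewrite hE.
  by rewrite bdS (eqP (wb v)) subrK.
rewrite inE => /andP[/forallP h0 /forallP hb] _ v.
have hE e : (h w e : nat) = (w e).+1.
  have := ltn_ord (w e); rewrite ltnS leq_eqVlt => /orP[/eqP wN|wN].
    by have := h0 e; rewrite ffunE /inord /insubd insubF //= wN ltnn.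
  by rewrite ffunE inordK.
have := hb v; rewrite (@eq_bdry _ (fun e => ((w e).+1)%:R)) => [|e]; last by rewrite hE.
by rewrite bdS => /eqP<-; rewrite addrK.
Qed.

End FlowCount.

(** The white perimeters are negated so that this is the boundary of a flow directed from black to
    white. *)
Definition svec (I J : finType) (x : I + J -> nat) (v : I + J) : rat :=
  match v with inl i => (x (inl i))%:R | inr j => - (x (inr j))%:R end.

Section Treelike.
Variable n : nat.

Definition wcount (I J : finType) (kappa : {ffun 'I_n -> I * J} -> rat) N (x : I + J -> nat) : rat :=
  \sum_s kappa s * (nbw N s (x \o inl) (x \o inr))%:R.

Section Bipartite.
Variables (I J : finType).
Implicit Types (s : {ffun 'I_n -> I * J}) (x : I + J -> nat).

Lemma bdry_bend s a i : bdry (bend s) (wend s) a (inl i) = \sum_(e | (s e).1 == i) a e.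
Proof.
rewrite [RHS]big_mkcond; apply: eq_bigr => e _; rewrite /edelta /bend /wend subr0.
by rewrite (inj_eq (@inl_inj _ _)); case: ifP; rewrite ?mulr1 ?mulr0.
Qed.

Lemma bdry_wend s a j : bdry (bend s) (wend s) a (inr j) = - \sum_(e | (s e).2 == j) a e.
Proof.
rewrite [\sum_(e | _) _]big_mkcond -sumrN; apply: eq_bigr => e _; rewrite /edelta /bend /wend sub0r.
by rewrite (inj_eq (@inr_inj _ _)); case: ifP; rewrite ?mulrN1 ?oppr0 ?mulr0.
Qed.

Lemma weightings_bdry N s x : weightings N s (x \o inl) (x \o inr) =
  [set w : {ffun 'I_n -> 'I_N.+1} | [forall e, 0 < w e]%N &&
     [forall v, bdry (bend s) (wend s) (fun e => (w e)%:R) v == svec x v]]%SET.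
Proof.
apply/setP => w; rewrite !inE; congr (_ && _); apply/andP/forallP.
  move=> [/forallP h1 /forallP h2] [i|j].
    by rewrite bdry_bend -natr_sum (eqP (h1 i)).
  by rewrite bdry_wend -natr_sum (eqP (h2 j)).
move=> H; split; apply/forallP => v.
  by have := H (inl v); rewrite bdry_bend -natr_sum eqr_nat.
by have := H (inr v); rewrite bdry_wend -natr_sum eqr_opp eqr_nat.
Qed.

Lemma nbw_shifted N s x : (forall i, x (inl i) <= N)%N ->
  (nbw N s (x \o inl) (x \o inr))%:R = shifted (bend s) (wend s) (fun=> 1%N) (fun=> 1%N) N (svec x).
Proof.
by move=> xN; rewrite shifted_one // /nbw ?weightings_bdry // => e; rewrite ler_nat.
Qed.

Lemma nbw_cellwise s : conn (bend s) (wend s) ->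
  cellwise_polt (bend s) (n.+1 - #|{: I + J}|).+1
    (shifted (bend s) (wend s) (fun=> 1%N) (fun=> 1%N)).
Proof.
move=> cn; have := @cellwise_shifted _ _ (bend s) (wend s) _ (fun=> 1%N) (fun=> 1%N).
rewrite sum1_card card_ord; apply=> //.
by rewrite (_ : [set e | _]%SET = [set: 'I_n]%SET) ?econnT //; apply/setP => e; rewrite !inE.
Qed.

End Bipartite.

Lemma sum_map_onto (I J I' J' : finType) (phi : I -> I') (psi : J -> J') :
  onto phi -> onto psi -> forall v', exists v, sum_map phi psi v = v'.
Proof.
move=> /ontoP fo /ontoP po [i|j].
  by have [k <-] := fo i; exists (inl k).
by have [k <-] := po j; exists (inr k).
Qed.

Lemma conn_relabel (I J I' J' : finType) (phi : I -> I') (psi : J -> J') (s : {ffun 'I_n -> I * J}) :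
  onto phi -> onto psi -> conn (bend s) (wend s) ->
  conn (bend (relabel phi psi s)) (wend (relabel phi psi s)).
Proof.
move=> fo po cn; have pio := sum_map_onto fo po; apply/connP => S SE.
have [e|S0|ST] := connP _ _ cn [set v | sum_map phi psi v \in S]%SET.
- by rewrite !inE; have := SE e; rewrite /bend /wend ffunE.
- left; apply/setP => v'; rewrite inE; have [v <-] := pio v'.
  by have := finset.in_set0 v; rewrite -S0 inE.
- right; apply/setP => v'; rewrite inE; have [v <-] := pio v'.
  by have := finset.in_setT v; rewrite -ST inE.
Qed.

(** Holds for [tree_weight] because [btau] vanishes on disconnected graphs, and merging labels
    preserves connectedness. *)
Lemma treelike_conn (I J : finType) (kappa : {ffun 'I_n -> I * J} -> rat) : treelike kappa ->
  forall s, kappa s != 0 -> conn (bend s) (wend s).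
Proof.
elim=> {I J kappa}.
- move=> I J I0 _ _ s; apply: contraNT => nc; have [i _] := card_gt0P I0.
  by rewrite /tree_weight (btauE s (inl i)) tau_conn // mul0r.
- move=> I J I' J' phi psi k fo po _ IH s sn0.
  have [t /eqP<- kt] : exists2 t, relabel phi psi t == s & k t != 0.
    have [/exists_inP[t ts kt]|] := boolP [exists (t | relabel phi psi t == s), k t != 0].
      by exists t.
    rewrite negb_exists_in => /forall_inP H; case/eqP: sn0.
    by apply: big1 => t /H; rewrite negbK => /eqP.
  exact/conn_relabel/IH.
- by move=> I J s; rewrite eqxx.
- move=> I J a k1 k2 _ IH1 _ IH2 s kn0.
  have [k10|] := eqVneq (k1 s) 0; last exact: IH1.
  by apply: IH2; apply: contraNneq kn0 => ->; rewrite k10 mulr0 addr0.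
- by move=> I J k1 k2 _ IH E s; rewrite -E; exact: IH.
Qed.

(** The degree is the dimension of the cycle space, the same for every graph with nonzero weight
    because these are connected. *)
Theorem wcount_cell (I J : finType) (kappa : {ffun 'I_n -> I * J} -> rat) : treelike kappa ->
  forall sg : {set I + J} -> rat, exists2 Q, polt (n.+1 - #|{: I + J}|).+1 Q &
    forall N (x : I + J -> nat), \sum_v svec x v = 0 -> (forall i, x (inl i) <= N)%N ->
      (forall S, Num.sg (bsum (svec x) S) = sg S) -> wcount kappa N x = Q (svec x).
Proof.
move=> kt sg; have kc := treelike_conn kt.
have /choice[Q HQ] s : exists Q, polt (n.+1 - #|{: I + J}|).+1 Q /\
    forall N (x : I + J -> nat), \sum_v svec x v = 0 -> (forall i, x (inl i) <= N)%N ->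
      (forall S, Num.sg (bsum (svec x) S) = sg S) ->
      kappa s * (nbw N s (x \o inl) (x \o inr))%:R = Q (svec x).
  have [k0|kn0] := eqVneq (kappa s) 0.
    by exists (fun=> 0); split=> [|N x *]; [exact: polt_zero|rewrite k0 mul0r].
  have [Q pQ QE] := nbw_cellwise (kc s kn0) sg.
  exists (fun b => kappa s * Q b); split=> [|N x x0 xN xS]; first exact: polt_scale.
  rewrite nbw_shifted // QE //; first by case=> i; rewrite /= ?rpredN rpred_nat.
  by move=> e; rewrite ler_nat.
exists (fun b => \sum_s Q s b); first by apply: polt_sum => s _; have [] := HQ s.
by move=> N x x0 xN xS; apply: eq_bigr => s _; have [_ ->] := HQ s.
Qed.

End Treelike.

(** * The leading form *)

Lemma polt_comp (V W : finType) d (f : (V -> rat) -> rat) (g : V -> (W -> rat) -> rat) :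
  polt d f -> (forall v, polt 2 (g v)) -> polt d (fun y => f (fun v => g v y)).
Proof.
move=> pf pg; elim: pf => {d f}.
- by move=> d; exact: polt_zero.
- by move=> c; exact: polt_const.
- by move=> v; exact: pg.
- by move=> d f h _ pf _ ph; exact: polt_add.
- by move=> d e f h _ pf _ ph; exact: polt_mul.
- by move=> d e f _ pf de; exact: polt_weak de.
- by move=> d f h _ pf fh; apply: polt_ext pf _ => y; rewrite fh.
Qed.

Definition eps (I J : finType) (v : I + J) : rat := if v is inl _ then 1 else -1.

Lemma svec_eps (I J : finType) (x : I + J -> nat) v : svec x v = eps v * (x v)%:R.
Proof. by case: v => ?; rewrite /= ?mul1r ?mulN1r. Qed.

Lemma eps_svec (I J : finType) (x : I + J -> nat) v : eps v * svec x v = (x v)%:R.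
Proof. by case: v => ?; rewrite /= ?mul1r ?mulN1r ?opprK. Qed.

Section Lifts.
Variables (n : nat) (I J I' J' : finType) (phi : I -> I') (psi : J -> J').
Hypotheses (fo : onto phi) (po : onto psi).
Notation V := (I + J)%type.
Notation V' := (I' + J')%type.
Notation pi := (sum_map phi psi).
Implicit Types (s : {ffun 'I_n -> I * J}).

Definition lifts N (x' : V' -> nat) : {set {ffun V -> 'I_N.+1}} :=
  [set x : {ffun V -> 'I_N.+1} | [forall v, 0 < x v]%N &&
    [forall v', \sum_(v | pi v == v') x v == x' v']%N]%SET.

Lemma sum_unit (F : unit -> rat) : \sum_u F u = F tt.
Proof. by rewrite (bigD1 tt) //= big1 ?addr0 // => -[]. Qed.

Lemma sg_sum_pos (T : finType) (P : pred T) (a : T -> rat) : (forall t, 0 < a t) ->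
  Num.sg (\sum_(t | P t) a t) = [exists t, P t]%:R.
Proof.
move=> a0; have [/existsP[t Pt]|] := boolP [exists t, P t].
  rewrite gtr0_sg // (bigD1 t) //= ltr_pwDl // sumr_ge0 // => u _; exact: ltW.
rewrite negb_exists => /forallP H; rewrite big1 ?sgr0 // => t Pt.
by have := H t; rewrite Pt.
Qed.

(* The lifts are the flows on the graph joining the points of [V], through their
   images in [V'], to one more vertex; all their cuts have constant sign. *)
Lemma card_lifts_polt : exists2 Q, polt (#|{: V}| - #|{: V'}|).+1 Q &
  forall N (x' : V' -> nat), (forall v', 0 < x' v')%N -> (forall v', x' v' <= N)%N ->
    #|lifts N x'|%:R = Q (svec x').
Proof.
pose p (v : V) : V' + unit := inl (pi v); pose q (v : V) : V' + unit := inr tt.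
have pq v w : p v != q w by [].
have cn : econn p q [set e | 0 < 1]%N%SET.
  apply/econnP => S SE.
  have SE' v' : (inl v' \in S) = (inr tt \in S).
    by have [v <-] := sum_map_onto fo po v'; apply: SE; rewrite inE.
  case: (boolP (inr tt \in S)) => ttS; [right|left]; apply/setP => -[v'|[]]; rewrite ?inE ?SE' //.
    by apply/negbTE.
  by apply/negbTE.
pose bb (y : V' -> rat) (w : V' + unit) : rat :=
  match w with inl v' => eps v' * y v' | inr _ => - \sum_v' eps v' * y v' end.
have bbE (x' : V' -> nat) w : bb (svec x') w =
    match w with inl v' => (x' v')%:R | inr _ => - \sum_v' (x' v')%:R end.
  case: w => [v'|u]; rewrite /bb ?eps_svec //; congr (- _).
  by apply: eq_bigr => v' _; exact: eps_svec.
have bsE (x' : V' -> nat) S : bsum (bb (svec x')) S =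
    if inr tt \in S then - \sum_(v' | inl v' \notin S) (x' v')%:R
    else \sum_(v' | inl v' \in S) (x' v')%:R.
  rewrite bsumE big_sumType /= sum_unit.
  under eq_bigr => v' _ do rewrite eps_svec.
  under [X in _ * - X]eq_bigr => v' _ do rewrite eps_svec.
  case: (inr tt \in S); rewrite ?mul0r ?addr0 ?mul1r.
    apply/eqP; rewrite subr_eq addrC eq_sym subr_eq [eqbLHS](bigID (fun v' => inl v' \in S)) /=.
    apply/eqP; congr (_ + _); rewrite big_mkcond; apply: eq_bigr => v' _.
    by case: ifP; rewrite ?mul1r ?mul0r.
  by rewrite [RHS]big_mkcond; apply: eq_bigr => v' _; case: ifP; rewrite ?mul1r ?mul0r.
have := @cellwise_shifted _ _ p q pq (fun=> 1%N) (fun=> 1%N) cn (fun=> leqnn _)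
  (fun S => if inr tt \in S then - [exists v', inl v' \notin S]%:R else [exists v', inl v' \in S]%:R).
rewrite sum1_card [#|{: V' + unit}|]card_sum card_unit addn1 subSS => -[Q pQ QE].
exists (fun y => Q (bb y)).
  apply: polt_comp pQ _ => -[v'|_].
    exact: polt_scale (polt_var _).
  apply: polt_ext (polt_scale (-1) (polt_sum _ _)) _ => [v' _|y]; last by rewrite mulN1r.
  exact: polt_scale (polt_var _).
move=> N x' x0 xN; rewrite -(QE N (bb (svec x'))); first last.
- move=> S; rewrite bsE; have x0' v' : 0 < (x' v')%:R :> rat by rewrite ltr0n.
  by case: ifP => _; rewrite ?sgrN sg_sum_pos.
- by move=> v; rewrite bbE ler_nat.
- by rewrite big_sumType /= sum_unit subrr.
- by case=> [v'|[]]; rewrite bbE ?rpredN ?rpred_nat //; apply: rpred_sum => *; exact: rpred_nat.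
rewrite shifted_one //; last by move=> v; rewrite bbE ler_nat.
congr (_%:R); apply: eq_card => x; rewrite !inE; congr (_ && _).
have bdE v' : bdry p q (fun v => (x v)%:R) (inl v') = (\sum_(v | pi v == v') x v)%:R.
  rewrite natr_sum [RHS]big_mkcond; apply: eq_bigr => v _; rewrite /edelta /p /q subr0.
  by rewrite (inj_eq (@inl_inj _ _)); case: ifP; rewrite ?mulr1 ?mulr0.
apply/forallP/forallP => [H [v'|[]]|H v'].
- by rewrite bdE bbE eqr_nat.
- rewrite bbE; apply/eqP.
  transitivity (- \sum_v (x v)%:R : rat).
    rewrite -sumrN; apply: eq_bigr => v _; rewrite /edelta /p /q sub0r eqxx mulrN1 //.
  congr (- _); rewrite (partition_big pi predT) //=; apply: eq_bigr => v' _.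
  by rewrite -natr_sum (eqP (H v')).
- by have := H (inl v'); rewrite bdE bbE eqr_nat.
Qed.


Definition wdegree (K L : finType) N (s : {ffun 'I_n -> K * L}) (w : {ffun 'I_n -> 'I_N.+1})
    (v : K + L) : nat :=
  match v with inl i => \sum_(e | (s e).1 == i) w e | inr j => \sum_(e | (s e).2 == j) w e end%N.

Lemma weightings_wdegree (K L : finType) N (s : {ffun 'I_n -> K * L}) (w : {ffun 'I_n -> 'I_N.+1})
    (x : K + L -> nat) :
  reflect ((forall e, 0 < w e)%N /\ forall v, wdegree s w v = x v)
    (w \in weightings N s (x \o inl) (x \o inr)).
Proof.
apply: (iffP (weightingsP _ _ _ _)) => [[w0 h1 h2]|[w0 h]]; first by split=> // -[v|v]; [exact: h1|exact: h2].
by split=> // v; [exact: (h (inl v))|exact: (h (inr v))].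
Qed.

Lemma wdegree_relabel N s (w : {ffun 'I_n -> 'I_N.+1}) v' :
  wdegree (relabel phi psi s) w v' = (\sum_(v | pi v == v') wdegree s w v)%N.
Proof.
rewrite big_sumType; case: v' => [i'|j'] /=.
  rewrite [X in (_ + X)%N]big_pred0 // addn0.
  under eq_bigl => e do rewrite ffunE /=.
  rewrite (partition_big (fun e => (s e).1) (fun i => phi i == i')) //=.
  apply: eq_big => i; first by rewrite (inj_eq (@inl_inj _ _)).
  by move=> /eqP ii; apply: eq_bigl => e; case: (eqVneq (s e).1 i) => [->|]; rewrite ?andbF // ii eqxx.
rewrite [X in (X + _)%N]big_pred0 // add0n.
under eq_bigl => e do rewrite ffunE /=.
rewrite (partition_big (fun e => (s e).2) (fun j => psi j == j')) //=.
apply: eq_big => j; first by rewrite (inj_eq (@inr_inj _ _)).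
by move=> /eqP jj; apply: eq_bigl => e; case: (eqVneq (s e).2 j) => [->|]; rewrite ?andbF // jj eqxx.
Qed.

Lemma wdegree_gt0 N s (w : {ffun 'I_n -> 'I_N.+1}) v : full_support s -> (forall e, 0 < w e)%N ->
  (0 < wdegree s w v)%N.
Proof.
case/andP => /forallP b0 /forallP w0 wp; case: v => [i|j] /=.
  have /card_gt0P[e] := b0 i; rewrite inE => ei.
  by rewrite (bigD1 e) //= addn_gt0 wp.
have /card_gt0P[e] := w0 j; rewrite inE => ej.
by rewrite (bigD1 e) //= addn_gt0 wp.
Qed.

(** The weightings of the merged graph are sorted by their vertex sums before the merging; full
    support makes these sums positive. *)
Lemma nbw_relabel N s (x' : V' -> nat) : full_support s -> (forall v', x' v' <= N)%N ->
  nbw N (relabel phi psi s) (x' \o inl) (x' \o inr) =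
  (\sum_(x in lifts N x') nbw N s ((fun v => x v : nat) \o inl) ((fun v => x v : nat) \o inr))%N.
Proof.
move=> fs xN; rewrite /nbw -sum1_card.
pose X (w : {ffun 'I_n -> 'I_N.+1}) : {ffun V -> 'I_N.+1} := [ffun v => inord (wdegree s w v)].
have XE (w : {ffun 'I_n -> 'I_N.+1}) v :
    w \in weightings N (relabel phi psi s) (x' \o inl) (x' \o inr) -> X w v = wdegree s w v :> nat.
  case/weightings_wdegree => _ /(_ (pi v)); rewrite wdegree_relabel => xv.
  by rewrite ffunE inordK // ltnS (leq_trans _ (xN (pi v))) // -xv (bigD1 v) //= leq_addr.
rewrite (partition_big X [in lifts N x']) /=; last first.
  move=> w wW; have /weightings_wdegree[w0 wx] := wW; rewrite inE.
  apply/andP; split; apply/forallP => v; first by rewrite XE // wdegree_gt0.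
  by rewrite -wx wdegree_relabel; apply/eqP; apply: eq_bigr => u _; rewrite XE.
apply: eq_bigr => x; rewrite inE => /andP[/forallP x0 /forallP xx].
rewrite -sum1_card; apply: eq_bigl => w; apply/andP/weightings_wdegree.
  case=> wW /eqP <-; have /weightings_wdegree[w0 wx] := wW.
  by split=> // v; rewrite XE.
case=> w0 wx; have wW : w \in weightings N (relabel phi psi s) (x' \o inl) (x' \o inr).
  apply/weightings_wdegree; split=> // v'; rewrite wdegree_relabel -(eqP (xx v')).
  by apply: eq_bigr => v _.
by split=> //; apply/eqP/ffunP => v; apply: val_inj; rewrite /= XE.
Qed.

Lemma wcount_push (kappa : {ffun 'I_n -> I * J} -> rat) N (x' : V' -> nat) :
  wcount (push phi psi kappa) N x' =
  \sum_s kappa s * (nbw N (relabel phi psi s) (x' \o inl) (x' \o inr))%:R.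
Proof.
rewrite [RHS](partition_big (relabel phi psi) predT) //=; apply: eq_bigr => s' _.
by rewrite mulr_suml; apply: eq_bigr => s /eqP->.
Qed.

Hypothesis cV : (#|I| + #|J| = n.+1)%N.
Hypotheses (I0 : (0 < #|I|)%N) (J0 : (0 < #|J|)%N).

(** The unique flow on a tree takes the sums over the fundamental cuts as its values, and it is a
    weighting exactly when they are positive. *)
Lemma tree_nbw N s (x : V -> nat) : conn (bend s) (wend s) -> \sum_v svec x v = 0 ->
  (forall v, x v <= N)%N ->
  nbw N s (x \o inl) (x \o inr) =
  [forall e, forall S, is_cut (bend s) (wend s) e S ==> (0 < bsum (svec x) S)].
Proof.
move=> cn x0 xN; have cV' := card_vertices cV.
have wcut (w : {ffun 'I_n -> 'I_N.+1}) e S : w \in weightings N s (x \o inl) (x \o inr) ->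
    is_cut (bend s) (wend s) e S -> (w e)%:R = bsum (svec x) S.
  rewrite weightings_bdry inE => /andP[_ /forallP wx] cS.
  transitivity (bsum (bdry (bend s) (wend s) (fun e => (w e)%:R)) S); last first.
    by apply: eq_bigr => v _; exact/eqP.
  rewrite bsum_bdry (bigD1 e) //= (is_cut_diff _ cS) eqxx mulr1 big1 ?addr0 // => e' /negPf ee'.
  by rewrite (is_cut_diff _ cS) ee' mulr0.
case: (boolP [forall e, _]) => [/forallP H|]; last first.
  rewrite negb_forall => /existsP[e]; rewrite negb_forall => /existsP[S].
  rewrite negb_imply => /andP[cS bS]; apply: eq_card0 => w; apply/negP => wW.
  case/negP: bS; rewrite -(wcut _ _ _ wW cS) ltr0n.
  by have /weightings_wdegree[] := wW.
pose a e := bsum (svec x) (tcut cn cV' e).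
have a0 e : 0 < a e by have /forallP/(_ (tcut cn cV' e))/implyP := H e; apply; exact: tcutP.
have an e : a e \is a Num.nat.
  rewrite natrEint ltW // andbT; apply: rpred_sum => v _.
  by case: v => v; rewrite /= ?rpredN rpred_nat.
have ax v : bdry (bend s) (wend s) (fun e => (Num.truncn (a e))%:R) v = svec x v.
  have := tree_flow cn cV' (fun u => (u == v)%:R) x0.
  rewrite (eq_bigr (fun u => svec x u * (v == u)%:R)) => [|u _]; last by rewrite mulrC eq_sym.
  rewrite sum_delta => ->; apply: eq_bigr => e _.
  by rewrite truncnK // mulrC.
have aN e : (Num.truncn (a e) < N.+1)%N.
  rewrite ltnS -(ler_nat rat); apply: (@le_trans _ _ (svec x (bend s e))); last first.
    by rewrite /= ler_nat.
  rewrite -ax; apply: (@bdry_src _ _ (bend s) (wend s) _ (fun e => (Num.truncn (a e))%:R)) => *;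
    exact: ler0n || by [].
transitivity #|[set [ffun e => Ordinal (aN e)]]%SET|; last by rewrite cards1.
congr #|pred_of_set _|; apply/setP => w; rewrite finset.in_set1.
apply/idP/eqP => [wW|->].
  apply/ffunP => e; apply: val_inj; rewrite ffunE /=; apply/eqP.
  by rewrite -(eqr_nat rat) (wcut _ _ _ wW (tcutP cn cV' e)) truncnK.
rewrite weightings_bdry inE; apply/andP; split; apply/forallP => v.
  by rewrite ffunE /= -(ltr_nat rat) truncnK.
by rewrite -ax; apply/eqP; apply: eq_bdry => e; rewrite ffunE.
Qed.

Lemma tree_weightE s : tree_weight s = (conn (bend s) (wend s))%:R * (cfact s)%:R.
Proof.
rewrite /tree_weight; congr (_ * _); have [i _] := card_gt0P I0; rewrite (btauE s (inl i)).
have [cn|nc] := boolP (conn _ _); last exact: tau_conn.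
exact: tau_tree (card_vertices cV).
Qed.

Lemma wcount_tree N (x' : V' -> nat) : \sum_v svec x' v = 0 -> (forall v', x' v' <= N)%N ->
  wcount (push phi psi (@tree_weight n I J)) N x' =
  \sum_(x in lifts N x') (tree_count n (fun S => 0 < bsum (svec (fun v => x v : nat)) S))%:R.
Proof.
move=> x0 xN; rewrite wcount_push.
transitivity (\sum_(s : {ffun 'I_n -> I * J}) \sum_(x in lifts N x')
    tree_weight s * (nbw N s ((fun v => x v : nat) \o inl) ((fun v => x v : nat) \o inr))%:R).
  apply: eq_bigr => s _; rewrite -mulr_sumr; have [fs|nfs] := boolP (full_support s).
    by rewrite nbw_relabel // natr_sum.
  by rewrite /tree_weight btau_full // !mul0r.
rewrite exchange_big; apply: eq_bigr => x; rewrite inE => /andP[_ /forallP xx] /=.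
rewrite /tree_count natr_sum [RHS]big_mkcond; apply: eq_bigr => s _.
rewrite tree_weightE; case: (boolP (conn _ _)) => cn; last by rewrite !mul0r.
rewrite mul1r /= tree_nbw //; first by case: ifP; rewrite ?mulr1 ?mulr0.
  rewrite -[RHS]x0 (partition_big pi predT) //=; apply: eq_bigr => v' _.
  rewrite svec_eps -(eqP (xx v')) natr_sum mulr_sumr; apply: eq_bigr => v /eqP <-.
  by rewrite svec_eps; case: v.
by move=> v; rewrite -ltnS.
Qed.

Lemma bsum_lift N x' (x : {ffun V -> 'I_N.+1}) (S' : {set V'}) : x \in lifts N x' ->
  bsum (svec (fun v => x v : nat)) (pi @^-1: S')%SET = bsum (svec x') S'.
Proof.
rewrite inE => /andP[_ /forallP xx]; rewrite /bsum.
rewrite (partition_big pi [in S']) /= => [|v]; last by rewrite inE.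
apply: eq_bigr => v' v'S; rewrite svec_eps -(eqP (xx v')) natr_sum mulr_sumr.
apply: eq_big => [v|v /andP[_ /eqP<-]]; last by rewrite svec_eps; case: v.
by rewrite inE; case: eqP => [->|]; rewrite ?v'S ?andbF.
Qed.

(** The sets that are not unions of fibres of the merging: the values of [x'] do not determine the
    sums of a lift over them. *)
Definition unsaturated : {set {set V}} :=
  [set S : {set V} | [exists u in S, exists u', (u' \notin S) && (pi u == pi u')]]%SET.

(* Such a lift is determined by its values away from [u'] and from one point of
   each fibre. *)
Lemma card_lifts_null N x' (S : {set V}) : (0 < N)%N -> S \in unsaturated ->
  (N * #|[set x in lifts N x' | bsum (svec (fun v => x v : nat)) S == 0%R]%SET| <=
   (2 * N) ^ (#|{: V}| - #|{: V'}|))%N.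
Proof.
move=> N0; rewrite inE => /exists_inP[u uS /existsP[u' /andP[u'S /eqP piu]]].
have uu' : u != u' by apply: contraNneq u'S => <-.
have /choice[sc scP] v' : exists v, pi v = v' /\ (v' = pi u -> v = u).
  have [->|vu] := eqVneq v' (pi u); first by exists u.
  by have [v pv] := sum_map_onto fo po v'; exists v; split=> // e; rewrite e eqxx in vu.
have piK v' : pi (sc v') = v' by case: (scP v').
have scu : sc (pi u) = u by case: (scP (pi u)) => _; apply.
pose Dm := (~: [set sc v' | v' in [set: V']] :\ u')%SET.
have DE v : (v \in Dm) = (v != u') && (v != sc (pi v)).
  rewrite in_setD1 finset.in_setC; congr (_ && ~~ _).
  by apply/imsetP/eqP => [[v' _ ->]|->]; [rewrite piK|exists (pi v)].
have cD : (#|{: V}| - #|{: V'}|)%N = #|Dm|.+1.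
  have cI : #|[set sc v' | v' in [set: V']]%SET| = #|{: V'}|.
    by rewrite card_imset ?cardsT //; exact: can_inj piK.
  have u'I : u' \in (~: [set sc v' | v' in [set: V']])%SET.
    rewrite finset.in_setC; apply/imsetP => -[v' _ u'E].
    by move: uu'; rewrite u'E -{1}scu piu u'E piK eqxx.
  have := cardsC [set sc v' | v' in [set: V']]%SET; rewrite cI (cardsD1 u' (~: _)%SET) u'I.
  by rewrite -/Dm => <-; rewrite addKn add1n.
rewrite cD; set B := [set x in _ | _]%SET.
have cB : (#|B| <= N.+1 ^ #|Dm|)%N.
  pose r (x : {ffun V -> 'I_N.+1}) : {ffun {v | v \in Dm} -> 'I_N.+1} := [ffun v => x (val v)].
  have rI : {in B &, injective r}.
    move=> x y; rewrite !inE => /andP[/andP[_ /forallP xx] /eqP xS].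
    move=> /andP[/andP[_ /forallP yy] /eqP yS] /ffunP rxy.
    pose z v : rat := (x v)%:R - (y v)%:R.
    have zD v : v \in Dm -> z v = 0.
      by move=> vD; have := rxy (exist _ v vD); rewrite !ffunE /= /z => ->; rewrite subrr.
    have zf v' : \sum_(v | pi v == v') z v = 0.
      by rewrite sumrB -!natr_sum (eqP (xx v')) (eqP (yy v')) subrr.
    have zsc v' : v' != pi u -> z (sc v') = 0.
      move=> v'u; rewrite -[RHS](zf v') (bigD1 (sc v')) ?piK //= big1 ?addr0 // => v /andP[/eqP pv vs].
      apply: zD; rewrite DE pv vs andbT; apply: contraNneq v'u => vu'.
      by rewrite -pv vu' piu.
    (* Every other point of [S] is already settled, so the vanishing sum over [S] determines the
       value at [u]; the sum over the fibre then determines the one at [u'], which is not in [S]. *)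
    have zu : z u = 0.
      have : \sum_(v in S) eps v * z v = 0.
        under eq_bigr => v _ do rewrite mulrBr.
        rewrite sumrB; under eq_bigr => v _ do rewrite -(svec_eps (fun v => x v : nat)).
        under [X in _ - X]eq_bigr => v _ do rewrite -(svec_eps (fun v => y v : nat)).
        by move: xS yS; rewrite /bsum => -> ->; rewrite subrr.
      rewrite (bigD1 u) //= big1 ?addr0.
        by move/eqP; rewrite mulf_eq0; case: (u) => ? /=; rewrite ?oppr_eq0 ?oner_eq0 /= => /eqP.
      move=> v /andP[vS vu]; have [vs|vs] := eqVneq v (sc (pi v)); last first.
        by rewrite zD ?mulr0 // DE vs andbT; apply: contraNneq u'S => <-.
      rewrite vs zsc ?mulr0 //; apply: contraNneq vu => pvu.
      by rewrite vs pvu scu.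
    have zu' : z u' = 0.
      have := zf (pi u); rewrite (bigD1 u) //= zu add0r (bigD1 u') /=; last first.
        by rewrite piu eqxx eq_sym.
      rewrite big1 ?addr0 // => v /andP[/andP[/eqP pv vu] vu'].
      by rewrite zD // DE vu' pv scu.
    apply/ffunP => v; apply: val_inj; apply/eqP; rewrite -(eqr_nat rat) -subr_eq0.
    apply/eqP; rewrite -/(z v); have [->//|vu'] := eqVneq v u'.
    have [vs|vs] := eqVneq v (sc (pi v)); last by rewrite zD // DE vu' vs.
    have [pvu|pvu] := eqVneq (pi v) (pi u); first by rewrite vs pvu scu.
    by rewrite vs zsc.
  rewrite -(card_in_imset rI); apply: leq_trans (max_card _) _.
  by rewrite card_ffun card_sig card_ord.
rewrite expnS leq_mul //; first by rewrite leq_pmull.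
apply: leq_trans cB _; case: #|Dm| => // d; rewrite leq_exp2r //; lia.
Qed.

Definition lift_pattern (Z : {set {set V'}}) : pred {set V} :=
  fun S => [exists S' in Z, S == pi @^-1: S']%SET.

(** Among the sums of [y], exactly those vanish whose vanishing is imposed by the zero pattern [Z]
    downstairs. *)
Definition generic (Z : {set {set V'}}) (y : V -> nat) : bool :=
  [forall S, (bsum (svec y) S == 0) == lift_pattern Z S].

(** A zero sum over a union of fibres is a zero sum of [x'], hence accounted for by [Z]. An
    unexpected zero must come from a set that cuts a fibre. *)
Lemma nongeneric_unsaturated N x' (Z : {set {set V'}}) (x : {ffun V -> 'I_N.+1}) :
  (forall S', (bsum (svec x') S' == 0) = (S' \in Z)) -> x \in lifts N x' ->
  ~~ generic Z (fun v => x v) ->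
  exists2 S, S \in unsaturated & bsum (svec (fun v => x v : nat)) S == 0.
Proof.
move=> xZ xl; rewrite negb_forall => /existsP[S].
have [/exists_inP[S' S'Z /eqP->]|nS] := boolP (lift_pattern Z S).
  by rewrite (bsum_lift _ xl) xZ S'Z.
rewrite eqbF_neg negbK => S0; exists S => //; apply: contraNT nS => nU.
have SE : S = (pi @^-1: (pi @: S))%SET.
  apply/setP => v; rewrite inE; apply/idP/imsetP => [vS|[u uS puv]]; first by exists v.
  apply: contraNT nU => vS; rewrite inE; apply/exists_inP; exists u => //.
  by apply/existsP; exists v; rewrite vS puv eqxx.
apply/exists_inP; exists (pi @: S)%SET; last by rewrite -SE.
by rewrite -xZ -(bsum_lift _ xl) -SE.
Qed.

(** All generic lifts have the same zero pattern, so [tree_count_const] applies. The value is read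
    off at any balanced generic vector, and is 0 by default if none exists. *)
Lemma generic_count (Z : {set {set V'}}) : exists c : nat, forall N x' (x : {ffun V -> 'I_N.+1}),
  \sum_v svec x' v = 0 -> x \in lifts N x' -> generic Z (fun v => x v) ->
  tree_count n (fun S => 0 < bsum (svec (fun v => x v : nat)) S) = c.
Proof.
pose Q (y : V -> nat) := [/\ balanced_vec (svec y) & generic Z y].
have HQ N x' (x : {ffun V -> 'I_N.+1}) : \sum_v svec x' v = 0 -> x \in lifts N x' ->
    generic Z (fun v => x v) -> Q (fun v => x v : nat).
  move=> x'0 xl xg; split=> //; have := bsum_lift [set: V']%SET xl.
  rewrite preimsetT !bsumT x'0; move: xl; rewrite inE => /andP[/forallP x0 _] sx; split=> // [i|j].
    by rewrite /= ltr0n.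
  by rewrite /= oppr_lt0 ltr0n.
have [[y yQ]|nQ] := pselect (exists y, Q y); last first.
  by exists 0%N => N x' x x'0 xl xg; case: nQ; exists (fun v => x v : nat); apply: HQ xl xg.
exists (tree_count n (fun S => 0 < bsum (svec y) S)) => N x' x x'0 xl xg.
have [xb _] := HQ _ _ _ x'0 xl xg; have [yb yg] := yQ.
apply: tree_count_const => // S.
by rewrite (eqP (forallP xg S)) (eqP (forallP yg S)).
Qed.

(** The leading form is the common tree count of the generic lifts times the leading form of the
    number of lifts. The other lifts satisfy one of finitely many extra linear conditions and number
    one order less. *)
Lemma tree_leading (Z : {set {set V'}}) : exists2 P, hpol (#|{: V}| - #|{: V'}|) P &
  exists2 C : rat, 0 <= C & forall N x', (0 < N)%N -> (forall v', 0 < x' v')%N ->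
    (forall v', x' v' <= N)%N -> \sum_v svec x' v = 0 ->
    (forall S', (bsum (svec x') S' == 0) = (S' \in Z)) ->
    N%:R * `|wcount (push phi psi (@tree_weight n I J)) N x' - P (svec x')| <=
      C * N%:R ^+ (#|{: V}| - #|{: V'}|).
Proof.
have [c cP] := generic_count Z; have [Q pQ QE] := card_lifts_polt.
have [h hh hQ] := polt_top pQ; have [Cq [Cq0 HCq]] := polt_growth hQ.
set d := (#|{: V}| - #|{: V'}|)%N in pQ hh hQ HCq *.
exists (fun y => c%:R * h y); first exact: hpol_scale.
pose K := ((\sum_(s : {ffun 'I_n -> I * J}) cfact s)%N%:R + c%:R : rat).
exists (K * (#|unsaturated| * 2 ^ d)%N%:R + c%:R * Cq).
  by rewrite addr_ge0 ?mulr_ge0 ?addr_ge0.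
move=> N x' N0 x0 xN x'0 xZ; rewrite wcount_tree //.
pose tc (x : {ffun V -> 'I_N.+1}) := tree_count n (fun S => 0 < bsum (svec (fun v => x v : nat)) S).
rewrite -/(tc _).
pose B := [set x in lifts N x' | ~~ generic Z (fun v => x v)]%SET.
have BN : (N * #|B| <= #|unsaturated| * (2 * N) ^ d)%N.
  have sB : B \subset \bigcup_(S in unsaturated)
      [set x in lifts N x' | bsum (svec (fun v => x v : nat)) S == 0]%SET.
    apply/fintype.subsetP => x; rewrite finset.in_set => /andP[xl xg].
    have [S SU S0] := nongeneric_unsaturated xZ xl xg.
    by apply/bigcupP; exists S => //; rewrite finset.in_set xl S0.
  apply: leq_trans (_ : N * \sum_(S in unsaturated)
      #|[set x in lifts N x' | bsum (svec (fun v => x v : nat)) S == 0%R]%SET| <= _)%N.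
    rewrite leq_mul2l; apply/orP; right; apply: leq_trans (subset_leq_card sB) _.
    by elim/big_rec2: _ => [|S m A _ Am]; rewrite ?cards0 // (leq_trans (leq_card_setU _ _)) // leq_add2l.
  rewrite big_distrr /= -sum_nat_const; apply: leq_sum => S SU; exact: card_lifts_null.
have E : \sum_(x in lifts N x') (tc x)%:R - c%:R * #|lifts N x'|%:R =
    \sum_(x in B) ((tc x)%:R - c%:R) :> rat.
  rewrite -sum1_card natr_sum mulr_sumr -sumrB (bigID (fun x : {ffun V -> 'I_N.+1} => generic Z (fun v => x v))) /=.
  rewrite big1 ?add0r => [|x /andP[xl xg]]; last by rewrite mulr1 /tc (cP N x') ?subrr.
  by apply: eq_big => [x|x _]; rewrite ?finset.in_set ?mulr1.
have tcK x : `|(tc x)%:R - c%:R : rat| <= K.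
  apply: le_trans (ler_normB _ _) _; rewrite !normr_nat lerD2r ler_nat.
  by rewrite /tc /tree_count big_mkcond; apply: leq_sum => s _; case: ifP.
have NB : N%:R * `|\sum_(x in B) ((tc x)%:R - c%:R)| <= K * (#|unsaturated| * 2 ^ d)%N%:R * N%:R ^+ d :> rat.
  apply: le_trans (_ : N%:R * (#|B|%:R * K) <= _).
    rewrite ler_wpM2l //; apply: le_trans (ler_norm_sum _ _ _) _.
    rewrite -sum1_card natr_sum mulr_suml; apply: ler_sum => x _; by rewrite mul1r.
  rewrite mulrA mulrC -mulrA ler_wpM2l ?addr_ge0 // -natrX -!natrM ler_nat.
  by rewrite -mulnA -expnMn.
have Q1 : N%:R * (c%:R * `|Q (svec x') - h (svec x')|) <= c%:R * Cq * N%:R ^+ d.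
  rewrite mulrCA -mulrA ler_wpM2l //; apply: HCq; first by rewrite ler1n.
  by move=> v; rewrite svec_eps normrM normr_nat; case: v => v /=; rewrite ?normrN normr1 mul1r ler_nat.
apply: le_trans (_ : N%:R * (`|\sum_(x in B) ((tc x)%:R - c%:R)| +
    c%:R * `|Q (svec x') - h (svec x')|) <= _); last by rewrite mulrDr mulrDl lerD.
rewrite ler_wpM2l //.
have -> : c%:R * `|Q (svec x') - h (svec x')| = `|c%:R * (Q (svec x') - h (svec x'))|.
  by rewrite normrM normr_nat.
apply: le_trans (ler_normD _ _).
rewrite -E (QE N x') // mulrBr.
by rewrite addrA subrK.
Qed.

End Lifts.

(** The error is multiplied by [N] as in [polt_growth]. Both [P] and [C] depend on the zero pattern
    [Z] only, not on signs. *)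
Definition has_leading n (I J : finType) (kappa : {ffun 'I_n -> I * J} -> rat) : Prop :=
  forall Z : {set {set I + J}}, exists2 P, hpol (n.+1 - #|{: I + J}|) P &
  exists2 C : rat, 0 <= C & forall N (x : I + J -> nat), (0 < N)%N -> (forall v, 0 < x v)%N ->
    (forall v, x v <= N)%N -> \sum_v svec x v = 0 ->
    (forall S, (bsum (svec x) S == 0) = (S \in Z)) ->
    N%:R * `|wcount kappa N x - P (svec x)| <= C * N%:R ^+ (n.+1 - #|{: I + J}|).

Lemma has_leading_ext n (I J : finType) (k1 k2 : {ffun 'I_n -> I * J} -> rat) :
  has_leading k1 -> k1 =1 k2 -> has_leading k2.
Proof.
move=> H E Z; have [P hP [C C0 HC]] := H Z; exists P => //; exists C => // N x N0 x0 xN xs xZ.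
rewrite (_ : wcount k2 N x = wcount k1 N x); first exact: HC.
by apply: eq_bigr => s _; rewrite E.
Qed.

Lemma push_comp n (I J I' J' I2 J2 : finType) (phi : I -> I') (psi : J -> J') (phi' : I' -> I2)
    (psi' : J' -> J2) (k : {ffun 'I_n -> I * J} -> rat) :
  push phi' psi' (push phi psi k) =1 push (phi' \o phi) (psi' \o psi) k.
Proof.
move=> s2; rewrite /push; rewrite [RHS](partition_big (relabel phi psi) (fun s' => relabel phi' psi' s' == s2)) /=.
  apply: eq_bigr => s' /eqP s's; apply: eq_bigl => s; case: (eqVneq (relabel phi psi s) s') => [E|]; last by rewrite andbF.
  rewrite andbT -s's -E; apply/esym/eqP/ffunP => e; by rewrite !ffunE.
move=> s /eqP<-; apply/eqP/ffunP => e; by rewrite !ffunE.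
Qed.

Lemma push_id n (I J : finType) (k : {ffun 'I_n -> I * J} -> rat) : push id id k =1 k.
Proof.
move=> s; rewrite /push (big_pred1 s) // => t /=.
by rewrite (_ : relabel id id t = t) //; apply/ffunP => e; rewrite ffunE; case: (t e).
Qed.

Lemma onto_comp (A B C : finType) (f : A -> B) (g : B -> C) : onto f -> onto g -> onto (g \o f).
Proof.
move=> /ontoP fo /ontoP go; apply/ontoP => c.
by have [b <-] := go c; have [a <-] := fo b; exists a.
Qed.

(** Stated for all push-forwards so that the induction passes through [treelike_push], where the two
    mergings are composed. *)
Lemma treelike_push_leading n (I J : finType) (kappa : {ffun 'I_n -> I * J} -> rat) :
  treelike kappa -> forall (I' J' : finType) (phi : I -> I') (psi : J -> J'),
  onto phi -> onto psi -> has_leading (push phi psi kappa).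
Proof.
elim=> {I J kappa}.
- move=> I J I0 J0 cV I' J' phi psi fo po Z.
  have := tree_leading fo po cV I0 J0 Z.
  by rewrite [#|{: I + J}|]card_sum cV.
- move=> I J I1 J1 phi1 psi1 k fo1 po1 _ IH I' J' phi psi fo po.
  apply: has_leading_ext (IH _ _ (phi \o phi1) (psi \o psi1) _ _) _; try exact: onto_comp.
  by move=> s; rewrite push_comp.
- move=> I J I' J' phi psi fo po Z; exists (fun=> 0); first exact: hpol_zero.
  exists 0 => // N x *; rewrite subr0 mul0r.
  rewrite (_ : wcount _ N x = 0) ?normr0 ?mulr0 //; apply: big1 => s _.
  by rewrite /push big1 ?mul0r.
- move=> I J a k1 k2 _ IH1 _ IH2 I' J' phi psi fo po Z.
  have [P1 h1 [C1 C10 H1]] := IH1 _ _ _ _ fo po Z.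
  have [P2 h2 [C2 C20 H2]] := IH2 _ _ _ _ fo po Z.
  exists (fun y => P1 y + a * P2 y); first exact/hpol_add/hpol_scale.
  exists (C1 + `|a| * C2) => [|N x N0 x0 xN xs xZ]; first by rewrite addr_ge0 ?mulr_ge0.
  have := H1 _ _ N0 x0 xN xs xZ; have := H2 _ _ N0 x0 xN xs xZ.
  rewrite (_ : wcount (push phi psi (fun s => k1 s + a * k2 s)) N x =
     wcount (push phi psi k1) N x + a * wcount (push phi psi k2) N x); last first.
    rewrite /wcount mulr_sumr -big_split; apply: eq_bigr => s _ /=.
    by rewrite /push big_split /= -mulr_sumr mulrDl mulrA.
  move: (wcount _ _ _) (wcount _ _ _) => w1 w2 E2 E1.
  apply: le_trans (_ : N%:R * (`|w1 - P1 (svec x)| + `|a| * `|w2 - P2 (svec x)|) <= _).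
    rewrite ler_wpM2l // -normrM; apply: le_trans (ler_normD _ _).
    by rewrite le_eqVlt; apply/orP; left; apply/eqP; congr `|_|; ring.
  rewrite mulrDr mulrDl lerD // mulrCA -mulrA ler_wpM2l //.
- move=> I J k1 k2 _ IH E I' J' phi psi fo po.
  by apply: has_leading_ext (IH _ _ _ _ fo po) _ => s; apply: eq_bigr => t _; rewrite E.
Qed.

Theorem treelike_leading n (I J : finType) (kappa : {ffun 'I_n -> I * J} -> rat) :
  treelike kappa -> has_leading kappa.
Proof.
move=> kt; apply: has_leading_ext (push_id kappa).
by apply: treelike_push_leading kt _ _ _ _ _ _; apply/ontoP => v; exists v.
Qed.

(** * Strata and their components *)

Lemma hpol_homog (V : finType) d (f : (V -> rat) -> rat) (c : rat) x : hpol d f ->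
  f (fun v => c * x v) = c ^+ d * f x.
Proof.
elim=> {d f}.
- by move=> d; rewrite mulr0.
- by move=> a; rewrite expr0 mul1r.
- by move=> v; rewrite expr1.
- by move=> d f g _ -> _ ->; rewrite mulrDr.
- by move=> d e f g _ -> _ ->; rewrite exprD mulrACA.
- by move=> d f g _ E fg; rewrite -!fg.
Qed.

(** * Polynomial functions as multivariate polynomials *)

Section ToMpoly.
Variables (R : realType) (k l : nat).
Notation V := ('I_k + 'I_l)%type.

(** The last [l] variables are the white perimeters, hence the negatives of the coordinates of
    [svec]. *)
Definition signed_coord (b : V -> rat) (i : 'I_(k + l)) : R :=
  ratr (match fintype.split i with inl a => b (inl a) | inr c => - b (inr c) end).

Lemma var_mpoly v : exists p : mpoly (k + l) R, [/\ p \is ishomog1 1 mdeg, (msize p <= 2)%N &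
  forall b, meval (signed_coord b) p = ratr (b v)].
Proof.
case: v => [a|c].
  exists (mpolyX R (mnm1 (lshift l a))); split; first by rewrite dhomogX /= mdeg1.
    by rewrite msizeX mdeg1.
  by move=> b; rewrite mevalXU /signed_coord (unsplitK (inl a)).
exists (- mpolyX R (mnm1 (rshift k c))); split; first by rewrite dhomogN dhomogX /= mdeg1.
  by rewrite mmeasureN msizeX mdeg1.
by move=> b; rewrite mevalN mevalXU /signed_coord (unsplitK (inr c)) rmorphN opprK.
Qed.

Lemma hpol_mpoly d f : hpol d f -> exists2 p : mpoly (k + l) R, p \is ishomog1 d mdeg &
  forall b, meval (signed_coord b) p = ratr (f b).
Proof.
elim=> {d f}.
- by move=> d; exists 0; [exact: dhomog0|move=> b; rewrite meval0 rmorph0].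
- move=> c; exists (mpolyC (k + l) (ratr c)); last by move=> b; rewrite mevalC.
  by rewrite -[mpolyC _ _]mulr1 mul_mpolyC dhomogZ // dhomog1.
- by move=> v; have [p [h1 _ h2]] := var_mpoly v; exists p.
- move=> d f g _ [p hp pE] _ [q hq qE]; exists (p + q); first exact: dhomogD.
  by move=> b; rewrite mevalD pE qE rmorphD.
- move=> d e f g _ [p hp pE] _ [q hq qE]; exists (p * q); first exact: dhomogM.
  by move=> b; rewrite mevalM pE qE rmorphM.
- by move=> d f g _ [p hp pE] fg; exists p => // b; rewrite pE fg.
Qed.

Lemma polt_mpoly d f : polt d f -> exists2 p : mpoly (k + l) R, (msize p <= d)%N &
  forall b, meval (signed_coord b) p = ratr (f b).
Proof.
elim=> {d f}.
- by move=> d; exists 0; [rewrite mmeasure0|move=> b; rewrite meval0 rmorph0].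
- move=> c; exists (mpolyC (k + l) (ratr c)); last by move=> b; rewrite mevalC.
  by rewrite mmeasureC; case: eqP.
- by move=> v; have [p [_ h1 h2]] := var_mpoly v; exists p.
- move=> d f g _ [p hp pE] _ [q hq qE]; exists (p + q).
    by apply: leq_trans (mmeasureD_le _ _ _) _; rewrite geq_max hp.
  by move=> b; rewrite mevalD pE qE rmorphD.
- move=> d e f g _ [p hp pE] _ [q hq qE]; exists (p * q).
    have [->|p0] := eqVneq p 0; first by rewrite mul0r mmeasure0.
    have [->|q0] := eqVneq q 0; first by rewrite mulr0 mmeasure0.
    rewrite msizeM //; apply: leq_trans (_ : (d.+1 + e.+1).-1 <= _)%N; last by rewrite addnS.
    by rewrite -!subn1 leq_sub2r // leq_add.
  by move=> b; rewrite mevalM pE qE rmorphM.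
- by move=> d e f _ [p hp pE] de; exists p => //; exact: leq_trans de.
- by move=> d f g _ [p hp pE] fg; exists p => // b; rewrite pE fg.
Qed.

End ToMpoly.

(** * Signs of wall forms on the components of a stratum *)

Section Components.
Variables (R : realType) (k l : nat).
Local Open Scope classical_set_scope.
Local Notation space := ('rV[R]_k * 'rV[R]_l)%type.
Implicit Types (S : {set 'I_k + 'I_l}) (y : space) (W : set space).

Definition wall_form S y : R :=
  \sum_(i | inl i \in S) y.1 0 i - \sum_(j | inr j \in S) y.2 0 j.

Lemma continuous_bigsum (I : Type) (r : seq I) (P : pred I) (f : I -> space -> R) :
  (forall i, continuous (f i)) -> continuous (fun y => \sum_(i <- r | P i) f i y).
Proof.
move=> fc; elim: r => [|i r IH].
  by rewrite (_ : (fun _ => _) = fun=> 0); [move=> y; exact: cvg_cst|apply/funext => y; rewrite big_nil].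
have [Pi|Pi] := boolP (P i).
  rewrite (_ : (fun _ => _) = fun y => f i y + \sum_(j <- r | P j) f j y).
    by move=> y; apply: cvgD; [exact: fc|exact: IH].
  by apply/funext => y; rewrite big_cons Pi.
rewrite (_ : (fun _ => _) = fun y => \sum_(j <- r | P j) f j y) //.
by apply/funext => y; rewrite big_cons (negPf Pi).
Qed.

Lemma wall_form_continuous S : continuous (wall_form S).
Proof.
move=> y; apply: cvgB; apply: continuous_bigsum => i {}y.
  apply: (@continuous_comp _ _ _ fst (fun M : 'rV[R]_k => M 0 i)); first exact: cvg_fst.
  exact: coord_continuous.
apply: (@continuous_comp _ _ _ snd (fun M : 'rV[R]_l => M 0 i)); first exact: cvg_snd.
exact: coord_continuous.
Qed.

Lemma flat_balanced W : flats W -> W `<=` @balanced R k l.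
Proof. by case=> F _ -> y []. Qed.

(** Otherwise [W] cut by the wall of [S] would be a strictly smaller flat through [y], which
    [flat_core] excludes. The empty and the full set define no wall, but their forms vanish on
    [balanced]. *)
Lemma stratum_form0 W y S : flats W -> stratum W y -> wall_form S y = 0 ->
  forall z, W z -> wall_form S z = 0.
Proof.
move=> fW [_ [Wy core]] y0 z Wz; have zb := flat_balanced fW Wz.
pose A := [set i | inl i \in S]%SET; pose B := [set j | inr j \in S]%SET.
have formE u : wall_form S u = \sum_(i in A) u.1 0 i - \sum_(j in B) u.2 0 j.
  by congr (_ - _); apply: eq_bigl => v; rewrite inE.
have [[A0 B0]|AB] := pselect ((A, B) = (finset.set0, finset.set0)).
  by rewrite formE A0 B0 !big_set0 subrr.
have [[A1 B1]|AB'] := pselect ((~: A, ~: B)%SET = (finset.set0, finset.set0)).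
  have AT : A = [set: 'I_k]%SET by rewrite -[A]finset.setCK A1 finset.setC0.
  have BT : B = [set: 'I_l]%SET by rewrite -[B]finset.setCK B1 finset.setC0.
  rewrite formE AT BT (eq_bigl predT) => [|i]; last by rewrite inE.
  rewrite [X in _ - X](eq_bigl predT) => [|i]; last by rewrite inE.
  by apply/eqP; rewrite subr_eq0; apply/eqP.
have wf : walls (wall A B) by exists A, B.
suff : W `<=` wall A B.
  by move=> /(_ z Wz)[_ H]; rewrite formE H subrr.
apply: contrapT => nW; apply: core; exists (W `&` wall A B); last first.
  split=> //; split; first exact: flat_balanced fW _ Wy.
  by apply/eqP; rewrite -subr_eq0 -formE y0.
split; last by split=> [u []//|H]; apply: nW => u /H[].
case: fW => F FW ->; exists (F `|` [set wall A B]).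
  by move=> V [/FW//|->].
apply/seteqP; split=> u.
  by case=> [[ub uF] uw]; split=> // V [/uF//|->].
case=> ub uF; split; last by apply: uF; right.
by split=> // V FV; apply: uF; left.
Qed.

(** A form that is nonzero at one point of the stratum has no zero on it, so it keeps its sign on a
    connected subset by the intermediate value property. *)
Lemma component_sg W x y S : flats W -> stratum W x ->
  connected_component (stratum W) x y -> Num.sg (wall_form S y) = Num.sg (wall_form S x).
Proof.
move=> fW sx [C [Cx CW cC] Cy].
have [x0|xn0] := eqVneq (wall_form S x) 0.
  rewrite x0 (stratum_form0 fW sx x0) //; by case: (CW _ Cy) => _ [].
have n0 z : C z -> wall_form S z != 0.
  move=> Cz; apply/eqP => z0; case/eqP: xn0.
  by apply: stratum_form0 fW (CW _ Cz) z0 _ _; case: sx => _ [].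
have cI : connected (wall_form S @` C).
  apply: connected_continuous_connected => //.
  exact/continuous_subspaceT/wall_form_continuous.
have /connected_intervalP iI := cI.
have no a b : C a -> C b -> wall_form S a < 0 -> 0 < wall_form S b -> False.
  move=> Ca Cb a0 b0; have [z Cz z0] : (wall_form S @` C) 0.
    apply: (iI (wall_form S a) (wall_form S b)); [by exists a|by exists b|].
    by rewrite !ltW.
  by have := n0 z Cz; rewrite z0 eqxx.
have [x1|x1|/eqP x1] := ltrgtP (wall_form S x) 0; last by rewrite (negPf xn0) in x1.
- have [y1|y1|/eqP y1] := ltrgtP (wall_form S y) 0; last by rewrite (negPf (n0 y Cy)) in y1.
    by rewrite !ltr0_sg.
  by case: (no x y).
- have [y1|y1|/eqP y1] := ltrgtP (wall_form S y) 0; last by rewrite (negPf (n0 y Cy)) in y1.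
    by case: (no y x).
  by rewrite !gtr0_sg.
Qed.

End Components.

(* The leading form [h] of the difference between the polynomial of a cell and
   [P] vanishes at the points [x] of the cell: along the ray through [x] this
   difference is [O(t^(d-1))]. *)
Theorem wcount_leading n (I J : finType) (kappa : {ffun 'I_n -> I * J} -> rat)
    (Z : {set {set I + J}}) : treelike kappa ->
  exists2 P, hpol (n.+1 - #|{: I + J}|) P & forall sg : {set I + J} -> rat,
    exists2 Q, polt (n.+1 - #|{: I + J}|) Q & forall N (x : I + J -> nat), (0 < N)%N ->
      (forall v, 0 < x v)%N -> (forall v, x v <= N)%N -> \sum_v svec x v = 0 ->
      (forall S, (bsum (svec x) S == 0) = (S \in Z)) ->
      (forall S, Num.sg (bsum (svec x) S) = sg S) ->
      wcount kappa N x = P (svec x) + Q (svec x).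
Proof.
move=> kt; have [P hP [C C0 HC]] := treelike_leading kt Z; exists P => // sg.
have [Q pQ QE] := wcount_cell kt sg.
have [h hh hr] := polt_top (polt_sub pQ (hpol_polt hP)).
have [C' [C'0 HC']] := polt_growth hr.
exists (fun y => Q y - P y - h y) => // N x N0 x0 xN xs xZ xsg.
suff h0 : h (svec x) = 0 by rewrite h0 subr0 (QE N) // addrC subrK.
set d := (n.+1 - _)%N in HC HC' hh hr *.
(* The point [t x] has the zero pattern and the signs of [x], so both estimates hold there;
   homogeneity of [h] lets [t^d] be cancelled and leaves a spare factor [t] on the left. *)
have ray (t : nat) : (0 < t)%N -> t%:R * (N%:R * `|h (svec x)|) <= (C + C') * N%:R ^+ d.
  move=> t0; pose xt v := (t * x v)%N; have tN : (0 < t * N)%N by rewrite muln_gt0 t0.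
  have xtE : svec xt = (fun v => t%:R * svec x v).
    by apply/funext => -[v|v]; rewrite /= /xt natrM ?mulrN.
  have bsE S : bsum (svec xt) S = t%:R * bsum (svec x) S by rewrite xtE /bsum mulr_sumr.
  have tr0 : 0 < t%:R :> rat by rewrite ltr0n.
  have xt0 v : (0 < xt v)%N by rewrite muln_gt0 t0 x0.
  have xtN v : (xt v <= t * N)%N by rewrite leq_mul2l xN orbT.
  have xts : \sum_v svec xt v = 0 by rewrite -bsumT bsE bsumT xs mulr0.
  have xtZ S : (bsum (svec xt) S == 0) = (S \in Z).
    by rewrite bsE mulf_eq0 (gt_eqF tr0) /= xZ.
  have E1 := HC _ _ tN xt0 xtN xts xtZ.
  have E2 : (t * N)%:R * `|Q (svec xt) - P (svec xt) - h (svec xt)| <= C' * (t * N)%:R ^+ d.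
    apply: HC' => [|v]; first by rewrite ler1n.
    by rewrite svec_eps normrM normr_nat; case: v => v /=; rewrite ?normrN normr1 mul1r ler_nat.
  rewrite (QE (t * N)%N xt) // in E1; last by move=> S; rewrite bsE sgrM gtr0_sg // mul1r.
  have E3 : (t * N)%:R * `|h (svec xt)| <= (C + C') * (t * N)%:R ^+ d.
    apply: le_trans (_ : (t * N)%:R * (`|Q (svec xt) - P (svec xt)| +
        `|Q (svec xt) - P (svec xt) - h (svec xt)|) <= _); last by rewrite mulrDr mulrDl lerD.
    rewrite ler_wpM2l // -{1}[h _](subKr (Q (svec xt) - P (svec xt))).
    exact: ler_normB.
  move: E3; rewrite xtE (hpol_homog _ _ hh) normrM normrX normr_nat natrM exprMn.
  have td0 : 0 < t%:R ^+ d :> rat by rewrite exprn_gt0.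
  rewrite [X in X <= _](_ : _ = t%:R ^+ d * (t%:R * (N%:R * `|h (svec x)|))); last by ring.
  by rewrite [X in _ <= X]mulrCA ler_pM2l.
apply/eqP; apply: contraT => hn0.
have a0 : 0 < N%:R * `|h (svec x)| by rewrite mulr_gt0 ?ltr0n // normr_gt0.
pose y := (C + C') * N%:R ^+ d / (N%:R * `|h (svec x)|).
have y0 : 0 <= y by rewrite divr_ge0 ?mulr_ge0 ?addr_ge0 ?exprn_ge0 // ltW.
have := archi_boundP y0; set t := Num.bound y => yt.
have t0 : (0 < t)%N by rewrite -(ltr_nat rat); exact: le_lt_trans yt.
by have := ray t t0; rewrite leNgt -ltr_pdivrMr // yt.
Qed.

Lemma wall_form_int_point (R : realType) (k l : nat) (L : 'rV[int]_k) (L' : 'rV[int]_l)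
    (x : 'I_k + 'I_l -> nat) S :
  (forall i, L 0 i = Posz (x (inl i))) -> (forall j, L' 0 j = Posz (x (inr j))) ->
  wall_form S (int_point R L L') = ratr (bsum (svec x) S).
Proof.
move=> Lx L'x; rewrite /bsum rmorph_sum big_sumType /= /wall_form -sumrN.
congr (_ + _); apply: eq_bigr => v _; rewrite !mxE ?Lx ?L'x /=.
  by rewrite rmorph_nat.
by rewrite rmorphN rmorph_nat.
Qed.

Lemma peval_int_point (R : realType) (k l : nat) (L : 'rV[int]_k) (L' : 'rV[int]_l)
    (x : 'I_k + 'I_l -> nat) (p : mpoly (k + l) R) :
  (forall i, L 0 i = Posz (x (inl i))) -> (forall j, L' 0 j = Posz (x (inr j))) ->
  peval p (int_point R L L') = meval (signed_coord R (svec x)) p.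
Proof.
move=> Lx L'x; apply: meval_eq => i; rewrite mxE /signed_coord.
case: (fintype.split i) => v; rewrite mxE ?Lx ?L'x /=; first by rewrite rmorph_nat.
by rewrite opprK rmorph_nat.
Qed.

(* [msize Q] is the degree of Q plus one, or 0 when Q = 0. *)
Theorem theorem2p3 (R : realType) (g k l : nat) (hk : (0 < k)%N) (hl : (0 < l)%N)
    (W : set ('rV[R]_k * 'rV[R]_l)) (hW : flats W) :
  exists P : mpoly (k + l) R,
    P \is ishomog1 (2 * g) mdeg /\
    forall x : 'rV[R]_k * 'rV[R]_l, stratum W x ->
      exists Q : mpoly (k + l) R,
        (msize Q <= 2 * g)%N /\
        forall (L : 'rV[int]_k) (L' : 'rV[int]_l),
          connected_component (stratum W) x (int_point R L L') ->
          ratr (weighted_count g L L') =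
            peval P (int_point R L L') +
            peval Q (int_point R L L').
Proof.
pose n := (2 * g + k + l).-1; have n0 : (0 < n)%N by rewrite /n; lia.
pose kappa (s : {ffun 'I_n -> 'I_k * 'I_l}) : rat := (nb_gluings s)%:R.
have kt : treelike kappa by apply: treelike_gluings => //; rewrite card_ord.
(* By [stratum_form0] this is the zero pattern of every point of the stratum, so one form [P] serves
   all its components. *)
pose Z := [set S : {set 'I_k + 'I_l} | `[< forall z, W z -> wall_form S z = 0 >]]%SET.
have [P hP HP] := wcount_leading Z kt.
have dE : (n.+1 - #|{: 'I_k + 'I_l}| = 2 * g)%N by rewrite card_sum !card_ord /n; lia.
rewrite dE in hP HP; pose c : rat := ((n`!)%:R)^-1.
have [p hp pE] := hpol_mpoly R (hpol_scale c hP).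
exists p; split=> // x sx.
(* By [component_sg] these signs hold on the whole component of [x], which makes [Q] valid on all of
   it. *)
pose sg S : rat := if 0 < wall_form S x then 1 else if wall_form S x < 0 then -1 else 0.
have [Q pQ QE] := HP sg; have [q hq qE] := polt_mpoly R (polt_scale c pQ).
exists q; split=> // L L' cx; set y := int_point R L L' in cx *.
have sy : stratum W y := connected_component_sub cx.
have [[yb yL yL'] _] := sy.
pose xx (v : 'I_k + 'I_l) := match v with inl i => absz (L 0 i) | inr j => absz (L' 0 j) end.
have Lx i : L 0 i = Posz (xx (inl i)).
  by have := yL i; rewrite mxE ltr0z => L0; rewrite /= gez0_abs // ltW.
have L'x j : L' 0 j = Posz (xx (inr j)).
  by have := yL' j; rewrite mxE ltr0z => L0; rewrite /= gez0_abs // ltW.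
have x0 v : (0 < xx v)%N.
  case: v => v; [have := yL v|have := yL' v]; rewrite mxE ltr0z /= => L0; lia.
pose N := (\sum_v xx v)%N.
have xN v : (xx v <= N)%N by rewrite /N (bigD1 v) //= leq_addr.
have N0 : (0 < N)%N by apply: leq_trans (xN (inl (Ordinal hk))).
have formE S : wall_form S y = ratr (bsum (svec xx) S) by exact: wall_form_int_point.
have ratr0 (a : rat) : (ratr a == 0 :> R) = (a == 0) by rewrite fmorph_eq0.
have xs : \sum_v svec xx v = 0.
  apply/eqP; rewrite -bsumT -ratr0 -formE /wall_form.
  rewrite (eq_bigl predT) => [|i]; last by rewrite inE.
  by rewrite [X in _ - X](eq_bigl predT) => [|i]; [rewrite yb subrr|rewrite inE].
have xZ S : (bsum (svec xx) S == 0) = (S \in Z).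
  rewrite -ratr0 -formE inE; apply/eqP/asboolP => [|H]; last by apply: H; case: sy => _ [].
  exact: stratum_form0.
have xsg S : Num.sg (bsum (svec xx) S) = sg S.
  have := component_sg S hW sx cx; rewrite formE /sg.
  have [b0|b0|b0] := ltrgtP (bsum (svec xx) S) 0.
  - rewrite (ltr0_sg b0) ltr0_sg ?ltrq0 // => /esym/eqP; rewrite sgr_cp0 => h.
    by rewrite (lt_gtF h) h.
  - by rewrite (gtr0_sg b0) gtr0_sg ?ltr0q // => /esym/eqP; rewrite sgr_cp0 => ->.
  - by rewrite b0 rmorph0 !sgr0 => /esym/eqP; rewrite sgr_eq0 => /eqP->; rewrite ltxx.
rewrite (peval_int_point _ Lx L'x) (peval_int_point _ Lx L'x) pE qE -rmorphD; congr ratr.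
rewrite -mulrDr -(QE N) // (weighted_countE n0 hk hl (erefl n) (fun i => Lx i) (fun j => L'x j) (fun i => xN (inl i))) //.
Qed.
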